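(* Let $G_1,G_2$ be Orlicz functions and let $w_1=(w^{(1)}_k)_{k\ge1}$, $w_2=(w^{(2)}_k)_{k\ge1}$ be weight sequences such that the Orlicz–Lorentz sequence spaces $\lambda_{w_1,G_1}$ and $\lambda_{w_2,G_2}$ are separable. For an exponent $p$ let $p^*$ be given by $\frac1p+\frac1{p^*}=1$. (a) If $1\le p,q<\infty$ satisfy $q\le p^*$, the functions $t\mapsto G_1(t^{1/p})$ and $t\mapsto G_2(t^{1/q})$ are equivalent to concave functions, and $n\mapsto\sum_{k=1}^n w^{(1)}_k$ and $n\mapsto\sum_{k=1}^n w^{(2)}_k$ are convex, then the injective tensor product $\lambda_{w_1,G_1}\widehat{\widehat{\otimes}}\lambda_{w_2,G_2}$ is not isomorphic to any subspace of a Banach space with an unconditional basis. (b) If $1<p,q<\infty$ satisfy $p^*\le q$, the functions $t\mapsto G_1(t^{1/p})$ and $t\mapsto G_2(t^{1/q})$ are equivalent to convex functions, and $n\mapsto\sum_{k=1}^n w^{(1)}_k$ and $n\mapsto\sum_{k=1}^n w^{(2)}_k$ are concave, then the projective tensor product $\lambda_{w_1,G_1}\widehat{\otimes}\lambda_{w_2,G_2}$ is not isomorphic to any subspace of a Banach space with an unconditional basis.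
   Context: For a scalar sequence $x$ converging to zero, $x^*=(x^*_k)$ is the non-increasing rearrangement of $|x|=(|x_k|)$. An Orlicz function is a convex function $G:[0,\infty)\to[0,\infty)$ that vanishes only at $0$. A weight sequence is a non-increasing sequence $w=(w_k)$ of positive reals with $\sum_{k=1}^\infty w_k=\infty$. The Orlicz–Lorentz sequence space is $$\lambda_{w,G}=\Big\{x=(x_k)\in c_0:\ \sum_{k=1}^\infty G(\lambda x_k^* )w_k<\infty\ \text{for some }\lambda>0\Big\},$$ with norm $\|x\|_{w,G}=\inf\{\lambda>0:\sum_{k=1}^\infty G(x_k^*/\lambda)w_k\le1\}$. Two functions $G_1,G_2:[0,\infty)\to[0,\infty)$ are equivalent if there is a constant $0<c<\infty$ with $G_1(c^{-1}t)\le G_2(t)\le G_1(ct)$ for all $t\in[0,\infty)$. For Banach spaces $E,F$, the projective norm on the algebraic tensor product $E\otimes F$ is $\pi(u)=\inf\{\sum_{i=1}^n\|x_i\|_E\|y_i\|_F: u=\sum_{i=1}^n x_i\otimes y_i\}$, and the injective norm of $u=\sum_{i=1}^n x_i\otimes y_i$ is $\varepsilon(u)=\sup\{|\sum_{i=1}^n\varphi(x_i)\psi(y_i)|:\varphi\in E^*,\|\varphi\|\le1,\psi\in F^*,\|\psi\|\le1\}$. $E\widehat{\otimes}F$ and $E\widehat{\widehat{\otimes}}F$ are the completions of $E\otimes F$ with respect to $\pi$ and $\varepsilon$, respectively. *)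

(* Defs.v *)
From HB Require Import structures.
From mathcomp Require Import all_boot all_order all_algebra finmap.
From mathcomp Require Import complex.
From mathcomp Require Import all_classical all_reals all_analysis.

Set Implicit Arguments.
Unset Strict Implicit.
Unset Printing Implicit Defensive.

Import Order.TTheory GRing.Theory Num.Theory numFieldNormedType.Exports.
Local Open Scope classical_set_scope.
Local Open Scope ring_scope.

Section rearrangement.
Context {R : realType}.
Implicit Types (a b : nat -> R) (s : seq nat).

(* For a nonnegative sequence a tending to 0, the value at k of its
   non-increasing rearrangement; sequences start at index 0, so that k = 0 gives
   the largest term.  As usual, when a has infinitely many nonzero terms, its
   zero terms do not occur in the rearrangement. *)
Definition rearrangement a (k : nat) : R :=
  inf [set t : R | 0 <= t /\ ([set i | (t < a i)%R] #<= `I_k)%card].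

Definition vanishing a := forall e, 0 < e -> exists N, forall i, (N <= i)%N -> a i < e.

Lemma vanishing_bounded a : vanishing a -> exists2 M, 0 <= M & forall i, a i <= M.
Proof.
move=> /(_ 1 ltr01)[N aN].
exists (1 + \sum_(i < N) `|a i|); first by rewrite addr_ge0// sumr_ge0.
move=> i; case: (leqP N i) => [/aN/ltW ai|iN].
  by rewrite (le_trans ai)// lerDl sumr_ge0.
rewrite (bigD1 (Ordinal iN))//= addrCA (le_trans (ler_norm _))// lerDl.
by rewrite addr_ge0// sumr_ge0.
Qed.

Lemma rearrangement_ge0 a k : 0 <= rearrangement a k.
Proof.
rewrite /rearrangement; set S := [set _ | _].
have [->|S0] := eqVneq S set0; first by rewrite inf0.
by apply: lb_le_inf; [apply/set0P | move=> t []].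
Qed.

Lemma rearrangement_le a k v s : 0 <= v -> (size s <= k)%N ->
  (forall i, v < a i -> i \in s) -> rearrangement a k <= v.
Proof.
move=> v0 sk vs; apply: ge_inf; first by exists 0 => t [].
split => //.
have sub : [set i | v < a i] `<=` [set` [fset i in s]%fset].
  by move=> i /vs /= iS; rewrite inE.
apply: card_le_trans (subset_card_le sub) _.
have /card_eq_fsetP e := erefl #|` [fset i in s]%fset|.
rewrite (card_le_eql e) card_le_II (leq_trans _ sk)//.
by rewrite card_fseq size_undup.
Qed.

Lemma rearrangement_ge a k v s : vanishing a -> uniq s -> (k < size s)%N ->
  (forall i, i \in s -> v <= a i) -> v <= rearrangement a k.
Proof.
move=> /vanishing_bounded[M M0 aM] us ks vs; apply: lb_le_inf.
  exists M; split => //; rewrite (_ : [set _ | _] = set0) ?card_ge0//.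
  by apply/seteqP; split => // i /=; rewrite ltNge aM.
move=> t [_ tk]; rewrite leNgt; apply/negP => tv.
have sub : [set` [fset i in s]%fset] `<=` [set i | t < a i].
  by move=> i /=; rewrite inE => /vs; exact: lt_le_trans.
have := card_le_trans (subset_card_le sub) tk.
have /card_eq_fsetP e := erefl #|` [fset i in s]%fset|.
by rewrite (card_le_eql e) card_le_II card_fseq undup_id// leqNgt ks.
Qed.

(* s lists indices of the largest terms of a, in non-increasing order *)
Definition top_indices a s := uniq s /\ forall k, (k < size s)%N ->
  forall j, j \notin take k s -> a j <= a (nth 0%N s k).

Lemma top_rearrangement a s k : (forall i, 0 <= a i) -> vanishing a ->
  top_indices a s -> (k < size s)%N -> rearrangement a k = a (nth 0%N s k).
Proof.
move=> a0 va [us ts] ks; apply/eqP; rewrite eq_le; apply/andP; split.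
  apply: (@rearrangement_le _ _ _ (take k s)); rewrite ?size_take ?ks//.
  by move=> i; apply: contraTT => /ts - /(_ ks); rewrite -leNgt.
apply: (@rearrangement_ge _ _ _ (take k.+1 s)) => //; first exact: take_uniq.
  by rewrite size_takel.
move=> i /(nthP 0%N)[m]; rewrite size_takel// => mk; rewrite nth_take// => <-.
apply: ts; first exact: leq_trans mk ks.
apply/negP => /(nthP 0%N)[l].
rewrite size_takel ?(ltnW (leq_trans mk ks))// => lm; rewrite nth_take// => /eqP.
rewrite nth_uniq ?(ltn_trans lm)// ?(leq_trans mk)// => /eqP lk.
by move: lm; rewrite lk ltnNge -ltnS mk.
Qed.

Lemma top_exists a n : (forall i, 0 <= a i) -> vanishing a ->
  exists2 s, size s = n & top_indices a s.
Proof.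
move=> a0 va; elim: n => [|n [s sn [us ts]]]; first by exists [::].
suff [i iNs ai] : exists2 i, i \notin s & forall j, j \notin s -> a j <= a i.
  exists (rcons s i); first by rewrite size_rcons sn.
  split=> [|k]; first by rewrite rcons_uniq iNs.
  rewrite size_rcons ltnS leq_eqVlt => /predU1P[->|ks] j.
    by rewrite -cats1 take_size_cat// nth_cat ltnn subnn; exact: ai.
  by rewrite -cats1 take_cat ks nth_cat ks; exact: ts.
have max r : r != [::] -> exists2 i, i \in r & forall j, j \in r -> a j <= a i.
  elim: r => // x [_ _|y r /(_ isT)[i ir ai] _].
    by exists x => [|j]; rewrite inE// => /eqP->.
  have [xi|/ltW ix] := leP (a x) (a i).
    exists i; first by rewrite inE ir orbT.
    by move=> j; rewrite inE => /predU1P[->//|]; exact: ai.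
  exists x; first by rewrite mem_head.
  by move=> j; rewrite inE => /predU1P[->//|/ai /le_trans]; apply.
have [[j jNs aj]|h] := pselect (exists2 j, j \notin s & 0 < a j).
  have [N aN] := va _ aj.
  have memr i : i \notin s -> a j <= a i -> i \in [seq i <- iota 0 N | i \notin s].
    move=> iNs ji; rewrite mem_filter iNs mem_iota/= add0n ltnNge.
    by apply/negP => /aN; rewrite ltNge ji.
  have [|i] := max [seq i <- iota 0 N | i \notin s].
    by apply/eqP => r0; have := memr j jNs (lexx _); rewrite r0.
  rewrite mem_filter => /andP[iNs _] ai; exists i => // k kNs.
  have ji : a j <= a i by apply: ai; exact: memr.
  have [/(memr _ kNs)/ai//|/ltW kj] := leP (a j) (a k).
  exact: le_trans kj ji.
exists (\max_(k <- s) k).+1.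
  apply/negP => ms; suff : ((\max_(k <- s) k).+1 <= \max_(k <- s) k)%N by rewrite ltnn.
  exact: (@leq_bigmax_seq _ s predT id).
move=> j jNs; rewrite (le_trans _ (a0 _))// leNgt; apply/negP => aj.
by apply: h; exists j.
Qed.

Lemma rearrangementZ a c : (forall i, 0 <= a i) -> vanishing a -> 0 <= c ->
  rearrangement (fun i => c * a i) = fun k => c * rearrangement a k.
Proof.
move=> a0 va c0; apply/funext => k.
have ca0 i : 0 <= c * a i by rewrite mulr_ge0.
have vca : vanishing (fun i => c * a i).
  move=> e e0; have c1 : 0 < c + 1 by rewrite ltr_wpDl.
  have [N aN] := va (e / (c + 1)) (divr_gt0 e0 c1); exists N => i /aN ai.
  rewrite (@le_lt_trans _ _ ((c + 1) * a i))// ?ler_wpM2r ?lerDl//.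
  by rewrite mulrC -ltr_pdivlMr.
have [s sk tops] := top_exists k.+1 a0 va.
rewrite (top_rearrangement a0 va tops) ?sk// (@top_rearrangement _ s)// ?sk//.
case: tops => us ts; split=> // l ls j jl.
by rewrite ler_wpM2l// ts.
Qed.

End rearrangement.

(* G : [0, +oo[ -> [0, +oo[ is the restriction of a function on R, whose values at
   negative arguments play no role *)
Record orlicz_function (R : realType) := OrliczFunction {
  orlicz_fun :> R -> R ;
  orlicz_ge0 : forall t : R, 0 <= t -> 0 <= orlicz_fun t ;
  orlicz_convex : @convex_function R R^o `[0, +oo[ orlicz_fun ;
  orlicz_eq0 : forall t : R, 0 <= t -> orlicz_fun t = 0 <-> t = 0 }.

Record weight_sequence (R : realType) := Weight {
  weight_seq :> nat -> R ;
  weight_gt0 : forall k, 0 < weight_seq k ;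
  weight_nonincreasing : forall m n, (m <= n)%N -> weight_seq n <= weight_seq m ;
  weight_diverges : (\sum_(0 <= k <oo) (weight_seq k)%:E = +oo)%E }.

Section modular.
Context {R : realType} (G : orlicz_function R) (w : weight_sequence R).
Implicit Types (a b z : nat -> R) (s : seq nat).

Definition modular a : \bar R := (\sum_(0 <= k <oo) (G (a k) * w k)%:E)%E.

Lemma orlicz0 : G 0 = 0.
Proof. by apply/(orlicz_eq0 G (lexx 0)). Qed.

Lemma orlicz_conv t x y : 0 <= t <= 1 -> 0 <= x -> 0 <= y ->
  G (t * x + (1 - t) * y) <= t * G x + (1 - t) * G y.
Proof.
move=> t01 x0 y0.
have [u ut] : exists u : {i01 R}, u%:num = t.
  by exists (Itv01 (proj1 (andP t01)) (proj2 (andP t01))).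
have := @orlicz_convex _ G u x y; rewrite !inE/= !in_itv/= !andbT => /(_ x0 y0).
move=> H; rewrite -ut; exact: H.
Qed.

Lemma orlicz_contract t x : 0 <= t <= 1 -> 0 <= x -> G (t * x) <= t * G x.
Proof.
move=> t01 x0; have := orlicz_conv t01 x0 (lexx 0).
by rewrite orlicz0 !mulr0 !addr0.
Qed.

Lemma orlicz_le x y : 0 <= x -> x <= y -> G x <= G y.
Proof.
move=> x0 xy; have y0 := le_trans x0 xy.
have [y_eq0|yn0] := eqVneq y 0.
  have -> : x = 0 by apply/eqP; rewrite eq_le x0 -[leRHS]y_eq0 xy.
  by rewrite y_eq0.
have yp : 0 < y by rewrite lt_neqAle eq_sym yn0.
have t01 : 0 <= x / y <= 1 by rewrite divr_ge0// ler_pdivrMr// mul1r.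
have := orlicz_contract t01 y0; rewrite divfK// => /le_trans; apply.
by rewrite ler_piMl// ?orlicz_ge0//; case/andP: t01.
Qed.

Let psum a n := \sum_(k < n) G (a k) * w k.

Let term_ge0 a k : (forall i, 0 <= a i) -> 0 <= G (a k) * w k.
Proof. by move=> a0; rewrite mulr_ge0 ?orlicz_ge0// ltW// weight_gt0. Qed.

Lemma modular_le a M : (forall i, 0 <= a i) ->
  (modular a <= M%:E)%E <-> forall n, psum a n <= M.
Proof.
move=> a0; have t0 k : (0 <= k)%N -> xpredT k -> (0 <= (G (a k) * w k)%:E)%E.
  by move=> *; rewrite lee_fin term_ge0.
split=> [aM n|aM].
  have := le_trans (nneseries_lim_ge n t0) aM.
  by rewrite sumEFin lee_fin big_mkord.
apply: lime_le; first exact: is_cvg_nneseries.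
by apply: nearW => n; rewrite sumEFin lee_fin big_mkord; exact: aM.
Qed.

Lemma modular_lty a : (forall i, 0 <= a i) ->
  (modular a < +oo)%E <-> exists M, forall n, psum a n <= M.
Proof.
move=> a0; split=> [aoo|[M]]; last first.
  by move/(modular_le _ a0) => /le_lt_trans; apply; rewrite ltry.
exists (fine (modular a)); apply/modular_le => //; rewrite fineK//.
rewrite ge0_fin_numE// /modular; apply: nneseries_ge0 => k _ _.
by rewrite lee_fin term_ge0.
Qed.

Let abel (d : nat -> R) n : (forall m, (m <= n)%N -> 0 <= \sum_(k < m) d k) ->
  0 <= \sum_(k < n) d k * w k.
Proof.
case: n => [|n] d0; first by rewrite big_ord0.
suff h m : (m <= n)%N -> (\sum_(k < m.+1) d k) * w m <= \sum_(k < m.+1) d k * w k.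
  by apply: le_trans (h n (leqnn n)); rewrite mulr_ge0 ?d0// ltW// weight_gt0.
elim: m => [|m ih] mn; first by rewrite !big_ord1.
rewrite big_ord_recr/= mulrDl [in leRHS]big_ord_recr/= lerD2r.
rewrite (le_trans _ (ih (ltnW mn)))//.
by rewrite ler_wpM2l ?d0 ?weight_nonincreasing// ltnW.
Qed.

Let sum_le_rearrangement a s : (forall i, 0 <= a i) -> vanishing a -> uniq s ->
  \sum_(i <- s) G (a i) <= \sum_(k < size s) G (rearrangement a k).
Proof.
move=> a0 va; move sn : (size s) => n; elim: n s sn => [|n ih] s sn us.
  by rewrite (size0nil sn) big_nil big_ord0.
have min r : r != [::] -> exists2 i, i \in r & forall j, j \in r -> a i <= a j.
  elim: r => // x [_ _|y r /(_ isT)[i ir ai] _].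
    by exists x => [|j]; rewrite inE// => /eqP->.
  have [ix|/ltW xi] := leP (a i) (a x).
    exists i; first by rewrite inE ir orbT.
    by move=> j; rewrite inE => /predU1P[->//|]; exact: ai.
  exists x; first by rewrite mem_head.
  by move=> j; rewrite inE => /predU1P[->//|/ai]; exact: le_trans.
have [|i iS ai] := min s; first by rewrite -size_eq0 sn.
rewrite (perm_big _ (perm_to_rem iS))/= big_cons big_ord_recr/= addrC lerD//.
  by apply: ih; rewrite ?rem_uniq// size_rem// sn.
by apply: orlicz_le => //; apply: (rearrangement_ge va us); rewrite ?sn.
Qed.

Let psum_rearrangement a s : (forall i, 0 <= a i) -> vanishing a -> uniq s ->
  \sum_(k < size s) G (a (nth 0%N s k)) * w k <= psum (rearrangement a) (size s).
Proof.
move=> a0 va us; rewrite -subr_ge0 -sumrB.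
under eq_bigr do rewrite -mulrBl.
apply: (@abel (fun k => G (rearrangement a k) - G (a (nth 0%N s k)))) => m ms.
rewrite sumrB subr_ge0.
have := @sum_le_rearrangement a (take m s) a0 va (take_uniq _ us).
rewrite (big_nth 0%N) size_takel// big_mkord; apply: le_trans.
by apply: ler_sum => k _; rewrite nth_take.
Qed.

Lemma psum_convex a b z t n : (forall i, 0 <= a i) -> vanishing a ->
  (forall i, 0 <= b i) -> vanishing b -> (forall i, 0 <= z i) -> vanishing z ->
  0 <= t <= 1 -> (forall i, z i <= t * a i + (1 - t) * b i) ->
  psum (rearrangement z) n <=
  t * psum (rearrangement a) n + (1 - t) * psum (rearrangement b) n.
Proof.
move=> a0 va b0 vb z0 vz t01 zab.
have [s sn tops] := top_exists n z0 vz.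
have us := proj1 tops.
rewrite -{1}sn /psum (eq_bigr (fun k : 'I_(size s) => G (z (nth 0%N s k)) * w k)).
  have /andP[t0 t1] := t01.
  have zG i : G (z i) <= t * G (a i) + (1 - t) * G (b i).
    by apply: le_trans (orlicz_conv t01 (a0 i) (b0 i)); exact: orlicz_le.
  rewrite (@le_trans _ _ (t * (\sum_(k < size s) G (a (nth 0%N s k)) * w k) +
    (1 - t) * (\sum_(k < size s) G (b (nth 0%N s k)) * w k)))//.
    rewrite !mulr_sumr -big_split; apply: ler_sum => k _ /=.
    by rewrite !mulrA -mulrDl ler_wpM2r// ltW// weight_gt0.
  by rewrite -sn lerD// ler_wpM2l ?subr_ge0//; exact: psum_rearrangement.
by move=> k _; rewrite (top_rearrangement z0 vz tops).
Qed.

(* Membership in the Orlicz-Lorentz space and its norm, for a = |x| *)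
Definition orlicz_lorentz_finite a :=
  exists2 l : R, 0 < l & (modular (fun k => l * rearrangement a k)%R < +oo)%E.

Definition orlicz_lorentz_norm a : R :=
  inf [set l : R | 0 < l /\ (modular (fun k => rearrangement a k / l)%R <= 1)%E].

Let unit_scale a (l : R) := 0 < l /\ (modular (fun k => rearrangement a k / l)%R <= 1)%E.

Let divr_rearrangement_ge0 a (l : R) k : 0 < l -> 0 <= rearrangement a k / l.
Proof. by move=> l0; rewrite divr_ge0 ?rearrangement_ge0// ltW. Qed.

Let finite_unit_scale a : orlicz_lorentz_finite a <-> exists l : R, unit_scale a l.
Proof.
split=> [[l l0]|[l [l0 a1]]]; last first.
  exists l^-1; first by rewrite invr_gt0.
  under eq_fun do rewrite mulrC.
  by rewrite (le_lt_trans a1)// ltry.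
have la0 i : 0 <= l * rearrangement a i by rewrite mulr_ge0 ?rearrangement_ge0// ltW.
move=> /(modular_lty la0)[M aM].
have M0 : 0 <= M by have := aM 0%N; rewrite /psum big_ord0.
have M1 : 0 < M + 1 by rewrite ltr_wpDl.
exists (l / (M + 1))^-1.
have l1 : 0 < (l / (M + 1))^-1 by rewrite invr_gt0 divr_gt0.
split=> //; apply/modular_le => [i|n]; first exact: divr_rearrangement_ge0.
rewrite (@le_trans _ _ ((M + 1)^-1 * psum (fun k => l * rearrangement a k) n))//.
  rewrite mulr_sumr; apply: ler_sum => k _.
  rewrite mulrA ler_wpM2r ?(ltW (weight_gt0 _ _))//.
  rewrite invrK [l / _]mulrC [X in G X]mulrC -mulrA.
  by rewrite orlicz_contract// invr_ge0 ltW//= invf_le1// lerDr.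
by rewrite ler_pdivrMl// mulr1 (le_trans (aM n))// lerDl.
Qed.

Let unit_scaleD a b z l m : (forall i, 0 <= a i) -> vanishing a ->
  (forall i, 0 <= b i) -> vanishing b -> (forall i, 0 <= z i) -> vanishing z ->
  (forall i, z i <= a i + b i) ->
  unit_scale a l -> unit_scale b m -> unit_scale z (l + m).
Proof.
move=> a0 va b0 vb z0 vz zab [l0 al] [m0 bm].
have lm0 : 0 < l + m by rewrite addr_gt0.
split=> //.
have scale (c : nat -> R) (r : R) : (forall i, 0 <= c i) -> vanishing c -> 0 < r ->
    [/\ forall i, 0 <= r^-1 * c i, vanishing (fun i => r^-1 * c i) &
    (fun k => rearrangement c k / r) = rearrangement (fun i => r^-1 * c i)].
  move=> c0 vc r0; split.
  - by move=> i; rewrite mulr_ge0// invr_ge0 ltW.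
  - move=> e e0; have [N cN] := vc (r * e) (mulr_gt0 r0 e0); exists N => i /cN.
    by rewrite ltr_pdivrMl.
  - rewrite rearrangementZ ?invr_ge0 ?(ltW r0)//.
    by apply/funext => k; rewrite mulrC.
have [a0' va' ea] := scale a l a0 va l0.
have [b0' vb' eb] := scale b m b0 vb m0.
have [z0' vz' ez] := scale z (l + m) z0 vz lm0.
rewrite ez; apply/modular_le => [i|n]; first exact: rearrangement_ge0.
have tl : 1 - l / (l + m) = m / (l + m).
  by rewrite -[X in X - _](@divff _ (l + m)) ?gt_eqF// -mulrBl addrAC subrr add0r.
have t01 : 0 <= l / (l + m) <= 1.
  by rewrite divr_ge0 ?(ltW l0) ?(ltW lm0)//= ler_pdivrMr// mul1r lerDl ltW.
apply: le_trans (psum_convex n a0' va' b0' vb' z0' vz' t01 _) _ => [i|].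
  rewrite tl [l / _]mulrC [m / _]mulrC -!mulrA !mulVKf ?gt_eqF//.
  by rewrite -mulrDr ler_wpM2l// invr_ge0 ltW.
have /andP[t0 t1] := t01.
rewrite -[leRHS](subrK (l / (l + m))) [leRHS]addrC lerD//.
  rewrite -[leRHS]mulr1 ler_wpM2l// -ea.
  by move/modular_le : al => /(_ (fun i => divr_rearrangement_ge0 _ _ l0)); apply.
rewrite -[leRHS]mulr1 ler_wpM2l ?subr_ge0// -eb.
by move/modular_le : bm => /(_ (fun i => divr_rearrangement_ge0 _ _ m0)); apply.
Qed.

Let unit_scaleZ a c l : (forall i, 0 <= a i) -> vanishing a -> 0 < c ->
  unit_scale a l -> unit_scale (fun i => c * a i) (c * l).
Proof.
move=> a0 va c0 [l0 al]; split; first exact: mulr_gt0.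
rewrite rearrangementZ ?(ltW c0)//.
by under eq_fun do rewrite -mulf_div divff ?gt_eqF// mul1r.
Qed.

Let unit_scale0 a l : (forall i, 0 <= a i) -> vanishing a -> 0 < l ->
  unit_scale (fun i => 0 * a i) l.
Proof.
move=> a0 va l0; split=> //; rewrite rearrangementZ//.
apply/modular_le => [i|n]; first by rewrite mul0r mul0r.
by rewrite /psum big1// => i _; rewrite !mul0r orlicz0 mul0r.
Qed.

Lemma orlicz_lorentz_finiteD a b z : (forall i, 0 <= a i) -> vanishing a ->
  (forall i, 0 <= b i) -> vanishing b -> (forall i, 0 <= z i) -> vanishing z ->
  (forall i, z i <= a i + b i) ->
  orlicz_lorentz_finite a -> orlicz_lorentz_finite b -> orlicz_lorentz_finite z.
Proof.
move=> a0 va b0 vb z0 vz zab /finite_unit_scale[l al] /finite_unit_scale[m bm].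
by apply/finite_unit_scale; exists (l + m); apply: unit_scaleD al bm.
Qed.

Lemma orlicz_lorentz_finite0 : orlicz_lorentz_finite (fun=> 0).
Proof.
apply/finite_unit_scale; exists 1.
have -> : (fun=> 0) = (fun=> 0 * 0) :> (nat -> R) by apply/funext => i; rewrite mul0r.
by apply: (@unit_scale0 (fun=> 0)) => // e e0; exists 0%N.
Qed.

Lemma orlicz_lorentz_finiteZ a c : (forall i, 0 <= a i) -> vanishing a ->
  0 <= c -> orlicz_lorentz_finite a -> orlicz_lorentz_finite (fun i => c * a i).
Proof.
move=> a0 va; rewrite le_eqVlt => /predU1P[<- _|c0].
  by apply/finite_unit_scale; exists 1; exact: unit_scale0.
move=> /finite_unit_scale[l al].
by apply/finite_unit_scale; exists (c * l); exact: unit_scaleZ.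
Qed.

Let lb a : has_lbound (unit_scale a).
Proof. by exists 0 => l [/ltW]. Qed.

Lemma orlicz_lorentz_normD a b z : (forall i, 0 <= a i) -> vanishing a ->
  (forall i, 0 <= b i) -> vanishing b -> (forall i, 0 <= z i) -> vanishing z ->
  (forall i, z i <= a i + b i) ->
  orlicz_lorentz_finite a -> orlicz_lorentz_finite b ->
  orlicz_lorentz_norm z <= orlicz_lorentz_norm a + orlicz_lorentz_norm b.
Proof.
move=> a0 va b0 vb z0 vz zab /finite_unit_scale[l al] /finite_unit_scale[m bm].
rewrite -inf_sumE; last 2 first.
- by split; [exists l | exact: lb].
- by split; [exists m | exact: lb].
apply: lb_le_inf; first by exists (l + m); exists l => //; exists m.
by move=> _ [l' al' [m' bm' <-]]; apply: ge_inf; [exact: lb | exact: unit_scaleD al' bm'].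
Qed.

Let orlicz_lorentz_normZ_le a c : (forall i, 0 <= a i) -> vanishing a -> 0 < c ->
  orlicz_lorentz_finite a -> orlicz_lorentz_norm (fun i => c * a i) <= c * orlicz_lorentz_norm a.
Proof.
move=> a0 va c0 /finite_unit_scale[l al]; rewrite -ler_pdivrMl//.
apply: lb_le_inf; first by exists l.
move=> m am; rewrite ler_pdivrMl//; apply: ge_inf; first exact: lb.
exact: unit_scaleZ.
Qed.

Lemma orlicz_lorentz_normZ a c : (forall i, 0 <= a i) -> vanishing a -> 0 <= c ->
  orlicz_lorentz_finite a -> orlicz_lorentz_norm (fun i => c * a i) = c * orlicz_lorentz_norm a.
Proof.
move=> a0 va; rewrite le_eqVlt => /predU1P[<- _|c0 fa].
  rewrite mul0r; apply/eqP; rewrite eq_le; apply/andP; split.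
    apply/ler_addgt0Pr => e e0; rewrite add0r.
    by apply: ge_inf; [exact: lb | exact: unit_scale0].
  by apply: lb_le_inf; [exists 1; exact: unit_scale0 | move=> l [/ltW]].
apply/eqP; rewrite eq_le orlicz_lorentz_normZ_le//= -ler_pdivlMl//.
have e : a = fun i => c^-1 * (c * a i).
  by apply/funext => i; rewrite mulKf ?gt_eqF.
rewrite {1}e orlicz_lorentz_normZ_le ?invr_gt0//.
- by move=> i; rewrite mulr_ge0// ltW.
- move=> d d0; have [N aN] := va (c^-1 * d) (mulr_gt0 (eqbRL (invr_gt0 _) c0) d0).
  by exists N => i /aN; rewrite ltr_pdivlMl.
- by apply: orlicz_lorentz_finiteZ; rewrite ?(ltW c0).
Qed.

Lemma orlicz_lorentz_norm_eq0 a : (forall i, 0 <= a i) -> vanishing a ->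
  orlicz_lorentz_finite a -> orlicz_lorentz_norm a = 0 -> forall i, a i = 0.
Proof.
move=> a0 va /finite_unit_scale[m am] an0 i; apply/eqP; rewrite eq_le a0 andbT.
pose r := rearrangement a 0.
have air : a i <= r.
  by apply: (rearrangement_ge (s := [:: i])) => // j; rewrite inE => /eqP->.
have G1 : 0 < G 1.
  rewrite lt_neqAle orlicz_ge0 ?ler01// andbT eq_sym; apply/eqP.
  by move/(orlicz_eq0 G ler01)/eqP; rewrite oner_eq0.
pose C := 1 + (G 1 * w 0%N)^-1.
have Gw0 : 0 < G 1 * w 0%N by rewrite mulr_gt0 ?weight_gt0.
have C0 : 0 < C by rewrite addr_gt0 ?invr_gt0.
suff : r / C <= orlicz_lorentz_norm a.
  by rewrite an0 ler_pdivrMr// mul0r; exact: le_trans.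
apply: lb_le_inf; first by exists m.
move=> l [l0 /modular_le] => /(_ (fun i => divr_rearrangement_ge0 _ _ l0))/(_ 1%N).
rewrite /psum big_ord1 -/r => Gr; rewrite ler_pdivrMr// /C mulrDr mulr1.
have [rl|lr] := leP r l; first by rewrite (le_trans rl)// lerDl divr_ge0// ltW.
rewrite (@le_trans _ _ (l / (G 1 * w 0%N)))// ?lerDr ?(ltW l0)//.
have r0 := lt_trans l0 lr.
have : G 1 <= l / r * G (r / l).
  rewrite -{1}(@divff _ (r / l)) ?gt_eqF ?divr_gt0// [X in G X]mulrC invf_div.
  by rewrite orlicz_contract ?divr_ge0 ?(ltW l0) ?(ltW r0)//= ler_pdivrMr// mul1r ltW.
rewrite ler_pdivlMr// => h.
have w0 := ltW (weight_gt0 w 0%N).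
apply: le_trans (_ : r * (l / r * G (r / l) * w 0%N) <= _).
  by rewrite ler_wpM2l ?(ltW r0)// ler_wpM2r.
rewrite !mulrA [r * l]mulrC -!mulrA mulVKf ?gt_eqF//.
by rewrite -[leRHS]mulr1 ler_wpM2l// ltW.
Qed.

End modular.

Variant scalar_kind := RealScalars | ComplexScalars.

Definition scalar_field (R : realType) (s : scalar_kind) : numFieldType :=
  match s with RealScalars => R | ComplexScalars => R[i]%C end.

Definition of_real {R : realType} {s : scalar_kind} : R -> scalar_field R s :=
  match s with RealScalars => id | ComplexScalars => fun r => (r%:C)%C end.

Definition to_real {R : realType} {s : scalar_kind} : scalar_field R s -> R :=
  match s with RealScalars => id | ComplexScalars => @complex.Re R end.

(* In a normed space over the numFieldType K, norms take values in K; this is the real-valued one *)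
Definition rnorm {R : realType} {s : scalar_kind} {V : normedZmodType (scalar_field R s)}
  (x : V) : R := to_real `|x|.

Section scalar_theory.
Context {R : realType} {s : scalar_kind}.
Local Notation K := (scalar_field R s).

Lemma of_real0 : of_real 0 = 0 :> K. Proof. by case: s. Qed.

Lemma of_realD : {morph (of_real : R -> K) : x y / x + y}.
Proof. by case: s => // x y; rewrite /of_real rmorphD. Qed.

Lemma of_realM : {morph (of_real : R -> K) : x y / x * y}.
Proof. by case: s => // x y; rewrite /of_real rmorphM. Qed.

Lemma of_real_le : {mono (of_real : R -> K) : x y / x <= y}.
Proof. by case: s => // x y; rewrite /of_real lecR. Qed.

Lemma of_real_lt : {mono (of_real : R -> K) : x y / x < y}.
Proof. by case: s => // x y; rewrite /of_real ltcR. Qed.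

Lemma of_real_inj : injective (of_real : R -> K).
Proof. by case: s => // x y; exact: complexI. Qed.

Lemma of_rnorm (V : normedZmodType K) (x : V) : of_real (rnorm x) = `|x|.
Proof.
rewrite /rnorm; have : 0 <= `|x| by []; move: `|x|.
by rewrite /of_real/= /to_real; case: s => //= -[a b]; rewrite lecE/= => /andP[/eqP->].
Qed.

Lemma rnorm_ge0 (V : normedZmodType K) (x : V) : 0 <= rnorm x.
Proof. by rewrite -of_real_le of_real0 of_rnorm. Qed.

Lemma rnorm_eq0 (V : normedZmodType K) (x : V) : rnorm x = 0 -> x = 0.
Proof. by move=> x0; apply/normr0_eq0; rewrite -of_rnorm x0 of_real0. Qed.

Lemma rnormD (V : normedZmodType K) (x y : V) : rnorm (x + y) <= rnorm x + rnorm y.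
Proof. by rewrite -of_real_le of_realD !of_rnorm ler_normD. Qed.

Lemma rnormM (x y : K) : rnorm (x * y) = rnorm x * rnorm y.
Proof. by apply: of_real_inj; rewrite of_realM !of_rnorm normrM. Qed.

End scalar_theory.

Section orlicz_lorentz_space.
Context {R : realType} (s : scalar_kind) (G : orlicz_function R) (w : weight_sequence R).
Local Notation K := (scalar_field R s).
Implicit Types x y : nat -> K^o.

Let modulus x : nat -> R := fun k => rnorm (x k : K).

Definition in_orlicz_lorentz : pred (nat -> K^o) := fun x =>
  `[< x @ \oo --> (0 : K^o) /\
      orlicz_lorentz_finite G w (fun k => rnorm (x k)) >].

Let vanishing_modulus x : x @ \oo --> (0 : K^o) -> vanishing (modulus x).
Proof.
move=> /cvgr0Pnorm_lt x0 e e0.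
have : 0 < of_real e :> K by rewrite -of_real0 of_real_lt.
move=> /x0[N _ xN]; exists N => i iN.
by rewrite -(@of_real_lt R s) of_rnorm xN.
Qed.

Let modulus_ge0 x i : 0 <= modulus x i. Proof. exact: rnorm_ge0. Qed.

Let modulusD x y i : modulus (x + y) i <= modulus x i + modulus y i.
Proof. exact: rnormD. Qed.

Let modulusZ (c : K) x : modulus (c *: x) = fun i => rnorm c * modulus x i.
Proof. by apply/funext => i; rewrite /modulus -rnormM. Qed.

Lemma orlicz_lorentz_submod_closed : submod_closed in_orlicz_lorentz.
Proof.
have Z (c : K) x : x \in in_orlicz_lorentz -> c *: x \in in_orlicz_lorentz.
  move=> /asboolP[x0 fx]; apply/asboolP; split.
    rewrite -[X in _ --> X](scaler0 _ c).
    exact: cvgZr.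
  rewrite -/(modulus _) modulusZ.
  apply: orlicz_lorentz_finiteZ fx; rewrite ?rnorm_ge0//; first by move=> i; exact: rnorm_ge0.
  exact: vanishing_modulus.
split=> [|c x y /(Z c)/asboolP[x0 fx] /asboolP[y0 fy]].
  apply/asboolP; split; first exact: cvg_cst.
  rewrite (_ : (fun _ => _) = fun=> 0); first exact: orlicz_lorentz_finite0.
  by apply/funext => k; apply: (@of_real_inj R s); rewrite of_rnorm of_real0 [LHS]normr0.
have xy0 : c *: x + y @ \oo --> (0 : K^o) by rewrite -[X in _ --> X]addr0; exact: cvgD.
apply/asboolP; split => //.
exact: (orlicz_lorentz_finiteD (modulus_ge0 _) (vanishing_modulus x0)
  (modulus_ge0 _) (vanishing_modulus y0) (modulus_ge0 _) (vanishing_modulus xy0)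
  (modulusD _ _) fx fy).
Qed.

HB.instance Definition _ := GRing.isSubmodClosed.Build _ _ in_orlicz_lorentz
  orlicz_lorentz_submod_closed.

Definition orlicz_lorentz := {x : nat -> K^o | x \in in_orlicz_lorentz}.

HB.instance Definition _ := SubChoice.on orlicz_lorentz.
HB.instance Definition _ := [SubChoice_isSubLmodule of orlicz_lorentz by <:].

Let nm (x : orlicz_lorentz) : K :=
  of_real (orlicz_lorentz_norm G w (fun k => rnorm (val x k))).

Let val_vanishing (x : orlicz_lorentz) : vanishing (modulus (val x)).
Proof. by apply: vanishing_modulus; have /asboolP[] := valP x. Qed.

Let val_finite (x : orlicz_lorentz) : orlicz_lorentz_finite G w (modulus (val x)).
Proof. by have /asboolP[] := valP x. Qed.

Let nmD (x y : orlicz_lorentz) : nm (x + y) <= nm x + nm y.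
Proof.
rewrite -of_realD of_real_le.
exact: (orlicz_lorentz_normD (modulus_ge0 _) (val_vanishing x)
  (modulus_ge0 _) (val_vanishing y) (modulus_ge0 _) (val_vanishing (x + y))
  (modulusD (val x) (val y)) (val_finite x) (val_finite y)).
Qed.

Let nmZ (c : K) (x : orlicz_lorentz) : nm (c *: x) = `|c| * nm x.
Proof.
rewrite -of_rnorm -of_realM; congr of_real.
rewrite -[LHS]/(orlicz_lorentz_norm G w (modulus (val (c *: x)))) linearZ modulusZ.
exact: (orlicz_lorentz_normZ (modulus_ge0 _) (val_vanishing x) (rnorm_ge0 _)
  (val_finite x)).
Qed.

Let nm_eq0 (x : orlicz_lorentz) : nm x = 0 -> x = 0.
Proof.
rewrite -(of_real0 (R := R)) => /of_real_inj x0; apply/val_inj/funext => i.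
apply: rnorm_eq0.
exact: (orlicz_lorentz_norm_eq0 (modulus_ge0 _) (val_vanishing x) (val_finite x) x0).
Qed.

HB.instance Definition _ := Lmodule_isNormed.Build K orlicz_lorentz nmD nmZ nm_eq0.

Lemma orlicz_lorentz_normE (x : orlicz_lorentz) :
  rnorm x = orlicz_lorentz_norm G w (fun k => rnorm (val x k)).
Proof. by apply: (@of_real_inj R s); rewrite of_rnorm. Qed.

End orlicz_lorentz_space.

Section tensor_product.
Context {K : fieldType} (E F : lmodType K).

(* The tensor \sum x_i (x) y_i, as the functional B |-> \sum B x_i y_i on the
   space of bilinear forms on E x F *)
Definition tensor_sum (u : seq (E * F)) : {bilinear E -> F -> K^o} -> K^o :=
  fun B => \sum_(p <- u) B p.1 p.2.

Definition is_tensor : pred ({bilinear E -> F -> K^o} -> K^o) :=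
  fun f => `[< exists u, f = tensor_sum u >].

Lemma is_tensor_submod_closed : submod_closed is_tensor.
Proof.
split=> [|c f g /asboolP[u ->] /asboolP[v ->]]; apply/asboolP.
  by exists [::]; apply/funext => B; rewrite /tensor_sum big_nil.
exists ([seq (c *: p.1, p.2) | p <- u] ++ v); apply/funext => B.
rewrite /tensor_sum big_cat big_map/=; congr (_ + _).
rewrite -[LHS]/(c *: (\sum_(p <- u) B p.1 p.2)) scaler_sumr.
by apply: eq_bigr => p _; rewrite linearZl.
Qed.

HB.instance Definition _ := GRing.isSubmodClosed.Build _ _ is_tensor
  is_tensor_submod_closed.

Definition tensor := {f : {bilinear E -> F -> K^o} -> K^o | f \in is_tensor}.

HB.instance Definition _ := SubChoice.on tensor.
HB.instance Definition _ := [SubChoice_isSubLmodule of tensor by <:].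

End tensor_product.

Section tensor_norms.
Context {R : realType} {s : scalar_kind}.
Local Notation K := (scalar_field R s).
Context (E F : normedModType K).

Definition projective_norm (t : tensor E F) : R :=
  inf [set r | exists2 u : seq (E * F), val t = tensor_sum u &
                 r = \sum_(p <- u) rnorm p.1 * rnorm p.2].

Definition dual_ball (V : normedModType K) : set {linear V -> K^o} :=
  [set phi | forall x, rnorm x <= 1 -> rnorm (phi x) <= 1].

Definition injective_norm (t : tensor E F) : R :=
  sup [set r | exists2 u : seq (E * F), val t = tensor_sum u &
                 exists2 phi : {linear E -> K^o}, dual_ball phi &
                 exists2 psi : {linear F -> K^o}, dual_ball psi &
                 r = rnorm (\sum_(p <- u) phi p.1 * psi p.2)].

End tensor_norms.

Section banach_spaces.
Context {R : realType} {s : scalar_kind}.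
Local Notation K := (scalar_field R s).

Definition separable_space (T : topologicalType) := exists2 A : set T, countable A & dense A.

(* X, with some map j, is the completion of V for nu; it is unique up to an
   isometric isomorphism *)
Definition completion (V : lmodType K) (nu : V -> R) (X : completeNormedModType K) :=
  exists2 j : {linear V -> X}, (forall v, rnorm (j v) = nu v) & dense (range j).

Definition injective_tensor_product (E F : normedModType K) :=
  completion (@injective_norm R s E F).

Definition projective_tensor_product (E F : normedModType K) :=
  completion (@projective_norm R s E F).

Definition schauder_basis (Y : completeNormedModType K) (e : nat -> Y) :=
  forall y : Y, exists! a : nat -> K, series (fun k => a k *: e k) @ \oo --> y.

Definition unconditional_basis (Y : completeNormedModType K) (e : nat -> Y) :=
  schauder_basis e /\
  forall a : nat -> K, cvgn (series (fun k => a k *: e k)) ->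
  forall sigma : nat -> nat, bijective sigma ->
    cvgn (series (fun k => a (sigma k) *: e (sigma k))).

Definition isomorphic_to_subspace (X Y : normedModType K) :=
  exists (T : {linear X -> Y}) (c C : R), [/\ 0 < c, 0 < C &
    forall x, c * rnorm x <= rnorm (T x) <= C * rnorm x].

Definition embeds_in_unconditional_basis_space (X : completeNormedModType K) :=
  exists (Y : completeNormedModType K) (e : nat -> Y),
    unconditional_basis e /\ isomorphic_to_subspace X Y.

End banach_spaces.

Section hypotheses.
Context {R : realType}.
Implicit Types f g : R -> R.

Definition convex_on_nonneg f := @convex_function R R^o `[0, +oo[ f.

Definition concave_on_nonneg f := convex_on_nonneg (fun t => - f t).

Definition equivalent_functions f g := exists2 c : R, 0 < c &
  forall t : R, 0 <= t -> f (c^-1 * t) <= g t <= f (c * t).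

Definition equivalent_to_convex f := exists g : R -> R,
  [/\ forall t : R, 0 <= t -> 0 <= g t, convex_on_nonneg g & equivalent_functions f g].

Definition equivalent_to_concave f := exists g : R -> R,
  [/\ forall t : R, 0 <= t -> 0 <= g t, concave_on_nonneg g & equivalent_functions f g].

(* Functions of n = 1, 2, 3, ... *)
Definition convex_on_positive_nat (f : nat -> R) :=
  forall (t : {i01 R}) m n l, (0 < m)%N -> (0 < n)%N ->
    l%:R = t%:num * m%:R + (1 - t%:num) * n%:R ->
    f l <= t%:num * f m + (1 - t%:num) * f n.

Definition concave_on_positive_nat (f : nat -> R) :=
  convex_on_positive_nat (fun n => - f n).

(* \sum_(k < n) w k is the sum of the first n weights *)
Definition weight_sum (w : weight_sequence R) (n : nat) : R := \sum_(k < n) w k.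

End hypotheses.

(* Main.v *)
From HB Require Import structures.
Require Import Defs.
From mathcomp Require Import all_boot all_order all_algebra.
From mathcomp Require Import complex.
From mathcomp Require Import all_classical all_reals all_analysis.
From mathcomp Require Import lra ring zify.

Set Implicit Arguments.
Unset Strict Implicit.
Unset Printing Implicit Defensive.

Import Order.TTheory GRing.Theory Num.Theory numFieldNormedType.Exports.
Local Open Scope classical_set_scope.
Local Open Scope ring_scope.

(** Both tensor products contain the matrix units [e_i ⊗ f_j] of the unit vectors
of the two sequence spaces.  An embedding into a space with an unconditional
basis would make the truncation of matrices to their upper triangle uniformly
bounded in the tensor norm, and in both norms it is not.

_Unconditionality bounds triangular truncation._  Let [S] embed the tensor
product into a space with an unconditional basis.  The projections onto arbitrary
sets of basis vectors are uniformly bounded ([unconditional_constant], by Baire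
category).  Replace the unit vectors by differences [e_i - e_i'] and
[f_j - f_j'].  By the pigeonhole principle [S ((e_i - e_i') ⊗ f)] has
arbitrarily small coordinates on any given finite part of the basis for suitable
large [i < i'], so a gliding hump chooses the pairs [i_0], [j_0], [i_1], [j_1], ...
in turn such that the image of entry [(k, l)] is concentrated on a block of the
basis that depends only on [l] if [k <= l], only on [k] if [l < k], and all these
blocks are disjoint.  Projecting onto the blocks of the first kind truncates the
matrix ([triangle_projection], [triangle_tensor]).  Differences are used because
they work even in spaces such as l_1, whose unit vectors are not weakly null.

_A small matrix with a large triangle._  The antisymmetric matrix
[dyadic_matrix m], of size [n = 2 ^ m], has at [(k, l)], [k <> l], the entry [± 1 / |I|],
where [I] is the smallest dyadic interval containing [k] and [l].  It is a
martingale version of the Hilbert matrix: its upper triangle has sum [m n / 4],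
but the bilinear form is only [o(m) n] on the product of the unit balls of
[L_r] and [L_r'] over the uniform probability on [n] points, for conjugate
[1 < r, r'] ([dyadic_form_scalars]).  Each dyadic interval contributes products
of a mean of one function with a half-difference of means of the other, and by
strict convexity of [t ^ r] the half-differences are paid for by the growth of
the [r]-th moments of the conditional means from scale to scale.

_Comparison with [L_p] norms._  Choose [t] with [W(n) G(t) <= 1 <= W(n) G(2t)],
where [W(n)] is the sum of the first [n] weights; the indicator of [n] indices
then has norm about [1/t].  If [t |-> G (t ^ (1/p))] is equivalent to a convex
function, Chebyshev's sum inequality and Jensen's inequality show that on [n]
coordinates the normalised [L_p] norm is at most [C t] times the norm
([lorentz_mean]).  If it is equivalent to a concave function and [W] is convex,
Jensen's inequality gives the opposite estimate ([lorentz_combination_le]).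

In (a), the estimate from above and duality put the restrictions to [n]
coordinates of functionals of norm one into balls of [L_r] and [L_r']
([functional_moment]), so the dyadic matrix has small injective norm; its
triangle is large when tested on two functionals proportional to means.  In (b),
the estimates from below make the dyadic form a bilinear form of small norm on
the product of the two spaces.  It takes a large value on the triangle of the
matrix with all entries one, which is the elementary tensor of two sums of unit
vectors and has small projective norm. *)

(** * Real and complex scalars *)

Section scalars.
Context {R : realType} {s : scalar_kind}.
Local Notation K := (scalar_field R s).

Lemma rnorm0 (V : normedZmodType K) : rnorm (0 : V) = 0.
Proof. by apply: (@of_real_inj R s); rewrite of_rnorm normr0 of_real0. Qed.

Lemma rnormN (V : normedZmodType K) (x : V) : rnorm (- x) = rnorm x.
Proof. by rewrite /rnorm normrN. Qed.

Lemma rnormZ (V : normedModType K) (c : K) (x : V) : rnorm (c *: x) = rnorm c * rnorm x.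
Proof. by apply: (@of_real_inj R s); rewrite of_realM !of_rnorm normrZ. Qed.

Lemma rnormB (V : normedZmodType K) (x y : V) : rnorm (x - y) <= rnorm x + rnorm y.
Proof. by rewrite (le_trans (rnormD _ _))// rnormN. Qed.

Lemma rdistC (V : normedZmodType K) (x y : V) : rnorm (x - y) = rnorm (y - x).
Proof. by rewrite -rnormN opprB. Qed.

Lemma rnorm_le_dist (V : normedZmodType K) (x y : V) : rnorm x <= rnorm y + rnorm (x - y).
Proof. by rewrite -{1}(subrK y x) addrC rnormD. Qed.

Lemma rdist_triangle (V : normedZmodType K) (y x z : V) :
  rnorm (x - z) <= rnorm (x - y) + rnorm (y - z).
Proof. by rewrite (le_trans _ (rnormD _ _))// addrA subrK. Qed.

Lemma rnorm_sum (V : normedZmodType K) I (r : seq I) (P : pred I) (F : I -> V) :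
  rnorm (\sum_(i <- r | P i) F i) <= \sum_(i <- r | P i) rnorm (F i).
Proof.
elim/big_rec2 : _ => [|i x y _ yx]; first by rewrite rnorm0.
by rewrite (le_trans (rnormD _ _))// lerD2l.
Qed.

Lemma rnorm_of_real (x : R) : rnorm (of_real x : K) = `|x|.
Proof.
rewrite /rnorm /of_real /to_real; case: s => //=.
by rewrite expr0n/= addr0 sqrtr_sqr.
Qed.

Lemma of_real1 : of_real 1 = 1 :> K. Proof. by rewrite /of_real; case: s. Qed.

Lemma of_real_sum I (r : seq I) (P : pred I) (F : I -> R) :
  of_real (\sum_(i <- r | P i) F i) = \sum_(i <- r | P i) of_real (F i) :> K.
Proof. exact: (big_morph _ of_realD of_real0). Qed.

(** Over the reals the imaginary part is zero, so that complex products and norms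
    are given by the same formulas for both kinds of scalars. *)
Definition to_imag (x : K) : R :=
  (match s return scalar_field R s -> R with
   | RealScalars => fun=> 0 | ComplexScalars => @complex.Im R end) x.

Definition to_scalar (a b : R) : K :=
  match s return scalar_field R s with
  | RealScalars => a | ComplexScalars => (a +i* b)%C end.

Lemma to_realD (x y : K) : to_real (x + y) = to_real x + to_real y.
Proof. by rewrite /to_real; move: x y; case: s => //= -[? ?] [? ?]. Qed.

Lemma to_imagD (x y : K) : to_imag (x + y) = to_imag x + to_imag y.
Proof.
by rewrite /to_imag; move: x y; case: s => //= [? ?|[? ?] [? ?]//]; rewrite addr0.
Qed.

Lemma to_realN (x : K) : to_real (- x) = - to_real x.
Proof. by rewrite /to_real; move: x; case: s => //= -[? ?]. Qed.

Lemma to_imagN (x : K) : to_imag (- x) = - to_imag x.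
Proof. by rewrite /to_imag; move: x; case: s => //= [?|[? ?]//]; rewrite oppr0. Qed.

Lemma to_real_of_realM (c : R) (x : K) : to_real (of_real c * x) = c * to_real x.
Proof.
by rewrite /to_real /of_real; move: x; case: s => //= -[a b] /=; rewrite mul0r subr0.
Qed.

Lemma to_imag_of_realM (c : R) (x : K) : to_imag (of_real c * x) = c * to_imag x.
Proof.
rewrite /to_imag /of_real; move: x; case: s => //= [x|-[a b] /=].
  by rewrite mulr0.
by rewrite mul0r addr0.
Qed.

Lemma to_realM (x y : K) : to_real (x * y) = to_real x * to_real y - to_imag x * to_imag y.
Proof.
rewrite /to_real /to_imag; move: x y; case: s => //= [x y|[? ?] [? ?]//].
by rewrite mul0r subr0.
Qed.

Lemma to_imagM (x y : K) : to_imag (x * y) = to_real x * to_imag y + to_imag x * to_real y.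
Proof.
rewrite /to_real /to_imag; move: x y; case: s => //= [x y|[? ?] [? ?]//=].
by rewrite mul0r mulr0 addr0.
Qed.

Lemma to_real_sum I (r : seq I) (P : pred I) (F : I -> K) :
  to_real (\sum_(i <- r | P i) F i) = \sum_(i <- r | P i) to_real (F i) :> R.
Proof. by apply: (big_morph _ to_realD); rewrite /to_real; case: s. Qed.

Lemma to_imag_sum I (r : seq I) (P : pred I) (F : I -> K) :
  to_imag (\sum_(i <- r | P i) F i) = \sum_(i <- r | P i) to_imag (F i).
Proof. by apply: (big_morph _ to_imagD); rewrite /to_imag; case: s. Qed.

Lemma rnormE (x : K) : rnorm x = Num.sqrt (to_real x ^+ 2 + to_imag x ^+ 2).
Proof.
rewrite /rnorm /to_real /to_imag; move: x; case: s => //= [x|[a b]//=].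
by rewrite expr0n/= addr0 sqrtr_sqr.
Qed.

Lemma to_real_le (x : K) : `|to_real x| <= rnorm x.
Proof. by rewrite rnormE -sqrtr_sqr ler_sqrt ?addr_ge0 ?sqr_ge0// lerDl sqr_ge0. Qed.

Lemma to_imag_le (x : K) : `|to_imag x| <= rnorm x.
Proof. by rewrite rnormE -sqrtr_sqr ler_sqrt ?addr_ge0 ?sqr_ge0// lerDr sqr_ge0. Qed.

Lemma rnorm_le (x : K) : rnorm x <= `|to_real x| + `|to_imag x|.
Proof.
rewrite rnormE -(ger0_norm (addr_ge0 (normr_ge0 _) (normr_ge0 _))) -sqrtr_sqr.
rewrite ler_sqrt ?sqr_ge0// sqrrD !real_normK ?num_real// -addrA lerD2l lerDr.
by rewrite mulrn_wge0// mulr_ge0.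
Qed.

Lemma to_real_scalar a b : to_real (to_scalar a b) = a.
Proof. by rewrite /to_real /to_scalar; case: s. Qed.

(** An inequality only, since over the reals the second component of
    [to_scalar] is dropped. *)
Lemma to_imagB_scalar (x : K) a b : `|to_imag (x - to_scalar a b)| <= `|to_imag x - b|.
Proof.
rewrite /to_imag /to_scalar; move: x; case: s => //= [_|[? ?]//].
by rewrite normr0.
Qed.

Lemma cvg_rnormP (Y : normedModType K) (u : nat -> Y) (y : Y) :
  u @ \oo --> y <->
  forall e : R, 0 < e -> exists N, forall n, (N <= n)%N -> rnorm (u n - y) < e.
Proof.
split.
  move=> /cvgrPdist_lt uy e e0.
  have : 0 < of_real e :> K by rewrite -of_real0 of_real_lt.
  move=> /uy[N _ uN]; exists N => n Nn.
  by rewrite rdistC -(@of_real_lt R s) of_rnorm uN.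
move=> h; apply/cvgrPdist_lt => e e0.
have re : of_real (to_real e) = e.
  have := of_rnorm e; rewrite gtr0_norm//.
  by rewrite /rnorm gtr0_norm.
have /h[N uN] : 0 < to_real e by rewrite -(@of_real_lt R s) re of_real0.
exists N => // n /= Nn.
by rewrite -of_rnorm -re of_real_lt rdistC uN.
Qed.

Lemma rcauchy_cvg (Y : completeNormedModType K) (u : nat -> Y) :
  (forall e : R, 0 < e -> exists N, forall n, (N <= n)%N -> rnorm (u n - u N) < e) ->
  exists y : Y, forall e : R, 0 < e -> exists N, forall n, (N <= n)%N -> rnorm (u n - y) < e.
Proof.
move=> h.
suff : cvgn u by move=> uc; exists (lim (u @ \oo)); exact/cvg_rnormP.
apply/cauchy_cvgP/cauchyP => e e0.
have re : of_real (to_real e) = e.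
  have := of_rnorm e; rewrite gtr0_norm//.
  by rewrite /rnorm gtr0_norm.
have /h[N uN] : 0 < to_real e by rewrite -(@of_real_lt R s) re of_real0.
exists (u N); exists N => // n /= Nn.
by rewrite -ball_normE/= -of_rnorm -re of_real_lt rdistC uN.
Qed.

Lemma cvg_rcauchy (Y : normedModType K) (u : nat -> Y) : cvgn u ->
  forall e : R, 0 < e -> exists N, forall m n, (N <= m)%N -> (N <= n)%N -> rnorm (u m - u n) < e.
Proof.
move=> /cvg_rnormP uy e e0; have /uy[N uN] : 0 < e / 2 by rewrite divr_gt0.
exists N => m n Nm Nn; rewrite (le_lt_trans (rdist_triangle (lim (u @ \oo)) _ _))//.
by rewrite (splitr e) ltrD ?uN// rdistC uN.
Qed.

End scalars.

Section scalar_complete.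
Context {R : realType}.

Lemma real_cauchy_cvg (u : nat -> R) :
  (forall e : R, 0 < e -> exists N, forall n, (N <= n)%N -> `|u n - u N| < e) ->
  exists y : R, forall e : R, 0 < e -> exists N, forall n, (N <= n)%N -> `|u n - y| < e.
Proof. by move=> /(@rcauchy_cvg R RealScalars R u). Qed.

(** Completeness of the complex numbers, from that of the real and the imaginary
    parts. *)
Lemma scalar_cauchy_cvg (s : scalar_kind) (u : nat -> scalar_field R s) :
  (forall e : R, 0 < e -> exists N, forall n, (N <= n)%N -> rnorm (u n - u N) < e) ->
  exists y : scalar_field R s,
    forall e : R, 0 < e -> exists N, forall n, (N <= n)%N -> rnorm (u n - y) < e.
Proof.
move=> h.
have [|a ua] := @real_cauchy_cvg (to_real \o u).
  move=> e /h[N uN]; exists N => n /uN; apply: le_lt_trans.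
  by rewrite /= -to_realN -to_realD to_real_le.
have [|b ub] := @real_cauchy_cvg (to_imag \o u).
  move=> e /h[N uN]; exists N => n /uN; apply: le_lt_trans.
  by rewrite /= -to_imagN -to_imagD to_imag_le.
exists (to_scalar a b) => e e0.
have e2 : 0 < e / 2 by rewrite divr_gt0.
have [N1 h1] := ua _ e2; have [N2 h2] := ub _ e2.
exists (maxn N1 N2) => n; rewrite geq_max => /andP[/h1 n1 /h2 n2].
rewrite (le_lt_trans (rnorm_le _))// (splitr e) ltrD//.
  by rewrite to_realD to_realN to_real_scalar.
exact: le_lt_trans (to_imagB_scalar _ _ _) n2.
Qed.

End scalar_complete.

(** * Unconditional convergence *)

Section unconditional_sums.
Context {R : realType} {s : scalar_kind}.
Local Notation K := (scalar_field R s).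
Context {Y : completeNormedModType K}.

Let prefix_list (S : nat -> seq nat) : nat -> seq nat :=
  fix L i := if i is i'.+1 then
    let N := size (L i') in
    let M := maxn N.+1 (\max_(k <- S N) k).+1 in
    L i' ++ (S N ++ [seq k <- index_iota N M | k \notin S N])
  else [::].

(** Otherwise there are finite sets [S N] of indices [>= N] with sums of norm at
    least [e].  The lists [L i] below grow by appending such a set and then all
    indices skipped so far; they enumerate a permutation of the natural numbers, and the
    series rearranged by it has infinitely many blocks of norm at least [e]. *)
Lemma unconditional_tail (x : nat -> Y) :
  (forall sigma, bijective sigma -> cvgn (series (fun k => x (sigma k)))) ->
  forall e : R, 0 < e -> exists N, forall (A : pred nat) M,
    rnorm (\sum_(N <= k < M | A k) x k) < e.
Proof.
move=> xc e e0; apply: contrapT => /forallNP bad.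
have /choice[S hS] N : exists t : seq nat, [/\ uniq t, forall k, k \in t -> (N <= k)%N &
    e <= rnorm (\sum_(k <- t) x k)].
  have /existsNP[A /existsNP[M /negP]] := bad N; rewrite -leNgt => AM.
  exists [seq k <- index_iota N M | A k]; split.
  - exact/filter_uniq/iota_uniq.
  - by move=> k; rewrite mem_filter mem_index_iota => /and3P[].
  - by rewrite big_filter.
pose L := prefix_list S.
pose B i := S (size (L i)) ++ [seq k <- index_iota (size (L i))
  (maxn (size (L i)).+1 (\max_(k <- S (size (L i))) k).+1) | k \notin S (size (L i))].
have LS i : L i.+1 = L i ++ B i by [].
have L0 : L 0%N = [::] by [].
clearbody L.
have permL i : perm_eq (L i) (iota 0 (size (L i))) /\ (i <= size (L i))%N.
  elim: i => [|i [ih ihs]]; first by rewrite L0.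
   set N := size (L i) in ihs ih.
  pose M := maxn N.+1 (\max_(k <- S N) k).+1.
  have [uS SN _] := hS N.
  have NM : (N < M)%N by rewrite leq_maxl.
  have pB : perm_eq (B i) (index_iota N M).
    apply: uniq_perm; rewrite ?iota_uniq//.
      rewrite cat_uniq uS filter_uniq ?iota_uniq//= andbT.
      by apply/hasPn => k; rewrite mem_filter => /andP[].
    move=> k; rewrite mem_cat mem_filter -/N.
    case: (boolP (k \in S N)) => //= kS.
    rewrite mem_index_iota SN//= leq_max; apply/esym/orP; right.
    by rewrite ltnS (@leq_bigmax_seq _ (S N) predT id).
  have := perm_cat ih pB; rewrite -LS => pL.
  have sL := perm_size pL; rewrite size_cat !size_iota subnKC in sL; last exact: ltnW.
  split; last by rewrite sL (leq_ltn_trans ihs).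
  rewrite sL (perm_trans pL)// /index_iota.
  by rewrite -{2}[N]add0n -iotaD subnKC// ltnW.
have sizeL i := (permL i).2.
have uL i : uniq (L i) by rewrite (perm_uniq (permL i).1) iota_uniq.
have prefL i j : (i <= j)%N -> exists t, L j = L i ++ t.
  elim: j => [|j ih]; first by rewrite leqn0 => /eqP->; exists [::]; rewrite cats0.
  rewrite leq_eqVlt => /predU1P[->|/ih[t et]]; first by exists [::]; rewrite cats0.
  by exists (t ++ B j); rewrite LS et catA.
pose sigma k := nth 0%N (L k.+1) k.
have sigmaE i k : (k < size (L i))%N -> sigma k = nth 0%N (L i) k.
  move=> ki; rewrite /sigma; case: (leqP i k.+1) => [/prefL[t ->]|/ltnW/prefL[t ->]].
    by rewrite nth_cat ki.
  by rewrite nth_cat sizeL.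
have bij : bijective sigma.
  apply: (@Bijective _ _ _ (fun m => index m (L m.+1))).
    move=> k; rewrite /sigma /=; set m := nth _ _ k.
    have mL : m \in L k.+1 by rewrite mem_nth.
    have mm : m \in L m.+1.
      by rewrite (perm_mem (permL m.+1).1) mem_iota add0n/= sizeL.
    rewrite -/m; transitivity (index m (L (maxn k.+1 m.+1))).
      have [t ->] := prefL _ _ (leq_maxr k.+1 m.+1).
      by rewrite index_cat mm.
    have [t ->] := prefL _ _ (leq_maxl k.+1 m.+1).
    by rewrite index_cat mL index_uniq.
  move=> m; have mm : m \in L m.+1.
    by rewrite (perm_mem (permL m.+1).1) mem_iota add0n/= sizeL.
  by rewrite (sigmaE m.+1) ?nth_index// index_mem.
have sums i j : (j <= size (L i))%N ->
    series (fun k => x (sigma k)) j = \sum_(k <- take j (L i)) x k.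
  move=> ji; rewrite /series/= [RHS](big_nth 0%N) size_takel//.
  rewrite [LHS]big_nat_cond [RHS]big_nat_cond.
  apply: eq_bigr => k /andP[/andP[_ kj] _].
  by rewrite nth_take// (sigmaE i)// (leq_trans kj).
have [N hN] := cvg_rcauchy (xc sigma bij) e0.
have [uS SN eS] := hS (size (L N)).
have := hN (size (L N) + size (S (size (L N))))%N (size (L N)).
rewrite (leq_trans (sizeL N) (leq_addr _ _)) sizeL => /(_ isT isT).
have LNS : L N.+1 = (L N ++ S (size (L N))) ++ drop (size (S (size (L N)))) (B N).
  by rewrite LS -catA; congr (_ ++ _); rewrite /B drop_size_cat.
rewrite (sums N.+1); last by rewrite LNS 2!size_cat leq_addr.
rewrite (sums N)// LNS take_size_cat ?size_cat// take_size big_cat/=.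
by rewrite addrAC subrr add0r ltNge eS.
Qed.

Lemma unconditional_bounded (x : nat -> Y) :
  (forall sigma, bijective sigma -> cvgn (series (fun k => x (sigma k)))) ->
  exists M : R, forall (A : pred nat) N, rnorm (\sum_(k < N | A k) x k) <= M.
Proof.
move=> /unconditional_tail /(_ _ ltr01)[N0 hN].
exists (\sum_(k < N0) rnorm (x k) + 1) => A N.
rewrite -(big_mkord A) -(big_mkord xpredT (fun k => rnorm (x k))).
have h0 m : rnorm (\sum_(0 <= k < m | A k) x k) <= \sum_(0 <= k < m) rnorm (x k).
  rewrite (le_trans (rnorm_sum _ _ _))// big_mkcond/=.
  by apply: ler_sum => k _; case: (A k) => //; exact: rnorm_ge0.
have [NN0|/ltnW NN0] := leqP N N0.
  rewrite (le_trans (h0 _))// (le_trans _ (_ : \sum_(0 <= k < N0) rnorm (x k) <= _))//.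
    rewrite [leRHS](big_cat_nat (leq0n _) NN0)//= lerDl sumr_ge0// => k _; exact: rnorm_ge0.
  by rewrite lerDl.
rewrite (big_cat_nat (leq0n _) NN0)//= (le_trans (rnormD _ _))// lerD//.
exact/ltW/hN.
Qed.

End unconditional_sums.

(** * A Baire category argument *)

Section geometric.
Context {R : realType}.

Lemma half_small (c e : R) : 0 <= c -> 0 < e -> exists N, forall n, (N <= n)%N -> c / 2 ^+ n < e.
Proof.
move=> c0 e0.
exists (Num.truncn (c / e)).+1 => n Nn.
rewrite ltr_pdivrMr ?exprn_gt0// -ltr_pdivrMl// mulrC.
rewrite (lt_le_trans (truncnS_gt _))// (le_trans (_ : _ <= n%:R))// ?ler_nat//.
by rewrite -natrX ler_nat ltnW// ltn_expl.
Qed.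

Lemma half_sum (c : R) m n : 0 <= c -> \sum_(m <= k < n) c / 2 ^+ k <= 2 * c / 2 ^+ m.
Proof.
move=> c0; case: (leqP n m) => [nm|/ltnW mn].
  by rewrite big_geq// divr_ge0 ?mulr_ge0// exprn_ge0.
suff : \sum_(m <= k < n) c / 2 ^+ k <= 2 * c / 2 ^+ m - 2 * c / 2 ^+ n.
  by move=> /le_trans; apply; rewrite gerBl divr_ge0 ?mulr_ge0// exprn_ge0.
elim: n mn => [|n ih]; first by rewrite leqn0 => /eqP->; rewrite big_geq// subrr.
rewrite leq_eqVlt => /predU1P[->|mn]; first by rewrite big_geq// subrr.
rewrite big_nat_recr//= (le_trans (lerD (ih mn) (lexx _)))//.
rewrite exprS invfM; lra.
Qed.

End geometric.

Section baire.
Context {R : realType} {s : scalar_kind}.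
Local Notation K := (scalar_field R s).
Context {Y : completeNormedModType K}.

(** Baire's theorem in the form needed for real and for complex Banach spaces
    alike: if sets cover the space, one of them is dense in some ball.  If not,
    nested balls that avoid the sets one after the other shrink to a point of
    none of them. *)
Lemma baire_cover (F : nat -> set Y) : (forall y, exists n, F n y) ->
  exists n x (r : R), 0 < r /\ forall y, rnorm (y - x) < r ->
    forall e : R, 0 < e -> exists2 z, F n z & rnorm (y - z) < e.
Proof.
move=> cover; apply: contrapT => bad.
have /choice[f hf] (q : nat * (Y * R)) : exists p : Y * R, 0 < q.2.2 ->
    [/\ 0 < p.2, rnorm (p.1 - q.2.1) + p.2 <= q.2.2, p.2 <= q.2.2 / 2 &
    forall z, rnorm (p.1 - z) <= p.2 -> ~ F q.1 z].
  case: q => n [x r] /=.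
  have [r0|] := ltP 0 r; last by move=> r0; exists (x, r); rewrite ltNge r0.
  have [y [yr]] : exists y, rnorm (y - x) < r /\ exists2 e : R, 0 < e &
      forall z, rnorm (y - z) < e -> ~ F n z.
    apply: contrapT => /forallNP h; apply: bad; exists n, x, r; split=> // y yr e e0.
    apply: contrapT => h'; apply: (h y); split=> //; exists e => // z zy Fz.
    by apply: h'; exists z.
  move=> [e e0 he].
  exists (y, Num.min (e / 2) (Num.min (r - rnorm (y - x)) (r / 2))) => _ /=.
  have d0 : 0 < r - rnorm (y - x) by rewrite subr_gt0.
  split=> [|||z].
  - by rewrite !lt_min d0 !divr_gt0.
  - by rewrite -lerBrDl !ge_min lexx !orbT.
  - by rewrite !ge_min lexx !orbT.
  - rewrite le_min => /andP[ze _]; apply: he; apply: (le_lt_trans ze).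
    by rewrite ltr_pdivrMr// ltr_pMr// ltr1n.
pose st := fix st n : Y * R := if n is n'.+1 then f (n', st n') else (0, 1).
have st0 n : 0 < (st n).2.
  by elim: n => [|n ih] /=; [exact: ltr01 | have [] := hf (n, st n) ih].
have stS n : [/\ 0 < (st n.+1).2, rnorm ((st n.+1).1 - (st n).1) + (st n.+1).2 <= (st n).2,
    (st n.+1).2 <= (st n).2 / 2 &
    forall z, rnorm ((st n.+1).1 - z) <= (st n.+1).2 -> ~ F n z].
  exact: hf (n, st n) (st0 n).
clearbody st.
have st1 : exists2 c : R, 0 <= c & forall n, (st n).2 <= c / 2 ^+ n.
  exists (st 0).2; first exact: ltW.
  elim=> [|n ih]; first by rewrite expr0 divr1.
  have [_ _ h _] := stS n; rewrite (le_trans h)// exprS invfM mulrA mulrAC.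
  by rewrite ler_pM2r ?invr_gt0.
have D n m : (n <= m)%N -> rnorm ((st m).1 - (st n).1) + (st m).2 <= (st n).2.
  elim: m => [|m ih]; first by rewrite leqn0 => /eqP->; rewrite subrr rnorm0 add0r.
  rewrite leq_eqVlt => /predU1P[->|/ih]; first by rewrite subrr rnorm0 add0r.
  apply: le_trans; have [_ h _ _] := stS m.
  apply: le_trans (lerD (lexx _) h).
  by rewrite addrA lerD2r addrC rdist_triangle.
have D' n m : (n <= m)%N -> rnorm ((st m).1 - (st n).1) <= (st n).2.
  by move=> /D; apply: le_trans; rewrite lerDl ltW.
have [c c0 stc] := st1.
have [|x hx] := @rcauchy_cvg R s Y (fst \o st).
  move=> e e0; have [N hN] := half_small c0 e0; exists N => n /D' /= h.
  by rewrite (le_lt_trans h)// (le_lt_trans (stc _))// hN.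
have [n Fn] := cover x.
have [_ _ _ /(_ x)] := stS n; apply => //.
apply/ler_addgt0Pr => e e0; have [N hN] := hx e e0.
rewrite rdistC (le_trans (rdist_triangle (st (maxn N n.+1)).1 _ _))// addrC lerD//.
  by rewrite D' ?leq_maxr.
by rewrite rdistC ltW// hN ?leq_maxl.
Qed.

End baire.

(** * Coordinates in an unconditional basis *)

Section unconditional_constant.
Context {R : realType} {s : scalar_kind}.
Local Notation K := (scalar_field R s).
Context {Y : completeNormedModType K} (e : nat -> Y).

Definition partial_sum (a : nat -> K) (A : pred nat) N : Y :=
  \sum_(k < N | A k) a k *: e k.

Definition coordinates (a : Y -> nat -> K) :=
  [/\ forall y, series (fun k => a y k *: e k) @ \oo --> y,
    forall y b, series (fun k => b k *: e k) @ \oo --> y -> b = a y &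
    forall c y z, a (c *: y + z) = fun k => c * a y k + a z k].

Lemma partial_sumD c (a b : nat -> K) A N :
  partial_sum (fun k => c * a k + b k) A N = c *: partial_sum a A N + partial_sum b A N.
Proof.
rewrite /partial_sum scaler_sumr -big_split; apply: eq_bigr => k _ /=.
by rewrite scalerDl scalerA.
Qed.

Lemma seriesE (a : nat -> K) N :
  series (fun k => a k *: e k) N = partial_sum a predT N.
Proof. by rewrite /series/= big_mkord. Qed.

Lemma coordinates_exist : schauder_basis e -> exists a, coordinates a.
Proof.
move=> be; have /choice[a ha] y := be y.
have au y b : series (fun k => b k *: e k) @ \oo --> y -> b = a y.
  by move=> h; rewrite ((ha y).2 _ h).
exists a; split=> // [y|c y z]; first exact: (ha y).1.
apply/esym/au.
rewrite (_ : series _ = c *: series (fun k => a y k *: e k) + series (fun k => a z k *: e k)).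
  by apply: cvgD; [apply: cvgZl_tmp|]; exact: (ha _).1.
by apply/funext => N; rewrite /= !fctE/= !seriesE partial_sumD.
Qed.

Variable a : Y -> nat -> K.
Hypothesis ha : coordinates a.

Let aD y z : a (y + z) = fun k => a y k + a z k.
Proof.
have [_ _ /(_ 1 y z)] := ha; rewrite scale1r => ->.
by apply/funext => k; rewrite mul1r.
Qed.

Let a0 : a 0 = fun=> 0.
Proof.
have := aD 0 0; rewrite addr0 => h; apply/funext => k.
have := congr1 (fun f => f k) h => /eqP.
by rewrite -subr_eq subrr => /eqP.
Qed.

Let aZ c z : a (c *: z) = fun k => c * a z k.
Proof.
have [_ _ /(_ c z 0)] := ha; rewrite addr0 => ->.
by apply/funext => k; rewrite a0 addr0.
Qed.

Lemma coordinatesB y z k : a (y - z) k = a y k - a z k.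
Proof. by rewrite -scaleN1r aD aZ mulN1r. Qed.

(** If [e k] were zero, the vector zero would have two expansions. *)
Lemma basis_neq0 k : 0 < rnorm (e k).
Proof.
rewrite lt_neqAle rnorm_ge0 andbT eq_sym; apply/eqP => /rnorm_eq0 ek.
have [_ au _] := ha.
have := au 0 (fun j => (j == k)%:R).
rewrite (_ : series _ = fun=> 0).
  move=> /(_ (cvg_cst _))/(congr1 (fun f => f k))/eqP.
  by rewrite a0 eqxx oner_eq0.
apply/funext => N; rewrite /series/= big1// => j _.
by have [->|] := eqVneq j k; rewrite ?ek ?scaler0// scale0r.
Qed.

Let bounded_by (M : R) z := forall A N, rnorm (partial_sum (a z) A N) <= M.

Let partial_sumsD y z A N :
  partial_sum (a (y + z)) A N = partial_sum (a y) A N + partial_sum (a z) A N.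
Proof.
have [_ _ /(_ 1 y z)] := ha; rewrite scale1r => ->.
by rewrite partial_sumD scale1r.
Qed.

Let partial_sumsZ c z A N : partial_sum (a (c *: z)) A N = c *: partial_sum (a z) A N.
Proof.
rewrite aZ /partial_sum scaler_sumr; apply: eq_bigr => k _.
by rewrite scalerA.
Qed.

Let partial_sumsB y z A N :
  partial_sum (a (y - z)) A N = partial_sum (a y) A N - partial_sum (a z) A N.
Proof. by rewrite partial_sumsD -scaleN1r partial_sumsZ scaleN1r. Qed.

Hypothesis ue : unconditional_basis e.

(** The vectors whose partial sums over all sets of basis vectors are bounded by
    [n] cover the space when [n] varies, so for one [n] they are dense in a ball;
    differences and scaling turn this into approximation of every vector. *)
Let approx : exists2 D : R, 0 < D & forall z (d : R), 0 < d ->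
  exists2 z', bounded_by (D * rnorm z) z' & rnorm (z - z') < d.
Proof.
have [_ ub] := ue; have [ac _ _] := ha.
have [|n [x [r [r0 hr]]]] := @baire_cover _ _ Y (fun n => bounded_by n%:R).
  move=> y; have [|M hM] := @unconditional_bounded _ _ _ (fun k => a y k *: e k).
    by apply: ub; apply/cvg_ex; exists y; exact: ac.
  exists (Num.truncn M).+1 => A N; rewrite (le_trans (hM A N))//.
  exact/ltW/truncnS_gt.
have n2 : 0 < 2 * n.+1%:R :> R by [].
exists (2 * n.+1%:R * (2 / r)); first by rewrite !mulr_gt0// invr_gt0.
move=> z d d0; have [->|z0] := eqVneq z 0.
  exists 0; last by rewrite subr0 rnorm0.
  by move=> A N; rewrite rnorm0 mulr0 a0 /partial_sum big1 ?rnorm0// => k _; rewrite scale0r.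
have nz : 0 < rnorm z.
  by rewrite lt_neqAle rnorm_ge0 andbT eq_sym; apply: contra_neq z0 => /rnorm_eq0.
pose c := r / (2 * rnorm z).
have c0 : 0 < c by rewrite divr_gt0// mulr_gt0.
have cK : rnorm (of_real c : K) = c by rewrite rnorm_of_real gtr0_norm.
have cKV : rnorm (of_real c^-1 : K) = c^-1 by rewrite rnorm_of_real gtr0_norm// invr_gt0.
have cz : rnorm (of_real c *: z) < r.
  rewrite rnormZ cK /c invfM -mulrA mulrVK ?unitfE ?gt_eqF//.
  by rewrite ltr_pdivrMr// ltr_pMr// ltr1n.
have dc : 0 < d * c / 2 by rewrite divr_gt0// mulr_gt0.
have [|y1 by1 ny1] := hr (x + of_real c *: z) _ _ dc; first by rewrite addrAC subrr add0r.
have [|y2 by2 ny2] := hr x _ _ dc; first by rewrite subrr rnorm0.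
exists (of_real c^-1 *: (y1 - y2)).
  move=> A N; rewrite partial_sumsZ partial_sumsB rnormZ cKV.
  rewrite ler_pdivrMl// (le_trans (rnormB _ _))// (le_trans (lerD (by1 A N) (by2 A N)))//.
  rewrite (_ : c * _ = n.+1%:R * 2).
    by rewrite -natrM -natrD ler_nat; lia.
  rewrite /c; have := lt0r_neq0 r0; have := lt0r_neq0 nz; move: (rnorm z) => q q0 r0'.
  by field; rewrite q0 r0'.
have -> : z - of_real c^-1 *: (y1 - y2) =
    of_real c^-1 *: ((x + of_real c *: z - y1) - (x - y2)).
  rewrite -{1}(scale1r z) -of_real1 -(mulVf (lt0r_neq0 c0)) of_realM -scalerA -scalerBr.
  rewrite !opprB; congr (_ *: _); rewrite [x + _]addrC -!addrA; congr (_ + _).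
  by rewrite addrCA [x + _]addrC subrK addrC.
rewrite rnormZ cKV ltr_pdivrMl// (le_lt_trans (rnormB _ _))// mulrC.
by rewrite (splitr (d * c)) ltrD.
Qed.

(** The argument of the open mapping theorem.  Approximate [y], then the error, and
    so on; the successive approximations are summable for the norm given by the
    supremum of all partial sums, so their coordinates add up to coordinates of
    an expansion of [y], which is the expansion by uniqueness.  Continuity
    of the coordinates is a consequence. *)
Lemma unconditional_constant : exists2 C : R, 0 < C & forall y A N,
  rnorm (partial_sum (a y) A N) <= C * rnorm y.
Proof.
have [D D0 hD] := approx; have [ac au _] := ha.
exists (2 * D); first by rewrite mulr_gt0.
move=> y; have [->|y0] := eqVneq y 0.
  move=> A N; rewrite rnorm0 mulr0 a0 /partial_sum big1 ?rnorm0// => k _.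
  by rewrite scale0r.
set q := rnorm y.
have q0 : 0 < q.
  by rewrite lt_neqAle rnorm_ge0 andbT eq_sym; apply: contra_neq y0 => /rnorm_eq0.
have q2 m : 0 < q / 2 ^+ m.+1 by rewrite divr_gt0// exprn_gt0.
have /choice[f hf] (p : Y * nat) : exists z', bounded_by (D * rnorm p.1) z' /\
    rnorm (p.1 - z') < q / 2 ^+ p.2.+1.
  by have [z' ? ?] := hD p.1 _ (q2 p.2); exists z'.
pose r := fix r m : Y := if m is m'.+1 then r m' - f (r m', m') else y.
have rS m : r m.+1 = r m - f (r m, m) by [].
have r0 : r 0%N = y by [].
clearbody r.
have rq m : rnorm (r m) <= q / 2 ^+ m.
  case: m => [|m]; first by rewrite r0 expr0 divr1.
  by rewrite rS; exact/ltW/(hf (r m, m)).2.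
pose w m := y - r m.
have Dq0 : 0 <= D * q by rewrite ltW// mulr_gt0.
have step m A N : rnorm (partial_sum (a (w m.+1)) A N - partial_sum (a (w m)) A N) <=
    D * q / 2 ^+ m.
  rewrite -partial_sumsB /w rS.
  have -> : y - (r m - f (r m, m)) - (y - r m) = f (r m, m).
    by rewrite !opprB addrC addrA subrK addrC subrK.
  rewrite (le_trans ((hf (r m, m)).1 A N))//= -mulrA ler_wpM2l//; exact: ltW.
have tele m n A N : (m <= n)%N ->
    rnorm (partial_sum (a (w n)) A N - partial_sum (a (w m)) A N) <= 2 * (D * q) / 2 ^+ m.
  move=> mn; apply: le_trans (half_sum m n Dq0).
  elim: n mn => [|n ih]; first by rewrite leqn0 => /eqP->; rewrite subrr rnorm0 big_geq.
  rewrite leq_eqVlt => /predU1P[->|mn]; first by rewrite subrr rnorm0 big_geq.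
  rewrite big_nat_recr//= addrC.
  rewrite (le_trans (rdist_triangle (partial_sum (a (w n)) A N) _ _))// lerD ?ih//.
have tail m n A N : rnorm (partial_sum (a (w n)) A N - partial_sum (a (w m)) A N) <=
    2 * (D * q) / 2 ^+ minn m n.
  case: (leqP m n) => [|/ltnW] mn; first exact: tele.
  by rewrite rdistC; exact: tele.
have /choice[b hb] k : exists bk : K, forall d : R, 0 < d ->
    exists N, forall n, (N <= n)%N -> rnorm (a (w n) k - bk) < d.
  apply: scalar_cauchy_cvg => d d0.
  have [N hN] := half_small (mulr_ge0 (ler0n R 2) Dq0) (mulr_gt0 d0 (basis_neq0 k)).
  exists N => n Nn; rewrite -(ltr_pM2r (basis_neq0 k)) -rnormZ.
  apply: le_lt_trans (hN N (leqnn N)).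
  have := tele N n (pred1 k) k.+1 Nn.
  rewrite /partial_sum !(big_pred1 (Ordinal (ltnSn k))) ?scalerBl// => j //=.
have lim_b A N (d : R) : 0 < d -> exists M, forall m, (M <= m)%N ->
    rnorm (partial_sum (a (w m)) A N - partial_sum b A N) < d.
  elim: N d => [|N ih] d d0.
    by exists 0%N => m _; rewrite /partial_sum !big_ord0 subrr rnorm0.
  have d2 : 0 < d / 2 by rewrite divr_gt0.
  have [M1 h1] := ih _ d2.
  have [M2 h2] := hb N (d / 2 / rnorm (e N)) (divr_gt0 d2 (basis_neq0 N)).
  exists (maxn M1 M2) => m; rewrite geq_max => /andP[/h1 m1 /h2 m2].
  rewrite /partial_sum big_mkcond/= big_ord_recr/= -big_mkcond/=.
  rewrite [X in _ - X]big_mkcond/= big_ord_recr/= -big_mkcond/=.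
  rewrite opprD addrACA (le_lt_trans (rnormD _ _))// (splitr d) ltrD//.
  case: (A N); last by rewrite subrr rnorm0.
  by rewrite -scalerBl rnormZ -ltr_pdivlMr ?basis_neq0.
have dist_b m A N : rnorm (partial_sum (a (w m)) A N - partial_sum b A N) <=
    2 * (D * q) / 2 ^+ m.
  apply/ler_addgt0Pr => d /(lim_b A N)[M hM].
  rewrite (le_trans (rdist_triangle (partial_sum (a (w (maxn m M))) A N) _ _))// lerD//.
    by rewrite rdistC tele ?leq_maxl.
  by rewrite ltW// hM ?leq_maxr.
have -> : a y = b.
  apply/esym/au/cvg_rnormP => d d0.
  have d3 : 0 < d / 3 by rewrite divr_gt0.
  have [M1 h1] := half_small (mulr_ge0 (ler0n R 2) Dq0) d3.
  have [M2 h2] := half_small (ltW q0) d3.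
  pose M := maxn M1 M2.
  have [N hN] := (cvg_rnormP _ _).1 (ac (w M)) _ d3.
  exists N => n /hN; rewrite !seriesE => hn.
  rewrite (le_lt_trans (rdist_triangle (partial_sum (a (w M)) predT n) _ _))//.
  have -> : d = d / 3 + (d / 3 + d / 3) by lra.
  rewrite ltrD//.
    by rewrite rdistC (le_lt_trans (dist_b _ _ _))// h1// leq_maxl.
  rewrite (le_lt_trans (rdist_triangle (w M) _ _))// ltrD//.
  by rewrite rdistC /w opprB addrC subrK (le_lt_trans (rq _))// h2// leq_maxr.
move=> A N.
have := dist_b 0%N A N; rewrite expr0 divr1 -mulrA rdistC.
suff -> : partial_sum (a (w 0%N)) A N = 0 by rewrite subr0.
by rewrite /w r0 subrr a0 /partial_sum big1// => k _; rewrite scale0r.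
Qed.

End unconditional_constant.

(** * Pigeonhole principle and gliding humps *)

Section pigeonhole.
Context {R : realType}.

Definition infinite_pred (J : nat -> Prop) := forall n, exists2 i, (n <= i)%N & J i.

Lemma pigeonhole (c : nat -> R) (M d : R) (J : nat -> Prop) :
  infinite_pred J -> 0 < d -> (forall i, `|c i| <= M) ->
  exists J' : nat -> Prop, [/\ infinite_pred J', forall i, J' i -> J i &
    forall i j, J' i -> J' j -> `|c i - c j| <= d].
Proof.
move=> iJ d0 cM.
have main t : forall lo J, infinite_pred J -> (forall i, J i -> lo <= c i < lo + d *+ t) ->
    exists J' : nat -> Prop, [/\ infinite_pred J', forall i, J' i -> J i &
    forall i j, J' i -> J' j -> `|c i - c j| <= d].
  elim: t => [|t ih] lo I iI hI.
    by have [i _ /hI] := iI 0%N; rewrite mulr0n addr0 => /andP[/le_lt_trans h/h]; rewrite ltxx.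
  have [inf|] := pselect (infinite_pred (fun i => I i /\ c i < lo + d)).
    exists (fun i => I i /\ c i < lo + d); split=> // [i []//|i j [/hI/andP[li _] ci]
      [/hI/andP[lj _] cj]].
    by rewrite ler_norml; lra.
  move=> /existsNP[n0 hn0].
  have iI' : infinite_pred (fun i => I i /\ (n0 <= i)%N).
    move=> n; have [i nn0 Ii] := iI (maxn n n0); move: nn0; rewrite geq_max => /andP[ni n0i].
    by exists i.
  have [i [Ii ni]|J' [h1 h2 h3]] := ih (lo + d) _ iI'; last first.
    by exists J'; split=> // i /h2[].
  have /andP[li ui] := hI _ Ii; rewrite -addrA -mulrS ui andbT leNgt; apply/negP => ci.
  by apply: hn0; exists i.
have M0 : 0 <= M by rewrite (le_trans _ (cM 0%N)).
apply: (main (Num.truncn (2 * M / d)).+1 (- M) J iJ) => i _.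
have := cM i; rewrite ler_norml => /andP[-> /=] /le_lt_trans; apply.
have := truncnS_gt (2 * M / d); rewrite ltr_pdivrMr// (mulr_natl d).
set q := d *+ _; lra.
Qed.

Lemma pigeonhole_family (c : nat -> nat -> R) N (d : R) (J : nat -> Prop) :
  infinite_pred J -> 0 < d -> (forall k, (k < N)%N -> exists M, forall i, `|c k i| <= M) ->
  exists J' : nat -> Prop, [/\ infinite_pred J', forall i, J' i -> J i &
    forall k i j, (k < N)%N -> J' i -> J' j -> `|c k i - c k j| <= d].
Proof.
move=> iJ d0; elim: N => [|N ih] cM; first by exists J.
have [|J1 [i1 J1J c1]] := ih; first by move=> k kN; apply: cM; exact: ltnW.
have [M hM] := cM N (ltnSn N).
have [J2 [i2 J21 c2]] := pigeonhole i1 d0 hM.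
exists J2; split=> // [i /J21/J1J//|k i j].
rewrite ltnS leq_eqVlt => /predU1P[->|kN Ji Jj]; first exact: c2.
by apply: c1 => //; exact: J21.
Qed.

(** This replaces weak convergence: far out there are two indices at which
    finitely many bounded sequences nearly agree. *)
Lemma pigeonhole_scalars (s : scalar_kind) (c : nat -> nat -> scalar_field R s) N (d : R) i0 :
  0 < d -> (forall k, (k < N)%N -> exists M, forall i, rnorm (c k i) <= M) ->
  exists i j, [/\ (i0 <= i)%N, (i < j)%N &
    forall k, (k < N)%N -> rnorm (c k i - c k j) <= d].
Proof.
move=> d0 cM; have d2 : 0 < d / 2 by rewrite divr_gt0.
have [||J1 [i1 _ c1]] := @pigeonhole_family (fun k i => to_real (c k i)) N (d / 2) xpredT _ d2.
- by move=> n; exists n.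
- move=> k /cM[M hM]; exists M => i; exact: le_trans (to_real_le _) (hM i).
have [|J2 [i2 J21 c2]] := @pigeonhole_family (fun k i => to_imag (c k i)) N (d / 2) J1 i1 d2.
  move=> k /cM[M hM]; exists M => i; exact: le_trans (to_imag_le _) (hM i).
have [i i0i Ji] := i2 i0; have [j ij Jj] := i2 i.+1.
exists i, j; split=> // k kN; rewrite (le_trans (rnorm_le _))// (splitr d) lerD//.
  by rewrite to_realD to_realN c1//; exact: J21.
by rewrite to_imagD to_imagN c2.
Qed.

End pigeonhole.

(** Finitely many dependent choices, where the condition on the [l]-th choice may
    refer to the earlier ones. *)
Lemma sequential_choice (T : Type) (x0 : T) (Q : nat -> (nat -> T) -> T -> Prop) :
  (forall l f g x, (forall k, (k < l)%N -> f k = g k) -> Q l f x -> Q l g x) ->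
  (forall l f, (forall k, (k < l)%N -> Q k f (f k)) -> exists x, Q l f x) ->
  forall n, exists f, forall l, (l < n)%N -> Q l f (f l).
Proof.
move=> loc ex; elim=> [|n [f hf]]; first by exists (fun=> x0).
have [x hx] := ex n f hf.
have fE k : (k < n)%N -> f k = (fun k => if k == n then x else f k) k.
  by move=> kn /=; rewrite ltn_eqF.
exists (fun k => if k == n then x else f k) => l; rewrite ltnS leq_eqVlt => /predU1P[->|ln].
  by rewrite eqxx; exact: loc hx.
rewrite -fE//; apply: loc (hf l ln) => k kl; apply: fE; exact: ltn_trans ln.
Qed.

(** For [y i j] the image of [e_i ⊗ f_j], this is the image of
    [(e_p1 - e_p2) ⊗ (f_q1 - f_q2)]. *)
Definition second_difference {Y : zmodType} (y : nat -> nat -> Y) (p q : nat * nat) : Y :=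
  (y p.1 q.1 - y p.2 q.1) - (y p.1 q.2 - y p.2 q.2).

Definition increasing_pairs (u : nat -> nat * nat) n :=
  (forall l, (l < n)%N -> ((u l).1 < (u l).2)%N) /\
  (forall k l, (k < l < n)%N -> ((u k).2 < (u l).1)%N).

Section gliding_hump.
Context {R : realType} {s : scalar_kind}.
Local Notation K := (scalar_field R s).
Context {Y : completeNormedModType K} (e : nat -> Y).
Variable a : Y -> nat -> K.
Hypothesis ha : coordinates e a.
Hypothesis ue : unconditional_basis e.

(** Bounding the partial sums over all sets outside the block, and not just the
    remainder [z - P z], makes the property directly usable for every projection
    that respects the block. *)
Definition concentrated (d : R) (z : Y) b b' := forall (A : pred nat) N,
  (forall k, A k -> ~~ (b <= k < b')%N) -> rnorm (partial_sum e (a z) A N) <= d.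

Let small_tail (d : R) z : 0 < d -> exists N, forall (A : pred nat) M,
  rnorm (\sum_(N <= k < M | A k) a z k *: e k) < d.
Proof.
move=> d0; have [ac _ _] := ha; have [_ ub] := ue.
apply: unconditional_tail => //.
by apply: ub; apply/cvg_ex; exists z; exact: ac.
Qed.

Let small_tails (d : R) (z : nat -> Y) L : 0 < d ->
  exists N0, forall l N, (l < L)%N -> (N0 <= N)%N -> forall (A : pred nat) M,
  rnorm (\sum_(N <= k < M | A k) a (z l) k *: e k) <= d.
Proof.
move=> d0; elim: L => [|L [N1 h1]]; first by exists 0%N.
have [N2 h2] := small_tail (z L) d0.
exists (maxn N1 N2) => l N; rewrite ltnS leq_eqVlt geq_max.
move=> /predU1P[->|lL] /andP[n1 n2] A M; last exact: h1.
by rewrite (big_nat_widenl _ _ _ _ _ n2) ltW.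
Qed.

Let sum_initial_le (x : nat -> R) N Q : (forall k, 0 <= x k) ->
  \sum_(0 <= k < Q | (k < N)%N) x k <= \sum_(0 <= k < N) x k.
Proof.
move=> x0; have [QN|/ltnW NQ] := leqP Q N; last by rewrite (big_nat_widen _ _ _ _ _ NQ).
rewrite [leRHS](big_cat_nat (leq0n _) QN)//= (le_trans (_ : _ <= \sum_(0 <= k < Q) x k))//.
  by rewrite big_mkcond/=; apply: ler_sum => k _; case: ifP.
by rewrite lerDl sumr_ge0.
Qed.

(** The coordinates below [N] of [f l i - f l j] are made small by pigeonhole, those
    beyond a large [N'] are small because the expansion converges
    unconditionally. *)
Lemma gliding_step (f : nat -> nat -> Y) L (M d : R) N i0 :
  (forall l i, rnorm (f l i) <= M) -> 0 < d ->
  exists i j N', [/\ (i0 <= i)%N, (i < j)%N, (N <= N')%N &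
    forall l, (l < L)%N -> concentrated d (f l i - f l j) N N'].
Proof.
move=> fM d0; have [C C0 hC] := unconditional_constant ha ue.
have d2 : 0 < d / 2 by rewrite divr_gt0.
pose E := \sum_(0 <= k < N) rnorm (e k) + 1.
have E0 : 0 < E by rewrite ltr_wpDl// sumr_ge0// => k _; exact: rnorm_ge0.
(* the N first coordinates of the L sequences, as a single family *)
pose c t i := a (f (t %/ N)%N i) (t %% N)%N.
have e0 := basis_neq0 ha.
have [|i [j [i0i ij cij]]] := @pigeonhole_scalars _ s c (L * N)%N (d / 2 / E) i0 (divr_gt0 d2 E0).
  move=> t _; exists (C * M / rnorm (e (t %% N)%N)) => i.
  rewrite ler_pdivlMr// -rnormZ.
  have := hC (f (t %/ N)%N i) (pred1 (t %% N)%N) (t %% N).+1.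
  rewrite /partial_sum (big_pred1 (Ordinal (ltnSn (t %% N))))//= => /le_trans; apply.
  by rewrite ler_wpM2l// ltW.
have [N0 hN0] := small_tails (fun l => f l i - f l j) L d2.
exists i, j, (maxn N N0); split=> //; first exact: leq_maxl.
move=> l lL A Q hA; rewrite /partial_sum.
set z := f l i - f l j.
rewrite -(big_mkord A (fun k => a z k *: e k)) (bigID (fun k => (k < N)%N))/=.
rewrite (le_trans (rnormD _ _))// (splitr d) lerD//; last first.
  rewrite (eq_bigl (fun k => A k && (maxn N N0 <= k)%N)).
    rewrite -(big_nat_widenl _ _ _ _ _ (leq0n _)).
    by apply: hN0 => //; exact: leq_maxr.
  move=> k; case: (boolP (A k)) => //= /hA.
  rewrite -leqNgt negb_and -leqNgt -ltnNge => /orP[kN|].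
    by rewrite leqNgt kN; apply/esym/negbTE; rewrite -ltnNge (leq_trans kN)// leq_maxl.
  by move=> Nk; rewrite (leq_trans (leq_maxl _ _) Nk) Nk.
rewrite (le_trans (rnorm_sum _ _ _))//.
rewrite (le_trans (_ : _ <= \sum_(0 <= k < Q | (k < N)%N) d / 2 / E * rnorm (e k)))//.
  rewrite big_mkcond [leRHS]big_mkcond/=; apply: ler_sum => k _.
  case: (boolP (k < N)%N) => kN; rewrite ?andbF// andbT.
  have h : 0 <= d / 2 / E * rnorm (e k) by rewrite mulr_ge0 ?rnorm_ge0// ltW// divr_gt0.
  case: (A k) => //; rewrite rnormZ ler_wpM2r ?rnorm_ge0//.
  have := cij (l * N + k)%N; rewrite /c divnMDl ?modnMDl; last exact: leq_ltn_trans kN.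
  rewrite divn_small// modn_small// addn0 => h'.
  rewrite /z (coordinatesB ha) h'//.
  by rewrite (@leq_trans (l.+1 * N))// ?leq_mul2r ?lL ?orbT// mulSn addnC ltn_add2r.
rewrite (le_trans (sum_initial_le _ _ _))//.
  by move=> k; rewrite mulr_ge0 ?rnorm_ge0// ltW// divr_gt0.
by rewrite -mulr_sumr -mulrA ler_piMr ?(ltW d2)// ler_pdivrMl// mulr1 lerDl.
Qed.

End gliding_hump.

(** * Triangular truncation *)

Lemma addrBACA (V : zmodType) (x y z t : V) : x - y - (z - t) = x - z - (y - t).
Proof. by rewrite !opprB !addrA addrAC (addrAC x) addrAC. Qed.

Section triangle.
Context {R : realType} {s : scalar_kind}.
Local Notation K := (scalar_field R s).
Context {Y : completeNormedModType K} (e : nat -> Y).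
Variable a : Y -> nat -> K.
Hypothesis ha : coordinates e a.
Hypothesis ue : unconditional_basis e.

(** One step of the construction: a pair of rows, a pair of columns, and the block
    boundaries.  Entries of the new rows with the old columns live on
    the block from [hlow] to [hmid], entries of the new columns with the rows up
    to the new ones on the block from [hmid] to [hup]. *)
Record hump := Hump { hrow : nat * nat; hcol : nat * nat; hlow : nat; hmid : nat; hup : nat }.

Definition next_hump (y : nat -> nat -> Y) (d : R) l (h : nat -> hump) (x : hump) :=
  [/\ ((hrow x).1 < (hrow x).2)%N /\ ((hcol x).1 < (hcol x).2)%N,
    (hlow x <= hmid x)%N /\ (hmid x <= hup x)%N,
    forall k, (k < l)%N -> [/\ ((hrow (h k)).2 < (hrow x).1)%N,
      ((hcol (h k)).2 < (hcol x).1)%N & (hup (h k) <= hlow x)%N],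
    forall k, (k < l)%N ->
      concentrated e a d (second_difference y (hrow x) (hcol (h k))) (hlow x) (hmid x) &
    forall k, (k <= l)%N ->
      concentrated e a d (second_difference y (hrow (if k == l then x else h k)) (hcol x))
        (hmid x) (hup x)].

Lemma next_hump_exists (y : nat -> nat -> Y) (M d : R) :
  (forall i j, rnorm (y i j) <= M) -> 0 < d -> forall l (h : nat -> hump),
  exists x, next_hump y d l h x.
Proof.
move=> yM d0 l h.
(* beyond all rows, columns and blocks used so far *)
pose top (F : nat -> nat) := (\max_(k < l) F k)%N.
have topP F k : (k < l)%N -> (F k <= top F)%N.
  by move=> kl; exact: (@leq_bigmax _ (fun k : 'I_l => F k) (Ordinal kl)).
pose f k i := y i (hcol (h k)).1 - y i (hcol (h k)).2.
have fM k i : rnorm (f k i) <= M + M by rewrite (le_trans (rnormB _ _))// lerD.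
have [i [i' [N1 [h1 ii' N01 cI]]]] := gliding_step ha ue l (top (hup \o h))
  (top (fun k => (hrow (h k)).2)).+1 fM d0.
pose row k := if k == l then (i, i') else hrow (h k).
pose g k j := y (row k).1 j - y (row k).2 j.
have gM k j : rnorm (g k j) <= M + M by rewrite (le_trans (rnormB _ _))// lerD.
have [j [j' [N2 [h2 jj' N12 cJ]]]] := gliding_step ha ue l.+1 N1
  (top (fun k => (hcol (h k)).2)).+1 gM d0.
exists (Hump (i, i') (j, j') (top (hup \o h)) N1 N2); split=> //=.
- move=> k kl; split.
  + exact: leq_ltn_trans (topP (fun k => (hrow (h k)).2) k kl) h1.
  + exact: leq_ltn_trans (topP (fun k => (hcol (h k)).2) k kl) h2.
  + exact: (topP (hup \o h)).
- move=> k kl; have := cI k kl; rewrite /f /second_difference/=.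
  by rewrite addrBACA.
- move=> k kl; have := cJ k kl; rewrite /g /row /second_difference.
  by case: (k == l).
Qed.

Lemma humps_exist (y : nat -> nat -> Y) (M d : R) n :
  (forall i j, rnorm (y i j) <= M) -> 0 < d ->
  exists h : nat -> hump, forall l, (l < n)%N -> next_hump y d l h (h l).
Proof.
move=> yM d0.
apply: (@sequential_choice _ (Hump (0, 0) (0, 0) 0 0 0)%N (next_hump y d)).
  move=> l f g x fg [x1 x2 x3 x4 x5]; split=> // k kl.
  - by have [? ? ?] := x3 k kl; rewrite -fg.
  - by rewrite -fg//; exact: x4.
  - have := x5 k kl; case: eqVneq => // kl'; rewrite fg//.
    by rewrite ltn_neqAle kl' kl.
by move=> l f _; exact: (next_hump_exists yM d0).
Qed.

(** The union [A] of the blocks from [hmid] to [hup] carries the entries with [k <= l] and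
    is disjoint from the blocks of the others, so the projection onto [A] is the
    truncation up to an error [d'] per entry. *)
Lemma triangle_projection_coordinates : exists2 C : R, 0 < C &
  forall (y : nat -> nat -> Y) (M : R), (forall i j, rnorm (y i j) <= M) ->
  forall n (d : R), 0 < d -> exists u v : nat -> nat * nat,
  [/\ increasing_pairs u n, increasing_pairs v n &
    forall c : nat -> nat -> K, (forall k l, rnorm (c k l) <= 1) ->
    rnorm (\sum_(k < n) \sum_(l < n | (k <= l)%N) c k l *: second_difference y (u k) (v l)) <=
    C * rnorm (\sum_(k < n) \sum_(l < n) c k l *: second_difference y (u k) (v l)) + d].
Proof.
have [C C0 hC] := unconditional_constant ha ue.
exists C => // y M yM n d d0.
pose d' := d / n.+1%:R ^+ 2.
have d'0 : 0 < d' by rewrite divr_gt0// exprn_gt0.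
have [h hh] := humps_exist n yM d'0.
exists (hrow \o h), (hcol \o h); split.
- split=> [l /hh[[] //]|k l /andP[kl /hh[_ _ /(_ k kl)[]]]//].
- split=> [l /hh[[] //]|k l /andP[kl /hh[_ _ /(_ k kl)[]]]//].
move=> c c1.
pose z k l := second_difference y ((hrow \o h) k) ((hcol \o h) l).
pose A : pred nat := fun i => [exists l : 'I_n, (hmid (h l) <= i < hup (h l))%N].
pose N := (\max_(l < n) hup (h l))%N.
have AN i : A i -> (i < N)%N.
  move=> /existsP[l /andP[_ il]]; rewrite (leq_trans il)//.
  exact: (@leq_bigmax _ (fun l : 'I_n => hup (h l)) l).
have ord k l : (k < l < n)%N -> (hup (h k) <= hlow (h l))%N.
  by move=> /andP[kl /hh[_ _ /(_ k kl)[]]].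
have ord2 k : (k < n)%N -> (hlow (h k) <= hmid (h k))%N /\ (hmid (h k) <= hup (h k))%N.
  by move=> /hh[].
have lower k l : (l < k < n)%N -> rnorm (partial_sum e (a (z k l)) A N) <= d'.
  move=> /andP[lk kn]; have [_ _ _ /(_ l lk) cz _] := hh k kn.
  apply: cz => i /existsP[m /andP[mi im]]; apply/negP => /andP[ki ik].
  have [km|mk|km] := ltngtP k m.
  - have := ord k m; rewrite km ltn_ord => /(_ isT).
    have := ord2 k kn; have := ord2 m (ltn_ord m); lia.
  - have := ord m k; rewrite mk kn => /(_ isT).
    have := ord2 k kn; have := ord2 m (ltn_ord m); lia.
  - by move: mi im; rewrite -km => mi im; have := ord2 k kn; lia.
have upper k l : (k <= l < n)%N -> rnorm (z k l - partial_sum e (a (z k l)) A N) <= d'.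
  move=> /andP[kl ln]; have [_ _ _ _ /(_ k kl)] := hh l ln.
  rewrite (_ : (if _ then _ else _) = h k); last by case: eqP => // ->.
  rewrite -/(z k l) => cz.
  have [ac _ _] := ha.
  apply/ler_addgt0Pr => t t0.
  have [Q hQ] := (cvg_rnormP _ _).1 (ac (z k l)) t t0.
  pose Q' := maxn Q N.
  have := hQ Q' (leq_maxl _ _); rewrite seriesE => hQ'.
  rewrite (le_trans (rdist_triangle (partial_sum e (a (z k l)) predT Q') _ _))//.
  rewrite addrC lerD//; last by rewrite rdistC ltW.
  rewrite (_ : _ - _ = partial_sum e (a (z k l)) (predC A) Q').
    apply: cz => i; apply: contra => il; apply/existsP; by exists (Ordinal ln).
  rewrite /partial_sum -!(big_mkord _ (fun i => a (z k l) i *: e i)).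
  rewrite (bigID A)/= (_ : \sum_(0 <= i < Q' | A i) _ = \sum_(0 <= i < N | A i) a (z k l) i *: e i).
    by rewrite addrAC subrr add0r.
  rewrite [RHS](big_nat_widen _ _ _ _ _ (leq_maxr Q N)); apply: eq_bigl => i.
  by case: (boolP (A i)) => // /AN ->.
pose PA w := partial_sum e (a w) A N.
pose W := \sum_(k < n) \sum_(l < n) c k l *: z k l.
have PAD x w : PA (x + w) = PA x + PA w.
  by have [_ _ /(_ 1 x w)] := ha; rewrite scale1r /PA => ->; rewrite partial_sumD scale1r.
have PA0 : PA 0 = 0.
  by have := PAD 0 0; rewrite addr0 => /eqP; rewrite -subr_eq subrr => /eqP.
have PAZ b x : PA (b *: x) = b *: PA x.
  have [_ _ /(_ b x 0)] := ha; rewrite addr0 /PA => ->.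
  by rewrite partial_sumD -/(PA 0) PA0 addr0.
have PAW : PA W = \sum_(k < n) \sum_(l < n) c k l *: PA (z k l).
  rewrite /W (big_morph PA PAD PA0); apply: eq_bigr => k _.
  by rewrite (big_morph PA PAD PA0); apply: eq_bigr => l _; rewrite PAZ.
rewrite (le_trans (rnorm_le_dist _ (PA W)))// lerD//; first exact: hC.
rewrite PAW -sumrB (le_trans (rnorm_sum _ _ _))//.
have bound : forall k : 'I_n, rnorm (\sum_(l < n | (k <= l)%N) c k l *: z k l -
    \sum_(l < n) c k l *: PA (z k l)) <= n%:R * d'.
  move=> k; rewrite [X in X - _]big_mkcond/= -sumrB (le_trans (rnorm_sum _ _ _))//.
  rewrite -[n in leRHS]card_ord mulr_natl -sumr_const; apply: ler_sum => l _.
  case: (leqP k l) => kl.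
    rewrite -scalerBr rnormZ (le_trans _ (upper k l _)) ?kl ?ltn_ord//.
    by rewrite ler_piMl ?rnorm_ge0.
  rewrite sub0r rnormN rnormZ (le_trans _ (lower k l _)) ?kl ?ltn_ord//.
  by rewrite ler_piMl ?rnorm_ge0.
rewrite (le_trans (ler_sum _ (fun k _ => bound k)))// sumr_const card_ord -[leLHS]mulr_natl mulrA.
rewrite /d' mulrCA ler_piMr ?(ltW d0)// ler_pdivrMr ?exprn_gt0// mul1r.
by rewrite expr2 ler_pM ?ler_nat.
Qed.

End triangle.

Theorem triangle_projection {R : realType} {s : scalar_kind}
    {Y : completeNormedModType (scalar_field R s)} (e : nat -> Y) :
  unconditional_basis e -> exists2 C : R, 0 < C &
  forall (y : nat -> nat -> Y) (M : R), (forall i j, rnorm (y i j) <= M) ->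
  forall n (d : R), 0 < d -> exists u v : nat -> nat * nat,
  [/\ increasing_pairs u n, increasing_pairs v n &
    forall c : nat -> nat -> scalar_field R s, (forall k l, rnorm (c k l) <= 1) ->
    rnorm (\sum_(k < n) \sum_(l < n | (k <= l)%N) c k l *: second_difference y (u k) (v l)) <=
    C * rnorm (\sum_(k < n) \sum_(l < n) c k l *: second_difference y (u k) (v l)) + d].
Proof.
move=> ue; have [a ha] := coordinates_exist ue.1.
exact: triangle_projection_coordinates ha ue.
Qed.

(** * Quantitative strict convexity of powers *)

Section midpoint_gain.
Context {R : realType}.
Implicit Types (a b d r : R).

Lemma conjugate_gt1 r r' : 1 < r -> r^-1 + r'^-1 = 1 -> 1 < r'.
Proof.
move=> r1 rr'; have r0 : 0 < r by exact: lt_trans ltr01 r1.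
have r'E : r'^-1 = 1 - r^-1 by rewrite -rr' addrAC subrr add0r.
have r'1 : r'^-1 < 1 by rewrite r'E gtrBl invr_gt0.
have r'0 : 0 < r'^-1 by rewrite r'E subr_gt0 invf_lt1.
by rewrite -invf_lt1// -invr_gt0.
Qed.

(** The tangent inequality of [t ^ r], obtained from Young's inequality. *)
Lemma powR_tangent r u x : 1 < r -> 0 <= u -> 0 <= x ->
  x `^ r + r * x `^ (r - 1) * (u - x) <= u `^ r.
Proof.
move=> r1 u0 x0; have r0 : 0 < r by exact: lt_trans ltr01 r1.
have r10 : 0 < r - 1 by rewrite subr_gt0.
have := @conjugate_powR _ u (x `^ (r - 1)) r (r / (r - 1)) u0 (powR_ge0 _ _) r0.
have -> : r^-1 + (r / (r - 1))^-1 = 1.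
  by field; rewrite gt_eqF ?gt_eqF.
rewrite divr_gt0// => /(_ isT erefl).
rewrite -powRrM (_ : (r - 1) * (r / (r - 1)) = r); last by field; rewrite gt_eqF.
have <- := mulr_powRB1 x0 r0; set X := x `^ (r - 1).
rewrite -(ler_pM2l r0) mulrDr (mulrCA r (u `^ r)) divff ?gt_eqF// mulr1.
rewrite (_ : r * (x * X / (r / (r - 1))) = (r - 1) * (x * X)); last first.
  by field; rewrite !gt_eqF.
by move=> h; rewrite (_ : x * X + _ = r * (u * X) - (r - 1) * (x * X)) ?lerBlDr//; ring.
Qed.

(** Strict convexity of [|.| ^ r] makes this positive for [d != 0]; it is the growth
    of the [r]-th moment of the means from one dyadic scale to the next. *)
Definition gain r a d := (`|a + d| `^ r + `|a - d| `^ r) / 2 - `|a| `^ r.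

Lemma gain_abs r a d : gain r a d = gain r `|a| `|d|.
Proof.
have main x y : 0 <= x -> gain r x y = gain r x `|y|.
  move=> x0; have [y0|y0] := ger0P y; rewrite ?ger0_norm// /gain.
  by rewrite opprK [X in X / 2]addrC.
have [a0|a0] := ger0P a; first by rewrite main.
have e1 : `|- a + d| = `|a - d| by rewrite -normrN opprD opprK.
have e2 : `|- a - d| = `|a + d| by rewrite -opprD normrN.
rewrite -(main (- a)) ?oppr_ge0 ?(ltW a0)// /gain normrN e1 e2.
by rewrite [X in _ = X / 2 - _]addrC.
Qed.

(** Two tangent steps from [a] to [a + d], through [a + d / 2], and one from [a] to
    [|a - d|]; the first-order terms at [a] cancel. *)
Lemma gain_ge r a d : 1 < r -> 0 <= a -> 0 <= d ->
  r / 4 * d * ((a + d / 2) `^ (r - 1) - a `^ (r - 1)) <= gain r a d.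
Proof.
move=> r1 a0 d0; have r0 : 0 < r by exact: lt_trans ltr01 r1.
have y0 : 0 <= a + d / 2 by rewrite addr_ge0// divr_ge0.
have t1 := powR_tangent r1 (addr_ge0 a0 d0) y0.
have t2 := powR_tangent r1 y0 a0.
have t3 := powR_tangent r1 (normr_ge0 (a - d)) a0.
have d1 : - d <= `|a - d| - a by have := ler_norm (a - d); lra.
rewrite /gain (ger0_norm a0) (ger0_norm (addr_ge0 a0 d0)).
have t4 : - (r * a `^ (r - 1) * d) <= r * a `^ (r - 1) * (`|a - d| - a).
  by rewrite -mulrN ler_wpM2l// mulr_ge0 ?powR_ge0// ltW.
move: t1 t2 t3 t4; set p1 := (a + d) `^ r; set p2 := `|a - d| `^ r.
set y := (a + d / 2) `^ (r - 1); set x := a `^ (r - 1).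
set q := (a + d / 2) `^ r; set z := a `^ r; set w := _ * (`|a - d| - a).
rewrite (_ : a + d - (a + d / 2) = d / 2); last by field.
rewrite (_ : a + d / 2 - a = d / 2); last by ring.
rewrite (_ : r / 4 * d * (y - x) = (r * y * (d / 2) - r * x * (d / 2)) / 2); last by field.
rewrite (_ : r * x * d = r * x * (d / 2) * 2); last by field.
set A := _ * (d / 2); set B := _ * (d / 2); lra.
Qed.

Lemma gain_ge0 r a d : 1 < r -> 0 <= gain r a d.
Proof.
move=> r1; rewrite gain_abs (le_trans _ (gain_ge r1 _ _))//.
rewrite mulr_ge0// ?mulr_ge0//; first by rewrite ltW// (lt_trans _ r1).
have d2 : 0 <= `|d| / 2 by rewrite divr_ge0.
rewrite subr_ge0; apply: ge0_ler_powR; rewrite ?nnegrE ?subr_ge0 ?(ltW r1) ?lerDl ?addr_ge0//.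
Qed.

(** Where [|d|] is small compared with [|a|] the second term suffices; elsewhere the
    gain is at least a multiple of [|d| ^ r], by strict monotonicity of
    [t ^ (r - 1)]. *)
Lemma difference_le_gain r (eps : R) : 1 < r -> 0 < eps ->
  exists2 A : R, 0 < A & forall a d, `|d| `^ r <= A * gain r a d + eps * `|a| `^ r.
Proof.
move=> r1 eps0; have r0 : 0 < r by exact: lt_trans ltr01 r1.
have r10 : 0 < r - 1 by rewrite subr_gt0.
pose k := eps `^ r^-1; have k0 : 0 < k by rewrite powR_gt0.
have kr : k `^ r = eps by rewrite -powRrM mulVf ?gt_eqF// powRr1// ltW.
pose L := ((1 + k / 2) `^ (r - 1))^-1.
have L0 : 0 < (1 + k / 2) `^ (r - 1) by rewrite powR_gt0// addr_gt0// divr_gt0.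
have L1 : L < 1.
  rewrite invf_lt1//; have E : 1 `^ (r - 1) = 1 :> R by rewrite powR1.
  rewrite -[ltLHS]E.
  have k2 : 0 < k / 2 by rewrite divr_gt0.
  by apply: gt0_ltr_powR; rewrite ?nnegrE ?ltrDl// addr_ge0// ltW.
pose c := r / 4 * (1 - L) * (2^-1 `^ (r - 1)).
have c0 : 0 < c by rewrite !mulr_gt0 ?subr_gt0 ?powR_gt0.
exists c^-1; first by rewrite invr_gt0.
move=> a d; rewrite gain_abs.
have a0 := normr_ge0 a; have d0 := normr_ge0 d.
move: `|a| `|d| a0 d0 => {}a {}d a0 d0.
have [dk|kd] := leP d (k * a).
  rewrite -[leLHS]add0r lerD ?mulr_ge0 ?invr_ge0 ?(ltW c0) ?gain_ge0//.
  rewrite -kr -powRM ?(ltW k0)// ge0_ler_powR ?nnegrE ?(ltW r0)// mulr_ge0//.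
  exact: ltW.
rewrite -[leLHS]addr0 lerD ?mulr_ge0 ?powR_ge0 ?(ltW eps0)//.
rewrite ler_pdivlMl// (le_trans _ (gain_ge r1 a0 d0))//.
rewrite -(mulr_powRB1 d0 r0) /c.
have -> : r / 4 * (1 - L) * 2^-1 `^ (r - 1) * (d * d `^ (r - 1)) =
   r / 4 * d * ((1 - L) * (2^-1 * d) `^ (r - 1)).
  by rewrite powRM ?invr_ge0//; ring.
rewrite ler_wpM2l// ?mulr_ge0 ?divr_ge0 ?(ltW r0)//.
have aL : a `^ (r - 1) <= L * (a + d / 2) `^ (r - 1).
  rewrite /L ler_pdivlMl// -powRM ?addr_ge0 ?divr_ge0 ?(ltW k0)//.
  rewrite ge0_ler_powR ?nnegrE ?(ltW r10)//.
  - by rewrite mulr_ge0// addr_ge0// divr_ge0// ltW.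
  - by rewrite addr_ge0// divr_ge0.
  - by move: kd; lra.
rewrite (le_trans (_ : _ <= (1 - L) * (a + d / 2) `^ (r - 1)))//.
  rewrite ler_wpM2l ?subr_ge0 ?(ltW L1)// ge0_ler_powR ?nnegrE ?(ltW r10)//.
  - by rewrite mulr_ge0// invr_ge0.
  - by rewrite addr_ge0// divr_ge0.
  - by rewrite mulrC lerDr.
by rewrite mulrBl mul1r lerB.
Qed.

Lemma product_le_gain r r' (t : R) : 1 < r -> r^-1 + r'^-1 = 1 -> 0 < t ->
  exists2 A : R, 0 < A & forall a d b,
    `|d| * `|b| <= A * gain r a d + t * (`|a| `^ r + `|b| `^ r').
Proof.
move=> r1 rr' t0; have r0 : 0 < r by exact: lt_trans ltr01 r1.
have r'1 := conjugate_gt1 r1 rr'; have r'0 : 0 < r' by exact: lt_trans ltr01 r'1.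
(* the weight in Young's inequality that gives the factor [t] to [|b| ^ r'] *)
pose k := t `^ r'^-1; have k0 : 0 < k by rewrite powR_gt0.
have kr : k `^ r' = t by rewrite -powRrM mulVf ?gt_eqF// powRr1// ltW.
pose q := k `^ r; have q0 : 0 < q by rewrite powR_gt0.
have [A A0 hA] := difference_le_gain r1 (mulr_gt0 t0 q0).
exists (A / q); first by rewrite divr_gt0.
move=> a d b.
have := @conjugate_powR _ (k^-1 * `|d|) (k * `|b|) r r' _ _ r0 r'0 rr'.
rewrite !mulr_ge0 ?invr_ge0 ?(ltW k0)// => /(_ isT isT).
rewrite mulrACA mulVf ?gt_eqF// mul1r => /le_trans; apply.
rewrite !powRM ?invr_ge0 ?(ltW k0)// kr.
have -> : k^-1 `^ r = q^-1 by rewrite -powR_inv1 ?(ltW k0)// -powRrM mulN1r powRN.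
apply: (@le_trans _ _ (q^-1 * `|d| `^ r + t * `|b| `^ r')).
  rewrite lerD// ler_pdivrMr// ler_peMr ?(ltW r1) ?(ltW r'1)// mulr_ge0 ?powR_ge0 ?invr_ge0 ?ltW//.
rewrite (mulrDr t) addrA lerD2r (le_trans (ler_wpM2l _ (hA a d)))// ?invr_ge0 ?(ltW q0)//.
rewrite le_eqVlt; apply/orP; left; apply/eqP.
by field; rewrite gt_eqF.
Qed.

End midpoint_gain.

(** * The dyadic matrix *)

Section dyadic.
Context {R : realType}.

(** The two diagonal blocks are copies of the previous matrix, the upper right
    block is constant and the lower left block is its negative.  Only
    the entries below [2 ^ m] have a meaning. *)
Fixpoint dyadic_matrix m (k l : nat) : R :=
  if m is m'.+1 then
    if (k < 2 ^ m')%N then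
      if (l < 2 ^ m')%N then dyadic_matrix m' k l else 2^-1 ^+ m
    else if (l < 2 ^ m')%N then - 2^-1 ^+ m
      else dyadic_matrix m' (k - 2 ^ m')%N (l - 2 ^ m')%N
  else 0.

Lemma dyadic_matrix_le1 m k l : `|dyadic_matrix m k l| <= 1.
Proof.
elim: m k l => [|m ih] k l /=; first by rewrite normr0.
have h : `|2^-1 ^+ m.+1 : R| <= 1.
  by rewrite ger0_norm ?exprn_ge0 ?invr_ge0// exprn_ile1 ?invr_ge0// invf_le1// ler1n.
by do 2!case: ifP => _ //; rewrite normrN.
Qed.

Lemma sum_expn2S m (F : nat -> R) :
  \sum_(k < 2 ^ m.+1) F k = \sum_(k < 2 ^ m) F k + \sum_(k < 2 ^ m) F (2 ^ m + k)%N.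
Proof.
rewrite -!(big_mkord xpredT) expnS mul2n -addnn.
rewrite (big_cat_nat (leq0n _) (leq_addr _ _))/=; congr (_ + _).
rewrite -[X in index_iota X _]add0n big_addn addnK.
by rewrite big_mkord; apply: eq_bigr => k _; rewrite addnC.
Qed.

Lemma sum2_expn2S m (F : nat -> nat -> R) :
  \sum_(k < 2 ^ m.+1) \sum_(l < 2 ^ m.+1) F k l =
  \sum_(k < 2 ^ m) \sum_(l < 2 ^ m) F k l +
  \sum_(k < 2 ^ m) \sum_(l < 2 ^ m) F k (2 ^ m + l)%N +
  (\sum_(k < 2 ^ m) \sum_(l < 2 ^ m) F (2 ^ m + k)%N l +
   \sum_(k < 2 ^ m) \sum_(l < 2 ^ m) F (2 ^ m + k)%N (2 ^ m + l)%N).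
Proof.
rewrite (sum_expn2S m (fun k => \sum_(l < 2 ^ m.+1) F k l)).
by congr (_ + _); rewrite -big_split; apply: eq_bigr => k _ /=; rewrite sum_expn2S.
Qed.

Definition dyadic_shift m (f : nat -> R) : nat -> R := fun k => f (2 ^ m + k)%N.

Definition dyadic_form m (f g : nat -> R) :=
  \sum_(k < 2 ^ m) \sum_(l < 2 ^ m) dyadic_matrix m k l * (f k * g l).

Definition dyadic_mean m (f : nat -> R) := (\sum_(k < 2 ^ m) f k) / 2 ^+ m.

Lemma dyadic_meanS m f :
  dyadic_mean m.+1 f = (dyadic_mean m f + dyadic_mean m (dyadic_shift m f)) / 2.
Proof. by rewrite /dyadic_mean sum_expn2S exprS invfM -!mulrDl mulrA mulrAC. Qed.

Lemma sum_dyadic_mean m (f : nat -> R) : \sum_(k < 2 ^ m) f k = 2 ^+ m * dyadic_mean m f.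
Proof. by rewrite /dyadic_mean mulrC divfK// expf_neq0. Qed.

Lemma dyadic_formS m f g : dyadic_form m.+1 f g =
  dyadic_form m f g + dyadic_form m (dyadic_shift m f) (dyadic_shift m g) +
  2^-1 * 2 ^+ m * (dyadic_mean m f * dyadic_mean m (dyadic_shift m g) -
                   dyadic_mean m (dyadic_shift m f) * dyadic_mean m g).
Proof.
have cst (c : R) (f' g' : nat -> R) : \sum_(k < 2 ^ m) \sum_(l < 2 ^ m) c * (f' k * g' l) =
    c * 2 ^+ m * 2 ^+ m * (dyadic_mean m f' * dyadic_mean m g').
  transitivity (c * ((\sum_(k < 2 ^ m) f' k) * (\sum_(l < 2 ^ m) g' l))).
    rewrite mulr_suml mulr_sumr; apply: eq_bigr => k _.
    by rewrite mulr_sumr mulr_sumr.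
  by rewrite !sum_dyadic_mean; ring.
have lt_h (k : 'I_(2 ^ m)) : (k < 2 ^ m)%N by [].
have ge_h (k : 'I_(2 ^ m)) : (2 ^ m + k < 2 ^ m)%N = false by rewrite ltnNge leq_addr.
rewrite /dyadic_form (sum2_expn2S m (fun k l => dyadic_matrix m.+1 k l * (f k * g l)))/=.
rewrite [X in X + _ + _](_ : _ = \sum_(k < 2 ^ m) \sum_(l < 2 ^ m) dyadic_matrix m k l * (f k *
  g l)); last first.
  by apply: eq_bigr => k _; apply: eq_bigr => l _; rewrite !lt_h.
rewrite [X in _ + X + _](_ : _ = \sum_(k < 2 ^ m) \sum_(l < 2 ^ m) 2^-1 ^+ m.+1 * (f k *
  dyadic_shift m g l)); last first.
  by apply: eq_bigr => k _; apply: eq_bigr => l _; rewrite lt_h ge_h.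
rewrite [X in _ + (X + _)](_ : _ = \sum_(k < 2 ^ m) \sum_(l < 2 ^ m) - 2^-1 ^+ m.+1 *
  (dyadic_shift m f k * g l)); last first.
  by apply: eq_bigr => k _; apply: eq_bigr => l _; rewrite lt_h ge_h.
rewrite [X in _ + (_ + X)](_ : _ = \sum_(k < 2 ^ m) \sum_(l < 2 ^ m) dyadic_matrix m k l *
  (dyadic_shift m f k * dyadic_shift m g l)); last first.
  by apply: eq_bigr => k _; apply: eq_bigr => l _; rewrite !ge_h !addKn.
rewrite !cst exprS exprVn.
have n0 : 2 ^+ m != 0 :> R by rewrite expf_neq0.
move: (\sum_(k < _) _) (\sum_(k < _) _) (dyadic_mean m f) (dyadic_mean m g)
  (dyadic_mean m (dyadic_shift m f)) (dyadic_mean m (dyadic_shift m g)) => A B a1 b1 a2 b2.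
by field.
Qed.

Lemma dyadic_upper m :
  \sum_(k < 2 ^ m) \sum_(l < 2 ^ m | (k <= l)%N) dyadic_matrix m k l = m%:R * 2 ^+ m / 4.
Proof.
elim: m => [|m ih]; first by rewrite !mul0r big1// => k _; rewrite big1.
under eq_bigr => k _ do rewrite big_mkcond/=.
rewrite (sum2_expn2S m (fun k l => if (k <= l)%N then dyadic_matrix m.+1 k l else 0)).
have lt_h (k : 'I_(2 ^ m)) : (k < 2 ^ m)%N by [].
have ge_h (k : 'I_(2 ^ m)) : (2 ^ m + k < 2 ^ m)%N = false by rewrite ltnNge leq_addr.
rewrite /=.
rewrite [X in X + _ + _](_ : _ = \sum_(k < 2 ^ m) \sum_(l < 2 ^ m | (k <= l)%N) dyadic_matrix m
  k l); last first.
  by apply: eq_bigr => k _; rewrite [RHS]big_mkcond; apply: eq_bigr => l _; rewrite !lt_h.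
rewrite [X in _ + X + _](_ : _ = \sum_(k < 2 ^ m) \sum_(l < 2 ^ m) 2^-1 ^+ m.+1); last first.
  apply: eq_bigr => k _; apply: eq_bigr => l _; rewrite lt_h ge_h.
  by rewrite (leq_trans (ltnW (lt_h k)))// leq_addr.
rewrite [X in _ + (X + _)](_ : _ = 0); last first.
  rewrite big1// => k _; rewrite big1// => l _; case: ifP => // kl.
  by have := leq_ltn_trans kl (lt_h l); rewrite ge_h.
rewrite [X in _ + (_ + X)](_ : _ = \sum_(k < 2 ^ m) \sum_(l < 2 ^ m | (k <= l)%N) dyadic_matrix
  m k l); last first.
  apply: eq_bigr => k _; rewrite [RHS]big_mkcond; apply: eq_bigr => l _.
  by rewrite !ge_h !addKn leq_add2l.
have -> : \sum_(k < 2 ^ m) \sum_(l < 2 ^ m) 2^-1 ^+ m.+1 = 2^-1 ^+ m.+1 * 2 ^+ m * 2 ^+ m :> R.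
  by rewrite !sumr_const card_ord -mulrnA -[LHS]mulr_natr natrM natrX mulrA.
have -> : m.+1%:R = m%:R + 1 :> R by rewrite natr1.
rewrite ih exprS exprVn exprS.
have : 2 ^+ m != 0 :> R by rewrite expf_neq0.
by move: (2 ^+ m) => q q0; field.
Qed.

End dyadic.

(** * Smallness of the dyadic form *)

Section dyadic_bound.
Context {R : realType}.
Implicit Types (f g : nat -> R) (r : R).

Definition dyadic_moment r m f := dyadic_mean m (fun k => `|f k| `^ r).

Let spread r m f := dyadic_moment r m f - `|dyadic_mean m f| `^ r.

Let spreadS r m f : spread r m.+1 f =
  (spread r m f + spread r m (dyadic_shift m f)) / 2 +
  gain r ((dyadic_mean m f + dyadic_mean m (dyadic_shift m f)) / 2)
         ((dyadic_mean m f - dyadic_mean m (dyadic_shift m f)) / 2).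
Proof.
rewrite /spread /dyadic_moment !dyadic_meanS /gain -/(dyadic_shift m _).
set x := dyadic_mean m f; set y := dyadic_mean m (dyadic_shift m f).
rewrite (_ : (x + y) / 2 + (x - y) / 2 = x); last by field.
rewrite (_ : (x + y) / 2 - (x - y) / 2 = y); last by field.
by rewrite -[dyadic_mean m (dyadic_shift m (fun k => _))]/(dyadic_mean m (fun k =>
  `|dyadic_shift m f k| `^ r)); field.
Qed.

Let spread_ge0 r m f : 1 < r -> 0 <= spread r m f.
Proof.
move=> r1; elim: m f => [|m ih] f.
  by rewrite /spread /dyadic_moment /dyadic_mean !big_ord1 expr0 !divr1 subrr.
by rewrite spreadS addr_ge0 ?gain_ge0// divr_ge0// addr_ge0.
Qed.

(** By induction on [m].  Let [a], [b] be the means of [f], [g] over an interval and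
    [d], [c] the half-differences of the means over its halves.  The off-diagonal
    blocks contribute a multiple of [d * b - a * c], which
    [product_le_gain] bounds by [A] times the increase of the two spreads plus [t]
    times the moments. *)
Lemma dyadic_form_spread (r r' t : R) : 1 < r -> r^-1 + r'^-1 = 1 -> 0 < t ->
  exists2 A : R, 0 <= A & forall m f g, `|dyadic_form m f g| <= 2 ^+ m *
    (A * (spread r m f + spread r' m g) +
     t * m%:R * (dyadic_moment r m f + dyadic_moment r' m g)).
Proof.
move=> r1 rr' t0; have r'1 := conjugate_gt1 r1 rr'.
have [A1 A10 h1] := product_le_gain r1 rr' t0.
have [A2 A20 h2] : exists2 A : R, 0 < A & forall a d b : R,
    `|d| * `|b| <= A * gain r' a d + t * (`|a| `^ r' + `|b| `^ r).
  by apply: product_le_gain => //; rewrite addrC.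
have A0 : 0 <= A1 + A2 by rewrite ltW// addr_gt0.
exists (A1 + A2) => //; elim=> [|m ih] f g.
  rewrite /dyadic_form big1 ?normr0//; last first.
    by move=> k _; rewrite big1// => l _; rewrite mul0r.
  rewrite mulr0 mul0r addr0 expr0 mul1r mulr_ge0// addr_ge0//.
    exact: spread_ge0 0%N f r1.
  exact: spread_ge0 0%N g r'1.
rewrite dyadic_formS.
have iS := @spreadS r m f; have jS := @spreadS r' m g.
have mS : dyadic_moment r m.+1 f = (dyadic_moment r m f + dyadic_moment r m (dyadic_shift m f)) / 2.
  exact: dyadic_meanS.
have nS : dyadic_moment r' m.+1 g = (dyadic_moment r' m g + dyadic_moment r' m (dyadic_shift m
  g)) / 2.
  exact: dyadic_meanS.
have := spread_ge0 m.+1 f r1; have := spread_ge0 m.+1 g r'1.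
rewrite {1}/spread {1}/spread nS mS !dyadic_meanS => sg sf.
have ihf := ih f g; have ihs := ih (dyadic_shift m f) (dyadic_shift m g).
move: ihf ihs iS jS sg sf; rewrite {ih mS nS}.
set s1 := spread r m f; set s2 := spread r m (dyadic_shift m f).
set u1 := spread r' m g; set u2 := spread r' m (dyadic_shift m g).
set p1 := dyadic_moment r m f; set p2 := dyadic_moment r m (dyadic_shift m f).
set q1 := dyadic_moment r' m g; set q2 := dyadic_moment r' m (dyadic_shift m g).
set a1 := dyadic_mean m f; set a2 := dyadic_mean m (dyadic_shift m f).
set b1 := dyadic_mean m g; set b2 := dyadic_mean m (dyadic_shift m g).
move=> ihf ihs -> -> sg sf.
set a := (a1 + a2) / 2; set d := (a1 - a2) / 2.
set b := (b1 + b2) / 2; set c := (b1 - b2) / 2.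
have -> : a1 * b2 - a2 * b1 = 2 * (d * b - a * c) by rewrite /a /b /c /d; field.
have D := h1 a d b; have E := h2 b c a.
have ga := gain_ge0 a d r1; have gb := gain_ge0 b c r'1.
rewrite (le_trans (ler_normD _ _))// (le_trans (lerD (ler_normD _ _) (lexx _)))//.
have n0 : 0 <= 2 ^+ m :> R by rewrite exprn_ge0.
have cross : `|2^-1 * 2 ^+ m * (2 * (d * b - a * c))| <= 2 ^+ m * (`|d| * `|b| + `|c| * `|a|).
  rewrite (_ : 2^-1 * _ * _ = 2 ^+ m * (d * b - a * c)); last by field.
  rewrite normrM (ger0_norm n0) ler_wpM2l// -!normrM [c * a]mulrC.
  exact: ler_normB.
apply: le_trans (lerD (lerD ihf ihs) cross) _.
rewrite -!mulrDr exprS [2 * 2 ^+ m]mulrC -[leRHS]mulrA ler_wpM2l//.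
have X : `|d| * `|b| + `|c| * `|a| <= 2 * ((A1 + A2) * (gain r a d + gain r' b c) +
   t * ((p1 + p2) / 2 + (q1 + q2) / 2)).
  have A1g : 0 <= A1 * gain r' b c by rewrite mulr_ge0// ltW.
  have A2g : 0 <= A2 * gain r a d by rewrite mulr_ge0// ltW.
  have A1g' : 0 <= A1 * gain r a d by rewrite mulr_ge0// ltW.
  have A2g' : 0 <= A2 * gain r' b c by rewrite mulr_ge0// ltW.
  have tt1 : t * (`|a| `^ r) <= t * ((p1 + p2) / 2).
    by rewrite ler_wpM2l ?(ltW t0)// -subr_ge0.
  have tt2 : t * (`|b| `^ r') <= t * ((q1 + q2) / 2).
    by rewrite ler_wpM2l ?(ltW t0)// -subr_ge0.
  move: D E tt1 tt2 A1g A2g A1g' A2g'.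
  move: (gain r a d) (gain r' b c) (`|a| `^ r) (`|b| `^ r') (`|d| * `|b|) (`|c| * `|a|) => g1 g2
    v1 v2 x1 x2.
  rewrite (_ : 2 * _ = 2 * (A1 * g1 + A1 * g2 + A2 * g1 + A2 * g2 + (t * ((p1 + p2) / 2) + t *
    ((q1 + q2) / 2))));
    last by ring.
  rewrite (mulrDr t v1) (mulrDr t v2); move: (t * v1) (t * v2) (t * ((p1 + p2) / 2)) (t * ((q1 +
    q2) / 2)).
  move: (A1 * g1) (A1 * g2) (A2 * g1) (A2 * g2) => w1 w2 w3 w4 w5 w6 w7 w8; lra.
apply: le_trans (lerD (lexx _) X) _.
have -> : m.+1%:R = m%:R + 1 :> R by rewrite natr1.
by rewrite le_eqVlt; apply/orP; left; apply/eqP; field.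
Qed.

(** The spreads are at most one, so the first term of the previous bound does not
    grow with [m] and is absorbed by the factor [m] for large [m]. *)
Lemma dyadic_form_small (r r' eta : R) : 1 < r -> r^-1 + r'^-1 = 1 -> 0 < eta ->
  exists2 m, (0 < m)%N & forall f g, dyadic_moment r m f <= 1 -> dyadic_moment r' m g <= 1 ->
    `|dyadic_form m f g| <= eta * (m%:R * 2 ^+ m).
Proof.
move=> r1 rr' eta0; have t0 : 0 < eta / 4 by rewrite divr_gt0.
have [A A0 hA] := dyadic_form_spread r1 rr' t0.
pose m := (Num.truncn (4 * A / eta)).+1.
exists m => // f g f1 g1; apply: le_trans (hA m f g) _.
rewrite (mulrC m%:R) mulrCA ler_wpM2l ?exprn_ge0//.
have s1 : spread r m f <= 1 by rewrite (le_trans _ f1)// gerBl powR_ge0.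
have s2 : spread r' m g <= 1 by rewrite (le_trans _ g1)// gerBl powR_ge0.
have Am : 4 * A <= eta * m%:R.
  by rewrite -ler_pdivrMl// mulrC ltW// truncnS_gt.
have X : A * (spread r m f + spread r' m g) <= A * 2 by rewrite ler_wpM2l//; lra.
have Y : eta / 4 * m%:R * (dyadic_moment r m f + dyadic_moment r' m g) <= eta / 4 * m%:R * 2.
  rewrite ler_wpM2l//; last by lra.
  by rewrite mulr_ge0// ltW.
lra.
Qed.

(** For complex scalars the form splits into four real ones. *)
Lemma dyadic_form_scalars (s : scalar_kind) (r r' eta : R) :
  1 < r -> r^-1 + r'^-1 = 1 -> 0 < eta ->
  exists2 m, (0 < m)%N & forall (f g : nat -> scalar_field R s) (x y : R), 0 < x -> 0 < y ->
    dyadic_mean m (fun k => rnorm (f k) `^ r) <= x `^ r ->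
    dyadic_mean m (fun k => rnorm (g k) `^ r') <= y `^ r' ->
    rnorm (\sum_(k < 2 ^ m) \sum_(l < 2 ^ m)
      of_real (dyadic_matrix m k l) * (f k * g l)) <= eta * (m%:R * 2 ^+ m) * (x * y).
Proof.
move=> r1 rr' eta0; have r'1 := conjugate_gt1 r1 rr'.
have [m m0 hm] := dyadic_form_small r1 rr' (divr_gt0 eta0 (ltr0n R 4)).
exists m => // f g x y x0 y0 fx gy.
have r_ge0 : 0 <= r by rewrite ltW// (lt_trans _ r1).
have r'_ge0 : 0 <= r' by rewrite ltW// (lt_trans _ r'1).
have moment (p z : R) (h : nat -> scalar_field R s) (h' : nat -> R) : 0 <= p -> 0 < z ->
    (forall k, `|h' k| <= rnorm (h k)) ->
    dyadic_mean m (fun k => rnorm (h k) `^ p) <= z `^ p ->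
    dyadic_moment p m (fun k => z^-1 * h' k) <= 1.
  move=> p0 z0 h'h hz; rewrite /dyadic_moment.
  rewrite (_ : (fun k => _) = fun k => (z `^ p)^-1 * `|h' k| `^ p); last first.
    apply/funext => k; rewrite normrM powRM// ger0_norm ?invr_ge0 ?(ltW z0)//.
    by rewrite -powR_inv1 ?(ltW z0)// -powRrM mulN1r powRN.
  rewrite /dyadic_mean -mulr_sumr -mulrA ler_pdivrMl ?powR_gt0// mulr1.
  apply: le_trans hz; rewrite ler_wpM2r ?invr_ge0 ?exprn_ge0//.
  by apply: ler_sum => k _; rewrite ge0_ler_powR ?nnegrE ?rnorm_ge0.
have B (f' g' : nat -> R) : (forall k, `|f' k| <= rnorm (f k)) ->
    (forall k, `|g' k| <= rnorm (g k)) ->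
    `|dyadic_form m f' g'| <= eta / 4 * (m%:R * 2 ^+ m) * (x * y).
  move=> /(moment _ _ _ _ r_ge0 x0)/(_ fx) h1 /(moment _ _ _ _ r'_ge0 y0)/(_ gy) h2.
  have := hm _ _ h1 h2.
  rewrite (_ : dyadic_form _ _ _ = (x * y)^-1 * dyadic_form m f' g'); last first.
    rewrite /dyadic_form mulr_sumr; apply: eq_bigr => k _.
    rewrite mulr_sumr; apply: eq_bigr => l _.
    by rewrite invfM; ring.
  rewrite normrM ger0_norm ?invr_ge0 ?mulr_ge0 ?(ltW x0) ?(ltW y0)//.
  by rewrite ler_pdivrMl ?mulr_gt0// mulrC.
pose c1 k := to_real (f k) : R; pose c2 k := to_imag (f k).
pose d1 k := to_real (g k) : R; pose d2 k := to_imag (g k).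
have c1f k : `|c1 k| <= rnorm (f k) := to_real_le _.
have c2f k : `|c2 k| <= rnorm (f k) := to_imag_le _.
have d1g k : `|d1 k| <= rnorm (g k) := to_real_le _.
have d2g k : `|d2 k| <= rnorm (g k) := to_imag_le _.
have := B _ _ c1f d1g; have := B _ _ c1f d2g.
have := B _ _ c2f d1g; have := B _ _ c2f d2g.
have -> : eta / 4 * (m%:R * 2 ^+ m) * (x * y) = (eta * (m%:R * 2 ^+ m) * (x * y)) / 4 by ring.
set Q := eta * _ * _ => h22 h21 h12 h11.
rewrite (le_trans (rnorm_le _))//.
rewrite (_ : to_real _ = dyadic_form m c1 d1 - dyadic_form m c2 d2); last first.
  rewrite to_real_sum -sumrB; apply: eq_bigr => k _.
  rewrite to_real_sum -sumrB; apply: eq_bigr => l _.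
  by rewrite to_real_of_realM to_realM mulrBr.
rewrite (_ : to_imag _ = dyadic_form m c1 d2 + dyadic_form m c2 d1); last first.
  rewrite to_imag_sum -big_split; apply: eq_bigr => k _ /=.
  rewrite to_imag_sum -big_split; apply: eq_bigr => l _ /=.
  by rewrite to_imag_of_realM to_imagM mulrDr.
have := ler_normB (dyadic_form m c1 d1) (dyadic_form m c2 d2).
have := ler_normD (dyadic_form m c1 d2) (dyadic_form m c2 d1).
lra.
Qed.

End dyadic_bound.

(** * Convexity and rearrangements *)

Section convexity.
Context {R : realType}.

Lemma convex_on_nonnegP (g : R -> R) : convex_on_nonneg g ->
  forall t x y, 0 <= t <= 1 -> 0 <= x -> 0 <= y ->
  g (t * x + (1 - t) * y) <= t * g x + (1 - t) * g y.
Proof.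
move=> cg t x y t01 x0 y0.
have [u ut] : exists u : {i01 R}, u%:num = t.
  by exists (Itv01 (proj1 (andP t01)) (proj2 (andP t01))).
have := @cg u x y; rewrite !inE/= !in_itv/= !andbT => /(_ x0 y0).
by move=> H; rewrite -ut; exact: H.
Qed.

Lemma convex_mean (g : R -> R) : convex_on_nonneg g ->
  forall n (x : nat -> R), (0 < n)%N -> (forall k, 0 <= x k) ->
  g ((\sum_(k < n) x k) / n%:R) <= (\sum_(k < n) g (x k)) / n%:R.
Proof.
move=> cg [//|n] x _ x0; elim: n => [|n ih]; first by rewrite !big_ord1 !divr1.
rewrite big_ord_recr [X in _ <= X / _]big_ord_recr/=.
move: ih; set S := \sum_(k < n.+1) x k; set T := \sum_(k < n.+1) g (x k).
have S0 : 0 <= S by exact: sumr_ge0.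
have n1 : 0 < n.+1%:R :> R by []. have n2 : 0 < n.+2%:R :> R by [].
have nE : n.+2%:R = n.+1%:R + 1 :> R by rewrite natr1.
have t01 : 0 <= (n.+1%:R / n.+2%:R : R) <= 1.
  by rewrite divr_ge0//= ler_pdivrMr// mul1r ler_nat.
move=> ih.
have := convex_on_nonnegP cg t01 (divr_ge0 S0 (ltW n1)) (x0 n.+1).
rewrite (_ : _ / n.+2%:R * (S / _) + _ = (S + x n.+1) / n.+2%:R); last first.
  by rewrite nE; move: n1 n2; rewrite nE => n1 n2; field; rewrite !gt_eqF.
move=> /le_trans; apply.
rewrite (_ : (T + _) / _ = n.+1%:R / n.+2%:R * (T / n.+1%:R) + (1 - n.+1%:R / n.+2%:R) * g (x
  n.+1)).
  by rewrite lerD2r ler_wpM2l//; case/andP: t01.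
by move: n1 n2; rewrite nE => n1 n2; field; rewrite !gt_eqF.
Qed.

Lemma concave_mean (g : R -> R) : concave_on_nonneg g ->
  forall n (x : nat -> R), (0 < n)%N -> (forall k, 0 <= x k) ->
  (\sum_(k < n) g (x k)) / n%:R <= g ((\sum_(k < n) x k) / n%:R).
Proof.
move=> cg n x n0 x0; have := convex_mean cg n0 x0.
by rewrite sumrN mulNr lerN2.
Qed.

(** Sum [(b k - b l) * (w k - w l) >= 0] over all [k] and [l]. *)
Lemma chebyshev_sum (b w : nat -> R) n :
  (forall k l, (k <= l)%N -> b l <= b k) -> (forall k l, (k <= l)%N -> w l <= w k) ->
  (\sum_(k < n) w k) * (\sum_(k < n) b k) <= n%:R * \sum_(k < n) b k * w k.
Proof.
move=> bn wn; rewrite -subr_ge0.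
have : 0 <= \sum_(k < n) \sum_(l < n) (b k - b l) * (w k - w l).
  apply: sumr_ge0 => k _; apply: sumr_ge0 => l _.
  have [kl|/ltnW lk] := leqP k l.
    by rewrite mulr_ge0 ?subr_ge0 ?bn ?wn.
  by rewrite mulr_le0 ?subr_le0 ?bn ?wn.
rewrite (_ : \sum_(k < n) _ = 2 * (n%:R * \sum_(k < n) b k * w k -
  (\sum_(k < n) w k) * (\sum_(k < n) b k))); first by rewrite pmulr_rge0.
transitivity (\sum_(k < n) (n%:R * (b k * w k) - b k * (\sum_(l < n) w l)
   - (\sum_(l < n) b l) * w k + \sum_(l < n) b l * w l)).
  apply: eq_bigr => k _.
  have -> : n%:R * (b k * w k) = \sum_(l < n) b k * w k by rewrite sumr_const card_ord mulr_natl.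
  rewrite mulr_sumr mulr_suml.
  rewrite -!sumrB -big_split; apply: eq_bigr => l _ /=; ring.
rewrite big_split/= !sumrB -mulr_sumr -mulr_suml -mulr_sumr sumr_const card_ord -mulr_natl.
ring.
Qed.

Lemma power_mean_le1 (p q : R) n (x : nat -> R) : 0 < p -> p <= q -> (0 < n)%N ->
  (forall k, 0 <= x k) -> (\sum_(k < n) x k `^ q) / n%:R <= 1 ->
  (\sum_(k < n) x k `^ p) / n%:R <= 1.
Proof.
move=> p0; rewrite le_eqVlt => /predU1P[->//|pq] n0 x0.
have n1 : 0 < n%:R :> R by rewrite ltr0n.
rewrite !ler_pdivrMr// !mul1r => xq.
pose c := q / p; have c1 : 1 < c by rewrite ltr_pdivlMr// mul1r.
have c0 : 0 < c by exact: lt_trans ltr01 c1.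
have h : \sum_(k < n) (1 + c * (x k `^ p - 1)) <= n%:R.
  apply: le_trans xq; apply: ler_sum => k _.
  have := powR_tangent c1 (powR_ge0 (x k) p) ler01.
  by rewrite !powR1 mulr1 -powRrM /c mulrCA divff ?gt_eqF// mulr1.
move: h; rewrite big_split/= sumr_const card_ord -mulr_sumr gerDl.
by rewrite pmulr_rle0// sumrB sumr_const card_ord subr_le0.
Qed.

End convexity.

Section rearrangement_sums.
Context {R : realType}.
Implicit Types (a : nat -> R).

Lemma rearrangement_nonincreasing a k l : (forall i, 0 <= a i) -> vanishing a ->
  (k <= l)%N -> rearrangement a l <= rearrangement a k.
Proof.
move=> a0 va kl; have [s sl tops] := top_exists l.+1 a0 va.
rewrite !(top_rearrangement a0 va tops) ?sl ?ltnS//.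
have [us ts] := tops; apply: ts; first by rewrite sl ltnS.
apply/negP => /(nthP 0%N)[m]; rewrite size_takel ?sl ?leqW// => mk.
rewrite nth_take// => /eqP; rewrite nth_uniq ?sl ?ltnS// ?(leq_trans (ltnW mk))//.
by move=> /eqP ml; move: mk; rewrite ml ltnNge kl.
Qed.

(** Sort the [n] values; the [k]-th largest of them is at most the [k]-th largest
    of all. *)
Lemma sum_le_rearrangement a (F : R -> R) (i : nat -> nat) n :
  (forall k, 0 <= a k) -> vanishing a -> (forall x y, 0 <= x -> x <= y -> F x <= F y) ->
  {in gtn n &, injective i} ->
  \sum_(k < n) F (a (i k)) <= \sum_(k < n) F (rearrangement a k).
Proof.
move=> a0 va hF ii.
pose s := sort (fun j l => a l <= a j) [seq i k | k <- index_iota 0 n].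
have sn : size s = n by rewrite size_sort size_map size_iota subn0.
have us : uniq s.
  rewrite sort_uniq map_inj_in_uniq ?iota_uniq// => k l.
  by rewrite !mem_index_iota /= => kn ln; exact: ii.
have ss k l : (k <= l < n)%N -> a (nth 0%N s l) <= a (nth 0%N s k).
  move=> /andP[kl ln].
  pose ge_a j m := a m <= a j.
  have ge_trans : transitive ge_a by move=> x y z /= yx zx; exact: le_trans zx yx.
  have ge_refl : reflexive ge_a by move=> x; exact: lexx.
  have sorted_s : sorted ge_a s by apply: sort_sorted => x y; exact: le_total.
  apply: (sorted_leq_nth ge_trans ge_refl 0%N sorted_s); rewrite ?inE ?sn//.
  exact: leq_ltn_trans kl ln.
have -> : \sum_(k < n) F (a (i k)) = \sum_(k < n) F (a (nth 0%N s k)).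
  rewrite -(big_mkord xpredT (fun k => F (a (i k)))) -(big_map i xpredT (fun j => F (a j))).
  rewrite -(perm_big _ (permEl (perm_sort (fun j l => a l <= a j) _)))/= -/s.
  by rewrite (big_nth 0%N) sn big_mkord.
apply: ler_sum => k _; apply: hF => //.
apply: (@rearrangement_ge _ _ _ _ (take k.+1 s)) => //; first exact: take_uniq.
  by rewrite size_takel ?sn.
move=> j /(nthP 0%N)[m]; rewrite size_takel ?sn// ltnS => mk.
by rewrite nth_take ?ltnS// => <-; apply: ss; rewrite mk ltn_ord.
Qed.

(** Only indices in the support contribute, and each at most once. *)
Lemma sum_rearrangement_le a (F : R -> R) (i : nat -> nat) n N :
  (forall k, 0 <= a k) -> vanishing a -> F 0 = 0 -> (forall x, 0 <= x -> 0 <= F x) ->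
  {in gtn n &, injective i} ->
  (forall j, a j != 0 -> exists2 k, (k < n)%N & j = i k) ->
  \sum_(k < N) F (rearrangement a k) <= \sum_(k < n) F (a (i k)).
Proof.
move=> a0 va F0 Fp ii ai.
have [s sN tops] := top_exists N a0 va.
rewrite (eq_bigr (fun k : 'I_N => F (a (nth 0%N s k)))); last first.
  by move=> k _; rewrite (top_rearrangement a0 va tops) ?sN.
have us := tops.1.
rewrite -sN -(big_mkord xpredT (fun k => F (a (nth 0%N s k)))).
rewrite -(big_nth 0%N xpredT (fun j => F (a j))).
rewrite -(big_mkord xpredT (fun k => F (a (i k)))) -(big_map i xpredT (fun j => F (a j))).
set t := map i _.
have ut : uniq t.
  rewrite map_inj_in_uniq ?iota_uniq// => k l; rewrite !mem_index_iota/= => kn ln; exact: ii.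
rewrite (bigID (mem t))/= [X in _ + X]big1 ?addr0; last first.
  move=> j jt; have [->//|/ai[k kn jk]] := eqVneq (a j) 0.
  by move: jt; rewrite jk map_f// mem_index_iota.
rewrite -big_filter.
have -> : \sum_(j <- [seq j <- s | j \in t]) F (a j) = \sum_(j <- t | j \in s) F (a j).
  rewrite -[RHS]big_filter; apply: perm_big; apply: uniq_perm; rewrite ?filter_uniq//.
  by move=> j; rewrite !mem_filter andbC.
rewrite big_mkcond/=; apply: ler_sum => j _; case: ifP => // _; exact: Fp.
Qed.

End rearrangement_sums.

(** * Unit vectors in Orlicz-Lorentz spaces *)

Section orlicz_functions.
Context {R : realType} (G : orlicz_function R).

Lemma orlicz_gt0 t : 0 < t -> 0 < G t.
Proof.
move=> t0; rewrite lt_neqAle orlicz_ge0 ?(ltW t0)// andbT eq_sym; apply/eqP.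
by move/(orlicz_eq0 G (ltW t0))/eqP; rewrite gt_eqF.
Qed.

Lemma orlicz_le_inv u v : 0 <= u -> 0 <= v -> G u <= G v -> u <= v.
Proof.
move=> u0 v0 uv; rewrite leNgt; apply/negP => vu.
have up : 0 < u by exact: le_lt_trans vu.
have t01 : 0 <= v / u <= 1 by rewrite divr_ge0//= ler_pdivrMr// mul1r ltW.
have := orlicz_contract G t01 u0; rewrite divfK ?gt_eqF// => h.
have : v / u * G u < G u by rewrite gtr_pMl ?orlicz_gt0// ltr_pdivrMr// mul1r.
by rewrite ltNge (le_trans uv h).
Qed.

(** By convexity [G t <= t * G 1] below one and [G t >= t * G 1] above, so [W * G]
    crosses the value one between [t] and [2 * t] for some
    dyadic multiple [t] of a small number. *)
Lemma orlicz_level (W : R) : 0 < W ->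
  exists2 t : R, 0 < t & W * G t <= 1 <= W * G (2 * t).
Proof.
move=> W0; have G1 : 0 < W * G 1 by rewrite mulr_gt0 ?orlicz_gt0.
pose a := Num.min 1 (W * G 1)^-1.
have a0 : 0 < a by rewrite lt_min ltr01 invr_gt0.
have Ga : W * G a <= 1.
  have := @orlicz_contract _ G a 1; rewrite (ltW a0) ge_min lexx mulr1 => /(_ isT ler01) h.
  rewrite (le_trans (ler_wpM2l (ltW W0) h))// mulrCA -ler_pdivlMr// mul1r.
  by rewrite ge_min lexx orbT.
have ex : exists n, 1 <= W * G (2 ^+ n * a).
  have [b b0 Gb] : exists2 b, 1 <= b & 1 <= W * G b.
    exists (1 + (W * G 1)^-1); first by rewrite lerDl invr_ge0 ltW.
    set b := _ + _; have b0 : 0 < b by rewrite addr_gt0// invr_gt0.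
    have t01 : 0 <= b^-1 <= 1 by rewrite invr_ge0 (ltW b0)/= invf_le1// lerDl invr_ge0 ltW.
    have := orlicz_contract G t01 (ltW b0); rewrite mulVf ?gt_eqF// => h.
    have : W * G 1 * b <= W * G b.
      by rewrite -mulrA ler_wpM2l ?(ltW W0)// mulrC -ler_pdivlMl// mulrC.
    by apply: le_trans; rewrite mulrDr mulr1 divff ?gt_eqF// lerDr ltW.
  exists (Num.truncn (b / a)).+1; rewrite (le_trans Gb)// ler_wpM2l ?(ltW W0)//.
  rewrite orlicz_le//; first by rewrite (le_trans ler01).
  rewrite -ler_pdivrMr// ltW// (lt_le_trans (truncnS_gt _))// -natrX ler_nat.
  exact/ltnW/ltn_expl.
case: (ex_minnP ex) => -[|n] n1 nmin.
  exists a => //; rewrite Ga/= (le_trans n1)// expr0 mul1r ler_wpM2l ?(ltW W0)//.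
  by rewrite orlicz_le ?(ltW a0)// ler_pMl// ler1n.
exists (2 ^+ n * a); first by rewrite mulr_gt0// exprn_gt0.
rewrite mulrA -exprS n1 andbT leNgt; apply/negP => /ltW/nmin.
by rewrite ltnn.
Qed.

End orlicz_functions.

Section orlicz_lorentz_vectors.
Context {R : realType} {s : scalar_kind} {G : orlicz_function R} {w : weight_sequence R}.
Local Notation K := (scalar_field R s).
Local Notation E := (orlicz_lorentz s G w).

Definition modulus (x : nat -> K^o) : nat -> R := fun k => rnorm (x k : K).

Lemma modulus_ge0 x k : 0 <= modulus x k. Proof. exact: rnorm_ge0. Qed.

Lemma modulus_vanishing (x : nat -> K^o) : x @ \oo --> (0 : K^o) -> vanishing (modulus x).
Proof.
move=> /cvg_rnormP x0 e /x0[N hN]; exists N => i /hN.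
by rewrite subr0.
Qed.

Lemma lorentz_vanishing (x : E) : vanishing (modulus (val x)).
Proof. by apply: modulus_vanishing; have /asboolP[] := valP x. Qed.

Lemma rearrangement_support (a : nat -> R) t k : (forall j, 0 <= a j) ->
  (size t <= k)%N -> (forall j, a j != 0 -> j \in t) -> rearrangement a k = 0.
Proof.
move=> a0 tk at0; apply/le_anti; rewrite rearrangement_ge0 andbT.
apply: rearrangement_le tk _ => // j aj; apply: at0.
by rewrite gt_eqF.
Qed.

Fact basis_vector_in (j : nat) : (fun k => (k == j)%:R : K^o) \in @in_orlicz_lorentz R s G w.
Proof.
have v0 : (fun k => (k == j)%:R : K^o) @ \oo --> (0 : K^o).
  apply/cvg_rnormP => e e0; exists j.+1 => n jn.
  by rewrite gtn_eqF// subr0 rnorm0.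
apply/asboolP; split=> //; exists 1 => //.
apply/modular_lty => [i|]; first by rewrite mul1r rearrangement_ge0.
exists (G (1 * rearrangement (modulus (fun k => (k == j)%:R)) 0) * w 0%N) => -[|n].
  by rewrite big_ord0 mulr_ge0 ?orlicz_ge0 ?mul1r ?rearrangement_ge0// ltW// weight_gt0.
rewrite big_ord_recl/= big1 ?addr0// => k _.
rewrite (@rearrangement_support _ [:: j])// ?mulr0 ?orlicz0 ?mul0r//.
  by move=> i; exact: rnorm_ge0.
by move=> i; rewrite inE; apply: contraNT => /negbTE ->; rewrite rnorm0.
Qed.

Definition basis_vector (j : nat) : E :=
  exist (fun x : nat -> K^o => x \in @in_orlicz_lorentz R s G w) _ (basis_vector_in j).

Lemma val_combination n (i : nat -> nat) (c : nat -> K) j :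
  val (\sum_(k < n) c k *: basis_vector (i k)) j = \sum_(k < n | j == i k) c k.
Proof.
rewrite raddf_sum fct_sumE [RHS]big_mkcond; apply: eq_bigr => k _.
rewrite -[LHS]/(c k * (j == i k)%:R).
by case: eqP; rewrite ?mulr1 ?mulr0.
Qed.

Lemma val_combination_at n (i : nat -> nat) (c : nat -> K) k :
  {in gtn n &, injective i} -> (k < n)%N ->
  val (\sum_(k < n) c k *: basis_vector (i k)) (i k) = c k.
Proof.
move=> ii kn; rewrite val_combination (big_pred1 (Ordinal kn))// => l /=.
apply/eqP/eqP => [/ii|->//]; rewrite !inE => /(_ kn (ltn_ord l)) kl.
by apply: val_inj.
Qed.

Lemma val_combination_support n (i : nat -> nat) (c : nat -> K) j :
  modulus (val (\sum_(k < n) c k *: basis_vector (i k))) j != 0 ->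
  exists2 k, (k < n)%N & j = i k.
Proof.
rewrite /modulus val_combination; apply: contraNP => h.
rewrite big_pred0 ?rnorm0// => k; apply/eqP => jk; apply: h.
by exists k.
Qed.

Lemma lorentz_norm_le (x : E) (l : R) : 0 < l ->
  (forall N, \sum_(k < N) G (l * rearrangement (modulus (val x)) k) * w k <= 1) ->
  rnorm x <= l^-1.
Proof.
move=> l0 hx; rewrite orlicz_lorentz_normE; apply: ge_inf.
  by exists 0 => t [/ltW].
split; first by rewrite invr_gt0.
apply/modular_le => [i|n].
  by rewrite invrK mulr_ge0 ?rearrangement_ge0// ltW.
rewrite (le_trans _ (hx n))//; apply: ler_sum => k _.
by rewrite invrK mulrC [X in G X]mulrC mulrC.
Qed.

(** If no scale is admissible the norm is [inf set0 = 0], and then [x] is zero. *)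
Lemma lorentz_norm_lt (x : E) (l : R) : 0 < l -> rnorm x < l ->
  forall N, \sum_(k < N) G (rearrangement (modulus (val x)) k / l) * w k <= 1.
Proof.
move=> l0 xl N.
have [S0|S0] := pselect ([set l : R | 0 < l /\
    (modular G w (fun k => rearrangement (modulus (val x)) k / l)%R <= 1)%E] !=set0).
  move: xl; rewrite orlicz_lorentz_normE /orlicz_lorentz_norm.
  move=> /inf_lt => /(_ S0)[m [m0 mx] ml].
  have mod0 i : 0 <= rearrangement (modulus (val x)) i / m.
    by rewrite divr_ge0 ?rearrangement_ge0// ltW.
  have := (@modular_le _ G w _ 1 mod0).1 mx N; apply: le_trans.
  apply: ler_sum => k _; apply: ler_wpM2r; first exact/ltW/weight_gt0.
  apply: orlicz_le; first by rewrite divr_ge0 ?rearrangement_ge0// ltW.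
  by rewrite ler_wpM2l ?rearrangement_ge0// lef_pV2// ltW.
have x0 : x = 0.
  apply: rnorm_eq0; rewrite orlicz_lorentz_normE /orlicz_lorentz_norm.
  rewrite -[RHS]inf0; congr inf; apply/seteqP; split=> // t ht.
  by exfalso; apply: S0; exists t.
rewrite big1// => k _; rewrite (@rearrangement_support _ [::])//.
- by rewrite mul0r orlicz0 mul0r.
- exact: modulus_ge0.
- by move=> j; rewrite x0 /modulus [val 0 j]/(0 : K) rnorm0 eqxx.
Qed.

End orlicz_lorentz_vectors.

(** * Comparison with power means *)

Section lorentz_estimates.
Context {R : realType} {s : scalar_kind} {G : orlicz_function R} {w : weight_sequence R}.
Local Notation K := (scalar_field R s).
Local Notation E := (orlicz_lorentz s G w).

Lemma weight_sum_gt0 n : (0 < n)%N -> 0 < weight_sum w n.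
Proof.
case: n => // n _; rewrite /weight_sum big_ord_recl ltr_pwDl ?weight_gt0//.
by rewrite sumr_ge0// => k _; rewrite ltW// weight_gt0.
Qed.

Lemma equivalent_to_convex1 : equivalent_to_convex (fun t => G (t `^ 1^-1)).
Proof.
exists G; split; first exact: orlicz_ge0.
  exact: orlicz_convex.
by exists 1 => // t t0; rewrite invr1 !mul1r powRr1// !lexx.
Qed.

(** Chebyshev's sum inequality removes the weights, at the price of replacing them
    by their mean [W(n) / n]; then Jensen's inequality is applied to the convex
    function equivalent to [t |-> G (t ^ (1/p))]. *)
Lemma lorentz_mean (p : R) : 1 <= p -> equivalent_to_convex (fun t => G (t `^ p^-1)) ->
  exists2 C : R, 0 < C & forall n (t : R), (0 < n)%N -> 0 < t ->
    1 <= weight_sum w n * G (2 * t) ->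
    forall i : nat -> nat, {in gtn n &, injective i} -> forall x : E, rnorm x <= 1 ->
    (\sum_(k < n) rnorm (val x (i k) : K) `^ p) / n%:R <= (C * t) `^ p.
Proof.
move=> p1 [g [g0 cg [c c0 hc]]].
have p0 : 0 < p by exact: lt_le_trans ltr01 p1.
have pV (y : R) : 0 <= y -> (y `^ p) `^ p^-1 = y.
  by move=> y0; rewrite -powRrM divff ?gt_eqF// powRr1.
have pV' (y : R) : 0 <= y -> (y `^ p^-1) `^ p = y.
  by move=> y0; rewrite -powRrM mulVf ?gt_eqF// powRr1.
pose D := (c * c) `^ p^-1.
have cc0 : 0 < c * c by rewrite mulr_gt0.
have D0 : 0 < D by rewrite powR_gt0.
exists (D * 4); first by rewrite mulr_gt0.
move=> n t n0 t0 Wt i ii x x1.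
have n1 : 0 < n%:R :> R by rewrite ltr0n.
have W0 := weight_sum_gt0 n0.
pose a k := modulus (val x) k; pose r k := rearrangement (modulus (val x)) k / 2.
have r0 k : 0 <= r k by rewrite divr_ge0 ?rearrangement_ge0.
have vx := lorentz_vanishing x.
have h1 : \sum_(k < n) G (r k) * w k <= 1.
  by apply: lorentz_norm_lt => //; rewrite (le_lt_trans x1)// ltr1n.
have h2 : \sum_(k < n) G (a (i k) / 2) <= \sum_(k < n) G (r k).
  apply: (@sum_le_rearrangement _ (modulus (val x)) (fun y => G (y / 2))) => //.
    by move=> k; exact: modulus_ge0.
  by move=> y z y0 yz; rewrite orlicz_le ?divr_ge0// ler_wpM2r// invr_ge0.
have h3 : weight_sum w n * \sum_(k < n) G (r k) <= n%:R * \sum_(k < n) G (r k) * w k.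
  apply: (@chebyshev_sum _ (fun k => G (r k)) w) => [k l kl|]; last exact: weight_nonincreasing.
  apply: orlicz_le => //; rewrite ler_wpM2r ?invr_ge0//.
  by apply: rearrangement_nonincreasing => // j; exact: modulus_ge0.
have h4 : (\sum_(k < n) G (a (i k) / 2)) / n%:R <= G (2 * t).
  rewrite ler_pdivrMr// -(ler_pM2l W0) (le_trans (ler_wpM2l (ltW W0) h2))//.
  rewrite (le_trans h3)// (le_trans (ler_wpM2l (ltW n1) h1))// mulr1 mulrA.
  by rewrite ler_peMl// ltW.
pose u k := (a (i k) / 2) `^ p.
have a2 k : 0 <= a (i k) / 2 by rewrite divr_ge0// modulus_ge0.
have u0 k : 0 <= u k by rewrite powR_ge0.
have cu0 k : 0 <= c^-1 * u k by rewrite mulr_ge0// invr_ge0 ltW.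
have h5 : g ((\sum_(k < n) c^-1 * u k) / n%:R) <= G (2 * t).
  apply: le_trans (convex_mean cg n0 cu0) _; apply: le_trans h4.
  rewrite ler_wpM2r ?invr_ge0 ?(ltW n1)//; apply: ler_sum => k _.
  have /andP[_] := hc _ (cu0 k); rewrite mulrA divff ?gt_eqF// mul1r /u => /le_trans; apply.
  by rewrite pV.
pose S := (\sum_(k < n) u k) / n%:R.
have S0 : 0 <= S by rewrite divr_ge0 ?sumr_ge0// ltW.
have h6 : G ((c^-1 * (c^-1 * S)) `^ p^-1) <= G (2 * t).
  apply: le_trans h5; rewrite -mulr_sumr -mulrA -/S.
  have cS : 0 <= c^-1 * S by rewrite mulr_ge0// invr_ge0 ltW.
  by have /andP[] := hc _ cS.
have t2 : 0 <= 2 * t by rewrite mulr_ge0// ltW.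
have h7 := orlicz_le_inv (powR_ge0 _ _) t2 h6.
have h8 : c^-1 * (c^-1 * S) <= (2 * t) `^ p.
  have cV0 : 0 <= c^-1 by rewrite invr_ge0 ltW.
  rewrite -[leLHS]pV'; last by rewrite (mulr_ge0 cV0)// (mulr_ge0 cV0).
  by rewrite ge0_ler_powR ?nnegrE ?powR_ge0// ltW.
have SE : \sum_(k < n) rnorm (val x (i k) : K) `^ p = (\sum_(k < n) u k) * 2 `^ p.
  rewrite mulr_suml; apply: eq_bigr => k _.
  by rewrite /u -powRM ?divfK.
rewrite SE mulrAC -/S.
have -> : (D * 4 * t) `^ p = c * c * (2 `^ p * (2 * t) `^ p).
  have <- : D `^ p = c * c by rewrite /D pV' ?(ltW cc0).
  have t4 : 0 <= 2 * (2 * t) by rewrite mulr_ge0.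
  rewrite -(powRM p _ t2)// -(powRM p (ltW D0) t4); congr (_ `^ _); ring.
rewrite mulrCA mulrC ler_wpM2l ?powR_ge0//.
by move: h8; rewrite mulrA -invfM ler_pdivrMl.
Qed.

Lemma weight_sumS n : weight_sum w n.+1 = weight_sum w n + w n.
Proof. by rewrite /weight_sum big_ord_recr. Qed.

(** The increments of the convex function [W] are nondecreasing from the second one
    on, and the weights are nonincreasing, so all weights but the first agree. *)
Lemma convex_weight : convex_on_positive_nat (weight_sum w) -> forall k, w 1%N <= w k.
Proof.
move=> cw; case=> [|k]; first exact: weight_nonincreasing.
have step l : w l.+1 <= w l.+2.
  have [u ut] : exists u : {i01 R}, u%:num = 2^-1.
    by exists (@Itv01 _ (2^-1 : R) ltac:(by rewrite invr_ge0) ltac:(by rewrite invf_le1// ler1n)).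
  have := cw u l.+1 l.+3 l.+2 isT isT; rewrite ut !weight_sumS.
  have -> : l.+3%:R = l.+1%:R + 2 :> R by rewrite -natrD addn2.
  have -> : l.+2%:R = l.+1%:R + 1 :> R by rewrite natr1.
  move=> h; have {}h := h ltac:(by field).
  by move: h; lra.
elim: k => [//|k ih]; exact: le_trans ih (step k).
Qed.

(** Jensen's inequality for the concave function equivalent to
    [t |-> G (t ^ (1/p))].  The weights lie between [w 1] and [w 0], and the ratio
    [e] of the two is moved inside [G] by convexity. *)
Lemma lorentz_combination_le (p q : R) : 1 <= p -> p <= q ->
  equivalent_to_concave (fun t => G (t `^ p^-1)) ->
  convex_on_positive_nat (weight_sum w) ->
  exists2 C : R, 0 < C & forall n (t : R), (0 < n)%N -> 0 < t ->
    weight_sum w n * G t <= 1 ->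
    forall i : nat -> nat, {in gtn n &, injective i} -> forall c : nat -> K,
    (\sum_(k < n) rnorm (c k) `^ q) / n%:R <= 1 ->
    rnorm (\sum_(k < n) c k *: basis_vector (i k) : E) <= C / t.
Proof.
move=> p1 pq [g [g0 cg [d d0 hd]]] cw.
have p0 : 0 < p by exact: lt_le_trans ltr01 p1.
have pV (y : R) : 0 <= y -> (y `^ p) `^ p^-1 = y.
  by move=> y0; rewrite -powRrM divff ?gt_eqF// powRr1.
pose D := (d * d) `^ p^-1.
have dd0 : 0 < d * d by rewrite mulr_gt0.
have D0 : 0 < D by rewrite powR_gt0.
pose e := w 1%N / w 0%N.
have w00 := weight_gt0 w 0%N.
have e0 : 0 < e by rewrite divr_gt0 ?weight_gt0.
have e1 : 0 <= e <= 1 by rewrite ltW//= ler_pdivrMr// mul1r weight_nonincreasing.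
exists (D / e); first exact: divr_gt0.
move=> n t n0 t0 Wt i ii c cq.
have n1 : 0 < n%:R :> R by rewrite ltr0n.
have cp := power_mean_le1 p0 pq n0 (fun k => rnorm_ge0 (c k : K)) cq.
set x : E := \sum_(k < n) _.
pose l := t / (D / e).
have l0 : 0 < l by apply: divr_gt0 => //; exact: divr_gt0.
have -> : D / e / t = l^-1 by rewrite /l [RHS]invf_div.
apply: lorentz_norm_le => // N.
pose r k := rearrangement (modulus (val x)) k.
have r0 k : 0 <= l * r k by rewrite mulr_ge0 ?rearrangement_ge0// ltW.
apply: (@le_trans _ _ (w 0%N * \sum_(k < N) G (l * r k))).
  rewrite mulr_sumr; apply: ler_sum => k _; rewrite mulrC ler_wpM2r ?orlicz_ge0//.
  exact: weight_nonincreasing.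
have h1 : \sum_(k < N) G (l * r k) <= \sum_(k < n) G (l * modulus (val x) (i k)).
  apply: (@sum_rearrangement_le _ (modulus (val x)) (fun y => G (l * y))) => //.
  - by move=> k; exact: modulus_ge0.
  - exact: lorentz_vanishing.
  - by rewrite mulr0 orlicz0.
  - by move=> y y0; rewrite orlicz_ge0// mulr_ge0// ltW.
  - by move=> j; exact: val_combination_support.
have xE k : (k < n)%N -> modulus (val x) (i k) = rnorm (c k).
  by move=> kn; rewrite /modulus val_combination_at.
pose u k := (l * rnorm (c k)) `^ p.
have u0 k : 0 <= u k by rewrite powR_ge0.
have du0 k : 0 <= d * u k by rewrite mulr_ge0// ltW.
have h2 : (\sum_(k < n) G (l * modulus (val x) (i k))) / n%:R <= (\sum_(k < n) g (d * u k)) / n%:R.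
  rewrite ler_wpM2r ?invr_ge0 ?(ltW n1)//; apply: ler_sum => k _; rewrite xE//.
  have /andP[] := hd _ (du0 k); rewrite (mulKf (lt0r_neq0 d0)) /u pV => [//|].
  by rewrite mulr_ge0 ?rnorm_ge0// ltW.
have h3 := le_trans h2 (concave_mean cg n0 du0).
have S0 : 0 <= (\sum_(k < n) d * u k) / n%:R.
  by rewrite divr_ge0 ?(ltW n1)// sumr_ge0.
have /andP[_ h4] := hd _ S0.
have h5 := le_trans h3 h4.
have h6 : G ((d * ((\sum_(k < n) d * u k) / n%:R)) `^ p^-1) <= G (e * t).
  rewrite orlicz_le ?powR_ge0//.
  have -> : e * t = (d * (d * l `^ p)) `^ p^-1.
    rewrite mulrA powRM ?powR_ge0 ?(ltW dd0)// pV ?(ltW l0)// -/D /l.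
    by field; rewrite !gt_eqF ?weight_gt0.
  apply: ge0_ler_powR; rewrite ?nnegrE.
  - by rewrite invr_ge0 ltW.
  - exact: mulr_ge0 (ltW d0) S0.
  - exact: mulr_ge0 (ltW d0) (mulr_ge0 (ltW d0) (powR_ge0 _ _)).
  rewrite ler_wpM2l ?(ltW d0)// -mulr_sumr -mulrA ler_wpM2l ?(ltW d0)//.
  have -> : \sum_(k < n) u k = l `^ p * \sum_(k < n) rnorm (c k) `^ p.
    rewrite mulr_sumr; apply: eq_bigr => k _; rewrite /u powRM ?rnorm_ge0//; exact: ltW.
  by rewrite -mulrA -[leRHS]mulr1 ler_wpM2l ?powR_ge0.
have h7 := le_trans h5 (le_trans h6 (orlicz_contract G e1 (ltW t0))).
have h8 : \sum_(k < n) G (l * modulus (val x) (i k)) <= n%:R * (e * G t).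
  by rewrite -ler_pdivrMl// mulrC.
apply: le_trans (ler_wpM2l (ltW w00) (le_trans h1 h8)) _.
apply: le_trans Wt.
have -> : w 0%N * (n%:R * (e * G t)) = (n%:R * w 1%N) * G t.
  by rewrite /e; field; rewrite gt_eqF.
rewrite ler_wpM2r ?orlicz_ge0 ?(ltW t0)// mulr_natl -[n in leLHS]card_ord -sumr_const.
by apply: ler_sum => k _; exact: convex_weight.
Qed.

Lemma lorentz_indicator_le n (t : R) (i : nat -> nat) : 0 < t ->
  weight_sum w n * G t <= 1 -> {in gtn n &, injective i} ->
  rnorm (\sum_(k < n) basis_vector (i k) : E) <= t^-1.
Proof.
move=> t0 Wt ii.
rewrite (_ : \sum_(k < n) _ = \sum_(k < n) (1 : K) *: basis_vector (i k)); last first.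
  by apply: eq_bigr => k _; rewrite scale1r.
apply: lorentz_norm_le => // N; set x : E := \sum_(k < n) _.
have xk k kn : val x (i k) = 1 := @val_combination_at _ s G w n i (fun=> 1) k ii kn.
have xs j := @val_combination_support _ s G w n i (fun=> 1) j.
have x1 j : modulus (val x) j <= 1.
  have [->//|/xs[k kn ->]] := eqVneq (modulus (val x) j) 0.
  by rewrite /modulus xk// -of_real1 rnorm_of_real normr1.
apply: le_trans Wt.
pose r k := rearrangement (modulus (val x)) k.
have r1 k : r k <= 1.
  by apply: (@rearrangement_le _ _ _ _ [::]) => // j; rewrite ltNge x1.
have rn k : (n <= k)%N -> r k = 0.
  move=> nk; apply: (@rearrangement_support _ _ [seq i k | k <- iota 0 n]).
  - by move=> j; exact: modulus_ge0.
  - by rewrite size_map size_iota.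
  - move=> j /xs[l ln ->].
    by apply: map_f; rewrite mem_iota.
have r0 k : 0 <= t * r k by rewrite mulr_ge0 ?rearrangement_ge0// ltW.
have Gw k : 0 <= G (t * r k) * w k by rewrite mulr_ge0 ?orlicz_ge0// ltW// weight_gt0.
apply: (@le_trans _ _ (\sum_(k < n) G (t * r k) * w k)).
  rewrite -(big_mkord xpredT (fun k => G (t * r k) * w k)).
  rewrite -[leRHS](big_mkord xpredT (fun k => G (t * r k) * w k)).
  have [Nn|/ltnW nN] := leqP N n.
    by rewrite [leRHS](big_cat_nat (leq0n _) Nn)//= lerDl sumr_ge0.
  rewrite (big_cat_nat (leq0n _) nN)//= gerDl big_nat big1// => k /andP[nk _].
  by rewrite rn// mulr0 orlicz0 mul0r.
rewrite /weight_sum mulr_suml; apply: ler_sum => k _.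
rewrite mulrC ler_wpM2l ?(ltW (weight_gt0 _ _))// orlicz_le//.
by rewrite ler_piMr// ltW.
Qed.

End lorentz_estimates.

(** * Tensor products *)

Section elementary_tensors.
Context {K : fieldType} {E F : lmodType K}.

Fact elementary_tensor_in (x : E) (y : F) : tensor_sum [:: (x, y)] \in @is_tensor K E F.
Proof. by apply/asboolP; exists [:: (x, y)]. Qed.

Definition elementary_tensor (x : E) (y : F) : tensor E F :=
  exist (fun f => f \in @is_tensor K E F) _ (elementary_tensor_in x y).

Lemma elementary_tensorE x y (b : {bilinear E -> F -> K^o}) :
  val (elementary_tensor x y) b = b x y.
Proof. by rewrite /= /tensor_sum big_seq1. Qed.

Lemma elementary_tensorBl x x' y :
  elementary_tensor (x - x') y = elementary_tensor x y - elementary_tensor x' y.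
Proof.
apply/val_inj/funext => b; rewrite elementary_tensorE linearBl.
by rewrite -[RHS]/(val (elementary_tensor x y) b - val (elementary_tensor x' y) b)
  !elementary_tensorE.
Qed.

Lemma elementary_tensorBr x y y' :
  elementary_tensor x (y - y') = elementary_tensor x y - elementary_tensor x y'.
Proof.
apply/val_inj/funext => b; rewrite elementary_tensorE linearBr.
by rewrite -[RHS]/(val (elementary_tensor x y) b - val (elementary_tensor x y') b)
  !elementary_tensorE.
Qed.

Lemma val_tensor_sum I (r : seq I) (P : pred I) (t : I -> tensor E F) b :
  val (\sum_(i <- r | P i) t i) b = \sum_(i <- r | P i) val (t i) b.
Proof. by rewrite raddf_sum fct_sumE. Qed.

Lemma val_matrix_tensor n (P : rel nat) (c : nat -> nat -> K) (x : nat -> E) (y : nat -> F)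
    (b : {bilinear E -> F -> K^o}) :
  val (\sum_(k < n) \sum_(l < n | P k l) c k l *: elementary_tensor (x k) (y l)) b =
  \sum_(k < n) \sum_(l < n | P k l) c k l * b (x k) (y l).
Proof.
rewrite val_tensor_sum; apply: eq_bigr => k _.
rewrite val_tensor_sum; apply: eq_bigr => l _.
by rewrite -[LHS]/(c k l * val (elementary_tensor (x k) (y l)) b) elementary_tensorE.
Qed.

Lemma sum_elementary_tensor n (x : nat -> E) (y : nat -> F) :
  \sum_(k < n) \sum_(l < n) (1 : K) *: elementary_tensor (x k) (y l) =
  elementary_tensor (\sum_(k < n) x k) (\sum_(l < n) y l).
Proof.
apply/val_inj/funext => b.
rewrite (val_matrix_tensor n (fun _ _ => true) (fun _ _ => 1)) elementary_tensorE linear_sumlz.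
apply: eq_bigr => k _; rewrite linear_sumr; apply: eq_bigr => l _.
by rewrite mul1r.
Qed.

Lemma tensor_sumP (t : tensor E F) : exists u, val t = tensor_sum u.
Proof. by have /asboolP[u ->] := valP t; exists u. Qed.

(** Bundling as an existence statement keeps the equations for the form abstract in
    the uses below. *)
Lemma bilinear_exists (b : E -> F -> K^o) :
  (forall y c x x', b (c *: x + x') y = c * b x y + b x' y) ->
  (forall x c y y', b x (c *: y + y') = c * b x y + b x y') ->
  exists B : {bilinear E -> F -> K^o}, forall x y, B x y = b x y.
Proof.
move=> bl br.
have H : bilinear_for *:%R *:%R b.
  by split=> [y c x x'|x c y y'] /=; [exact: bl | exact: br].
pose B : {bilinear E -> F -> K^o} := HB.pack b
  (bilinear_isBilinear.Build K E F K^o *:%R *:%R b H).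
by exists B.
Qed.

Lemma linear_exists (f : E -> K^o) : (forall c x x', f (c *: x + x') = c * f x + f x') ->
  exists g : {linear E -> K^o}, forall x, g x = f x.
Proof.
move=> fl.
have H : linear f by move=> c x x'; exact: fl.
pose g : {linear E -> K^o} := HB.pack f (GRing.isLinear.Build K E K^o *:%R f H).
by exists g.
Qed.

End elementary_tensors.

Section tensor_norm_estimates.
Context {R : realType} {s : scalar_kind}.
Local Notation K := (scalar_field R s).

Lemma unit_ball_bound (V : normedModType K) (f : {linear V -> K^o}) (L : R) :
  (forall x, rnorm x <= 1 -> rnorm (f x : K) <= L) ->
  forall x, rnorm (f x : K) <= L * rnorm x.
Proof.
move=> hf x; have [->|x0] := eqVneq x 0.
  by rewrite linear0 [rnorm (0 : K^o)]rnorm0 rnorm0 mulr0.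
have nx : 0 < rnorm x.
  by rewrite lt_neqAle rnorm_ge0 andbT eq_sym; apply: contra_neq x0 => /rnorm_eq0.
have cK : rnorm (of_real (rnorm x)^-1 : K) = (rnorm x)^-1.
  by rewrite rnorm_of_real ger0_norm ?invr_ge0 ?rnorm_ge0.
have := hf (of_real (rnorm x)^-1 *: x).
rewrite rnormZ cK mulVf ?gt_eqF// => /(_ (lexx _)).
have -> : f (of_real (rnorm x)^-1 *: x) = of_real (rnorm x)^-1 * f x by exact: linearZ.
rewrite rnormM cK.
by rewrite ler_pdivrMl// mulrC.
Qed.

Lemma dual_ball_le (V : normedModType K) (phi : {linear V -> K^o}) x :
  dual_ball phi -> rnorm (phi x : K) <= rnorm x.
Proof. by move=> h; rewrite -[leRHS]mul1r; exact: unit_ball_bound. Qed.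

Context {E F : normedModType K}.

Lemma product_form (phi : {linear E -> K^o}) (psi : {linear F -> K^o}) :
  exists B : {bilinear E -> F -> K^o}, forall x y, B x y = phi x * psi y.
Proof.
apply: (@bilinear_exists _ _ _ (fun x y => phi x * psi y)) => [y c x x'|x c y y'].
  have -> : phi (c *: x + x') = c * phi x + phi x' by exact: linearP.
  by rewrite mulrDl mulrA.
have -> : psi (c *: y + y') = c * psi y + psi y' by exact: linearP.
by rewrite mulrDr mulrCA.
Qed.

Let product_valE (phi : {linear E -> K^o}) (psi : {linear F -> K^o})
    (B : {bilinear E -> F -> K^o}) (t : tensor E F) u :
  (forall x y, B x y = phi x * psi y) -> val t = tensor_sum u ->
  \sum_(p <- u) phi p.1 * psi p.2 = val t B.
Proof. by move=> hB ->; apply: eq_bigr => p _; rewrite hB. Qed.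

Lemma injective_norm_le (t : tensor E F) (M : R) : 0 <= M ->
  (forall (phi : {linear E -> K^o}) (psi : {linear F -> K^o}) (B : {bilinear E -> F -> K^o}),
    dual_ball phi -> dual_ball psi ->
    (forall x y, B x y = phi x * psi y) -> rnorm (val t B : K) <= M) ->
  injective_norm t <= M.
Proof.
move=> M0 h; rewrite /injective_norm.
set S := [set _ | _]; have [->|/set0P S0] := eqVneq S set0; first by rewrite sup0.
apply: ge_sup => // _ [u tu [phi dphi [psi dpsi ->]]].
have [B hB] := product_form phi psi.
by rewrite (product_valE hB tu); exact: h hB.
Qed.

Lemma injective_norm_ge (t : tensor E F) (phi : {linear E -> K^o}) (psi : {linear F -> K^o})
    (B : {bilinear E -> F -> K^o}) : dual_ball phi -> dual_ball psi ->
  (forall x y, B x y = phi x * psi y) -> rnorm (val t B : K) <= injective_norm t.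
Proof.
move=> dphi dpsi hB; have [u tu] := tensor_sumP t.
apply: ub_le_sup; last first.
  by exists u => //; exists phi => //; exists psi => //; rewrite (product_valE hB tu).
exists (\sum_(p <- u) rnorm p.1 * rnorm p.2) => _ [v tv [phi' dphi' [psi' dpsi' ->]]].
have [B' hB'] := product_form phi' psi'.
rewrite (product_valE hB' tv) -(product_valE hB' tu) (le_trans (rnorm_sum _ _ _))//.
apply: ler_sum => p _; rewrite rnormM ler_pM ?rnorm_ge0//; exact: dual_ball_le.
Qed.

Lemma injective_norm_elementary (x : E) (y : F) :
  injective_norm (elementary_tensor x y) <= rnorm x * rnorm y.
Proof.
apply: injective_norm_le => [|phi psi B dphi dpsi hB]; first by rewrite mulr_ge0 ?rnorm_ge0.
by rewrite elementary_tensorE hB rnormM ler_pM ?rnorm_ge0//; exact: dual_ball_le.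
Qed.

Lemma projective_norm_elementary (x : E) (y : F) :
  projective_norm (elementary_tensor x y) <= rnorm x * rnorm y.
Proof.
apply: ge_inf; last by exists [:: (x, y)] => //; rewrite big_seq1.
by exists 0 => _ [u _ ->]; apply: sumr_ge0 => p _; rewrite mulr_ge0 ?rnorm_ge0.
Qed.

(** The projective norm is dual to bounded bilinear forms. *)
Lemma projective_norm_ge (t : tensor E F) (B : {bilinear E -> F -> K^o}) (L : R) : 0 < L ->
  (forall x y, rnorm x <= 1 -> rnorm y <= 1 -> rnorm (B x y : K) <= L) ->
  rnorm (val t B : K) <= L * projective_norm t.
Proof.
move=> L0 hB.
have B1 x y : rnorm x <= 1 -> rnorm (B x y : K) <= L * rnorm y.
  by move=> x1; apply: (unit_ball_bound (f := B x)) => z; exact: hB.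
have B2 x y : rnorm (B x y : K) <= L * rnorm y * rnorm x.
  by apply: (unit_ball_bound (f := applyr B y)) => z; exact: B1.
rewrite mulrC -ler_pdivrMr//; apply: lb_le_inf.
  by have [u tu] := tensor_sumP t; exists (\sum_(p <- u) rnorm p.1 * rnorm p.2), u.
move=> _ [u tu ->]; rewrite ler_pdivrMr// tu /tensor_sum (le_trans (rnorm_sum _ _ _))//.
rewrite mulr_suml; apply: ler_sum => p _.
by rewrite (le_trans (B2 _ _))// le_eqVlt; apply/orP; left; apply/eqP; ring.
Qed.

Theorem triangle_tensor (nu : tensor E F -> R) (X : completeNormedModType K) :
  completion nu X -> embeds_in_unconditional_basis_space X ->
  forall (x : nat -> E) (y : nat -> F) (M : R),
  (forall i j, nu (elementary_tensor (x i) (y j)) <= M) ->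
  exists2 C : R, 0 < C & forall n (d : R), 0 < d -> exists u v : nat -> nat * nat,
  [/\ increasing_pairs u n, increasing_pairs v n &
    forall (c : nat -> nat -> K) (z : nat -> nat -> tensor E F),
    (forall k l, rnorm (c k l) <= 1) ->
    (forall k l, z k l = elementary_tensor (x (u k).1 - x (u k).2) (y (v l).1 - y (v l).2)) ->
    nu (\sum_(k < n) \sum_(l < n | (k <= l)%N) c k l *: z k l) <=
    C * nu (\sum_(k < n) \sum_(l < n) c k l *: z k l) + d].
Proof.
move=> [j jnu _] [Y [e [ue [T [c0 [C0 [c00 C00 hT]]]]]]] x y M hM.
have [C C1 hC] := triangle_projection ue.
pose S : {linear tensor E F -> Y} := T \o j.
have Sle t : rnorm (S t) <= C0 * nu t by rewrite -jnu; have /andP[] := hT (j t).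
have Sge t : c0 * nu t <= rnorm (S t) by rewrite -jnu; have /andP[] := hT (j t).
exists (C * C0 / c0); first by rewrite divr_gt0// mulr_gt0.
move=> n d d0.
have [||u [v [iu iv huv]]] := hC (fun i j => S (elementary_tensor (x i) (y j))) (C0 * M) _ n (c0
  * d).
- by move=> i k; rewrite (le_trans (Sle _))// ler_wpM2l// ltW.
- by rewrite mulr_gt0.
exists u, v; split; [exact: iu | exact: iv | move=> c z c1 hz].
have zE k l : second_difference (fun i j => S (elementary_tensor (x i) (y j))) (u k) (v l) = S
  (z k l).
  by rewrite /second_difference hz elementary_tensorBr !elementary_tensorBl !linearB.
rewrite -(ler_pM2l c00) (le_trans (Sge _))//.
have := huv c c1.
under eq_bigr => k _ do under eq_bigr => l _ do rewrite zE -linearZ.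
under [X in C * rnorm X]eq_bigr => k _ do under eq_bigr => l _ do rewrite zE -linearZ.
under eq_bigr => k _ do rewrite -linear_sum.
under [X in C * rnorm X]eq_bigr => k _ do rewrite -linear_sum.
rewrite -!linear_sum => /le_trans; apply.
rewrite mulrDr lerD2r.
rewrite (_ : c0 * _ = C * (C0 * nu (\sum_(k < n) \sum_(l < n) c k l *: z k l))).
  by rewrite ler_wpM2l ?(ltW C1).
by field; rewrite gt_eqF.
Qed.

End tensor_norm_estimates.

(** * Differences of unit vectors, duality and exponents *)

Section increasing_pairs_theory.
Context {u : nat -> nat * nat} {n : nat}.
Hypothesis iu : increasing_pairs u n.

Let pair_lt k l : (k < n)%N -> (l < n)%N -> (k < l)%N ->
  [/\ ((u k).1 < (u l).1)%N, ((u k).2 < (u l).1)%N, ((u k).1 < (u l).2)%N & ((u k).2 < (u l).2)%N].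
Proof.
move=> kn ln kl; have [i1 i2] := iu.
have := i1 k kn; have := i1 l ln; have := i2 k l; rewrite kl ln => /(_ isT).
by move=> ? ? ?; split; lia.
Qed.

Lemma increasing_pairs_inj1 : {in gtn n &, injective (fun k => (u k).1)}.
Proof.
move=> k l; rewrite !inE => kn ln kl; have [h|h|//] := ltngtP k l.
  by have [] := pair_lt kn ln h; lia.
by have [] := pair_lt ln kn h; lia.
Qed.

Lemma increasing_pairs_inj2 : {in gtn n &, injective (fun k => (u k).2)}.
Proof.
move=> k l; rewrite !inE => kn ln kl; have [h|h|//] := ltngtP k l.
  by have [] := pair_lt kn ln h; lia.
by have [] := pair_lt ln kn h; lia.
Qed.

Lemma increasing_pairs_neq k l : (k < n)%N -> (l < n)%N -> (u k).1 != (u l).2.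
Proof.
move=> kn ln; have [i1 _] := iu; have := i1 k kn.
have [h|h|->] := ltngtP k l; last by lia.
  by have [] := pair_lt kn ln h; lia.
by have [] := pair_lt ln kn h; lia.
Qed.

End increasing_pairs_theory.

Section differences.
Context {R : realType} {s : scalar_kind} {G : orlicz_function R} {w : weight_sequence R}.
Local Notation K := (scalar_field R s).
Local Notation E := (orlicz_lorentz s G w).

Definition basis_difference (p : nat * nat) : E := basis_vector p.1 - basis_vector p.2.

Lemma val_basis_difference u n k l : increasing_pairs u n -> (k < n)%N -> (l < n)%N ->
  val (basis_difference (u l)) (u k).1 = (k == l)%:R :> K.
Proof.
move=> iu kn ln.
rewrite -[LHS]/(((u k).1 == (u l).1)%:R - ((u k).1 == (u l).2)%:R).
rewrite (negbTE (increasing_pairs_neq iu kn ln)) subr0.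
have -> // : ((u k).1 == (u l).1) = (k == l).
by apply/eqP/eqP => [/(increasing_pairs_inj1 iu)|->//]; apply.
Qed.

Lemma basis_vector_bounded : exists2 M : R, 0 < M & forall j, rnorm (basis_vector j : E) <= M.
Proof.
have [t t0 /andP[h _]] := orlicz_level G (@weight_sum_gt0 _ w 1 isT).
exists t^-1; first by rewrite invr_gt0.
move=> j; have := @lorentz_indicator_le _ s G w 1 t (fun=> j) t0 h; rewrite big_ord1; apply.
by move=> [|k] [|l].
Qed.

Lemma combination_difference_le n u (c : nat -> K) (D : R) : increasing_pairs u n ->
  (forall i : nat -> nat, {in gtn n &, injective i} ->
    rnorm (\sum_(k < n) c k *: basis_vector (i k) : E) <= D) ->
  rnorm (\sum_(k < n) c k *: basis_difference (u k)) <= 2 * D.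
Proof.
move=> iu h.
have -> : \sum_(k < n) c k *: basis_difference (u k) =
    \sum_(k < n) c k *: basis_vector (u k).1 - \sum_(k < n) c k *: basis_vector (u k).2.
  by rewrite -sumrB; apply: eq_bigr => k _; rewrite scalerBr.
rewrite (le_trans (rnormB _ _))// mulr_natl mulr2n lerD//.
  exact: (h (fun k => (u k).1) (increasing_pairs_inj1 iu)).
exact: (h (fun k => (u k).2) (increasing_pairs_inj2 iu)).
Qed.

End differences.

Section duality.
Context {R : realType} {s : scalar_kind}.
Local Notation K := (scalar_field R s).

Lemma rnormV (x : K) : rnorm x^-1 = (rnorm x)^-1.
Proof.
have [->|x0] := eqVneq x 0; first by rewrite invr0 rnorm0 invr0.
have nx : rnorm x != 0 by apply: contra_neq x0 => /rnorm_eq0.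
apply: (mulfI nx); rewrite -rnormM divff// divff//.
by rewrite -of_real1 rnorm_of_real normr1.
Qed.

(** Duality between [L_r] and [L_r'], tested on the coefficients
    [c k] proportional to [|a k| ^ r / a k], the extremal ones in Hölder's
    inequality. *)
Lemma functional_moment (E : normedModType K) (r r' : R) n (d : nat -> E) (D : R)
    (phi : {linear E -> K^o}) : 1 < r -> r^-1 + r'^-1 = 1 -> (0 < n)%N -> 0 < D ->
  (forall c : nat -> K, (\sum_(k < n) rnorm (c k) `^ r') / n%:R <= 1 ->
    rnorm (\sum_(k < n) c k *: d k) <= D) ->
  dual_ball phi ->
  (\sum_(k < n) rnorm (phi (d k) : K) `^ r) / n%:R <= (D / n%:R) `^ r.
Proof.
move=> r1 rr' n0 D0 hd dphi.
have r0 : 0 < r by exact: lt_trans ltr01 r1.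
have r'1 := conjugate_gt1 r1 rr'; have r'0 : 0 < r' by exact: lt_trans ltr01 r'1.
have n1 : 0 < n%:R :> R by rewrite ltr0n.
pose a k : K := phi (d k); pose S := (\sum_(k < n) rnorm (a k) `^ r) / n%:R.
rewrite -/S.
have S0 : 0 <= S by rewrite divr_ge0 ?(ltW n1)// sumr_ge0// => k _; rewrite powR_ge0.
have Dn : 0 <= D / n%:R by rewrite ltW// divr_gt0.
move: S0; rewrite le_eqVlt => /predU1P[<-|S0]; first exact: powR_ge0.
(* normalises the coefficients in L_r' *)
pose q := S `^ r'^-1; have q0 : 0 < q by rewrite powR_gt0.
have qr' : q `^ r' = S by rewrite -powRrM mulVf ?gt_eqF// powRr1// ltW.
pose c k : K := of_real (rnorm (a k) `^ r / q) * (a k)^-1.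
have cn k : rnorm (c k) = rnorm (a k) `^ (r - 1) / q.
  rewrite rnormM rnormV rnorm_of_real ger0_norm; last by rewrite divr_ge0 ?powR_ge0// ltW.
  have [a0|a0] := eqVneq (rnorm (a k)) 0.
    by rewrite a0 powR0 ?gt_eqF// powR0 ?mul0r// subr_eq0 gt_eqF.
  rewrite -(mulr_powRB1 (rnorm_ge0 _) r0).
  by field; rewrite a0 gt_eqF.
have c1 : (\sum_(k < n) rnorm (c k) `^ r') / n%:R <= 1.
  rewrite (_ : \sum_(k < n) _ = (\sum_(k < n) rnorm (a k) `^ r) / S).
    rewrite mulrAC -/S divff// gt_eqF//.
  rewrite mulr_suml; apply: eq_bigr => k _.
  rewrite cn powRM ?powR_ge0 ?invr_ge0 ?(ltW q0)// -powRrM.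
  congr (_ * _).
    congr (_ `^ _).
    have h : r'^-1 = (r - 1) / r.
      have -> : r'^-1 = 1 - r^-1 by rewrite -rr' addrAC subrr add0r.
      by field; rewrite gt_eqF.
    have r10 : 0 < r - 1 by rewrite subr_gt0.
    by rewrite -[X in _ * X]invrK h; field; rewrite !gt_eqF.
  by rewrite -powR_inv1 ?(ltW q0)// -powRrM mulN1r powRN qr'.
have := le_trans (dual_ball_le _ dphi) (hd c c1).
have -> : phi (\sum_(k < n) c k *: d k) = of_real (n%:R * S / q).
  rewrite linear_sum /S mulrCA divff ?gt_eqF// mulr1 mulr_suml of_real_sum.
  apply: eq_bigr => k _.
  have -> : phi (c k *: d k) = c k * a k by exact: linearZ.
  rewrite /c; have [a0|a0] := eqVneq (a k) 0.
    by rewrite a0 mulr0 rnorm0 powR0 ?gt_eqF// mul0r of_real0.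
  by rewrite -mulrA mulVf// mulr1.
rewrite rnorm_of_real ger0_norm; last exact: ltW (divr_gt0 (mulr_gt0 n1 S0) q0).
have -> : n%:R * S / q = n%:R * S `^ r^-1.
  rewrite -mulrA; congr (_ * _); apply: (mulIf (lt0r_neq0 q0)); rewrite divfK ?gt_eqF//.
  by rewrite -powRD ?rr' ?powRr1 ?(ltW S0)// oner_eq0.
move=> h.
have -> : S = (S `^ r^-1) `^ r by rewrite -powRrM mulVf ?gt_eqF// powRr1// ltW.
rewrite ge0_ler_powR ?nnegrE ?powR_ge0 ?(ltW r0)//.
by rewrite ler_pdivlMr// mulrC.
Qed.

End duality.

Section exponents.
Context {R : realType}.
Implicit Types p q : R.

Lemma real_conjugate p : 1 < p -> p^-1 + (p / (p - 1))^-1 = 1.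
Proof.
move=> p1; have p0 : 0 < p by exact: lt_trans ltr01 p1.
have p10 : 0 < p - 1 by rewrite subr_gt0.
by field; rewrite !gt_eqF.
Qed.

Lemma hoelder_conjugateE p : 1 < p -> hoelder_conjugate p%:E = (p / (p - 1))%:E.
Proof.
move=> p1; have p0 : 0 < p by exact: lt_trans ltr01 p1.
by rewrite /hoelder_conjugate/= eqe gt_eqF// -EFinB inver subr_eq0 gt_eqF.
Qed.

(** For [q > 1] take [r = q].  For [q = 1] any finite exponent [r' >= p] above one
    will do. *)
Lemma exponents_below_conjugate p q : 1 <= p -> 1 <= q -> (q%:E <= hoelder_conjugate p%:E)%E ->
  exists r r' : R, [/\ 1 < r, r^-1 + r'^-1 = 1, p <= r' & q <= r].
Proof.
move=> p1; rewrite le_eqVlt => /predU1P[<- _|q1].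
  pose a := Num.max p 2.
  have a1 : 1 < a by rewrite lt_max ltr1n orbT.
  exists (a / (a - 1)), a; split.
  - by rewrite ltr_pdivlMr ?subr_gt0// mul1r gtrBl.
  - by rewrite addrC real_conjugate.
  - by rewrite le_max lexx.
  - by rewrite ler_pdivlMr ?subr_gt0// mul1r gerBl.
move=> qp; exists q, (q / (q - 1)); split=> //; first exact: real_conjugate.
rewrite ler_pdivlMr ?subr_gt0//.
move: p1 qp; rewrite le_eqVlt => /predU1P[<- _|p1]; first by rewrite mul1r gerBl.
rewrite hoelder_conjugateE// lee_fin ler_pdivlMr ?subr_gt0//.
by rewrite !mulrBr !mulr1 !lerBlDr mulrC [p + q]addrC.
Qed.

End exponents.

(** * The two tensor products *)

Section injective_case.
Context {R : realType} {s : scalar_kind}.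
Local Notation K := (scalar_field R s).

Lemma val_linear {G : orlicz_function R} {w : weight_sequence R} (c : K)
    (x x' : orlicz_lorentz s G w) j : val (c *: x + x') j = c * val x j + val x' j :> K.
Proof. by []. Qed.

Lemma sum_forms_exist {G : orlicz_function R} {w : weight_sequence R} n (u : nat -> nat * nat)
  (a : R) :
  exists phi : {linear orlicz_lorentz s G w -> K^o},
    forall x, phi x = of_real a * \sum_(k < n) (val x (u k).1 : K).
Proof.
apply: (@linear_exists _ _ (fun x : orlicz_lorentz s G w =>
  of_real a * \sum_(k < n) (val x (u k).1 : K))) => c x x'.
rewrite (_ : \sum_(k < n) _ = c * (\sum_(k < n) (val x (u k).1 : K)) +
  \sum_(k < n) (val x' (u k).1 : K)); first by rewrite mulrDr mulrCA.
by rewrite mulr_sumr -big_split; apply: eq_bigr => k _; exact: val_linear.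
Qed.

(** The estimate from below with exponent one: the mean over [n] coordinates is a
    functional of norm at most [L * t]. *)
Lemma mean_functional {G : orlicz_function R} {w : weight_sequence R} :
  exists2 L : R, 0 < L & forall n (t : R) u, (0 < n)%N -> 0 < t ->
    1 <= weight_sum w n * G (2 * t) -> increasing_pairs u n ->
    exists2 phi : {linear orlicz_lorentz s G w -> K^o}, dual_ball phi &
      forall l, (l < n)%N -> phi (basis_difference (u l)) = of_real (L * t * n%:R)^-1.
Proof.
have [L L0 hL] := @lorentz_mean _ s G w 1 (lexx _) equivalent_to_convex1.
exists L => // n t u n0 t0 Wt iu.
have n1 : 0 < n%:R :> R by rewrite ltr0n.
have a0 : 0 < L * t * n%:R by rewrite !mulr_gt0.
have [phi hphi] := @sum_forms_exist G w n u (L * t * n%:R)^-1.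
exists phi => [x x1|l ln].
  have := hL n t n0 t0 Wt _ (increasing_pairs_inj1 iu) x x1.
  rewrite powRr1; last by rewrite ltW// mulr_gt0.
  under eq_bigr => k _ do rewrite powRr1 ?rnorm_ge0//.
  rewrite ler_pdivrMr// => h.
  rewrite hphi rnormM rnorm_of_real ger0_norm ?invr_ge0 ?(ltW a0)//.
  by rewrite ler_pdivrMl// mulr1 (le_trans (rnorm_sum _ _ _)).
rewrite hphi -[RHS]mulr1; congr (_ * _).
rewrite (eq_bigr (fun k : 'I_n => (k == l :> nat)%:R)); last first.
  by move=> k _; exact: (val_basis_difference iu).
rewrite (bigD1 (Ordinal ln))//= eqxx big1 ?addr0// => k kl.
by rewrite (_ : (k == l :> nat) = false)//; apply/negbTE.
Qed.

(** The value [kappa] on the mean functionals bounds the norm of the triangle of the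
    dyadic matrix from below; [eta] is chosen so that the truncation bound gives
    at most [kappa / 4 + kappa / 2]. *)
Theorem injective_not_embeds (G1 G2 : orlicz_function R) (w1 w2 : weight_sequence R)
    (p q r r' : R) : 1 <= p -> 1 <= q -> 1 < r -> r^-1 + r'^-1 = 1 -> p <= r' -> q <= r ->
  equivalent_to_concave (fun t => G1 (t `^ p^-1)) ->
  equivalent_to_concave (fun t => G2 (t `^ q^-1)) ->
  convex_on_positive_nat (weight_sum w1) -> convex_on_positive_nat (weight_sum w2) ->
  forall X : completeNormedModType K,
    injective_tensor_product (orlicz_lorentz s G1 w1) (orlicz_lorentz s G2 w2) X ->
  ~ embeds_in_unconditional_basis_space X.
Proof.
move=> p1 q1 r1 rr' pr qr eG1 eG2 cw1 cw2 X cX eX.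
have r'1 := conjugate_gt1 r1 rr'.
have [C1 C10 hC1] := @lorentz_combination_le _ s G1 w1 p r' p1 pr eG1 cw1.
have [C2 C20 hC2] := @lorentz_combination_le _ s G2 w2 q r q1 qr eG2 cw2.
have [L1 L10 hL1] := @mean_functional G1 w1.
have [L2 L20 hL2] := @mean_functional G2 w2.
have [M1 M10 hM1] := @basis_vector_bounded _ s G1 w1.
have [M2 M20 hM2] := @basis_vector_bounded _ s G2 w2.
have [|C C0 hC] := triangle_tensor cX eX (x := basis_vector) (y := basis_vector) (M := M1 * M2).
  move=> i j; rewrite (le_trans (injective_norm_elementary _ _))//.
  by rewrite ler_pM ?rnorm_ge0.
have P0 : 0 < C * C1 * C2 * L1 * L2 by rewrite !mulr_gt0.
pose eta := (64 * (C * C1 * C2 * L1 * L2))^-1.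
have eta0 : 0 < eta by rewrite invr_gt0 mulr_gt0.
have [m m0 hm] := dyadic_form_scalars s r1 rr' eta0.
pose n := (2 ^ m)%N; have n0 : (0 < n)%N by rewrite expn_gt0.
have n1 : 0 < n%:R :> R by rewrite ltr0n.
have nE : n%:R = 2 ^+ m :> R by rewrite natrX.
have [t1 t10 /andP[Wt1 Wt1']] := orlicz_level G1 (@weight_sum_gt0 _ w1 n n0).
have [t2 t20 /andP[Wt2 Wt2']] := orlicz_level G2 (@weight_sum_gt0 _ w2 n n0).
have m1 : 0 < m%:R :> R by rewrite ltr0n.
pose a := (L1 * t1 * n%:R)^-1; pose b := (L2 * t2 * n%:R)^-1.
have a0 : 0 < a by rewrite invr_gt0 !mulr_gt0.
have b0 : 0 < b by rewrite invr_gt0 !mulr_gt0.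
pose kappa := m%:R * n%:R / 4 * (a * b).
have kappa0 : 0 < kappa by rewrite !mulr_gt0.
have [u [v [iu iv huv]]] := hC n (kappa / 2) (divr_gt0 kappa0 (ltr0n _ 2)).
pose c k l : K := of_real (dyadic_matrix m k l).
pose z k l : tensor (orlicz_lorentz s G1 w1) (orlicz_lorentz s G2 w2) :=
  elementary_tensor (basis_difference (u k)) (basis_difference (v l)).
have c1 k l : rnorm (c k l) <= 1 by rewrite rnorm_of_real dyadic_matrix_le1.
have := huv c z c1 (fun _ _ => erefl).
have [phi dphi hphi] := hL1 n t1 u n0 t10 Wt1' iu.
have [psi dpsi hpsi] := hL2 n t2 v n0 t20 Wt2' iv.
have [B hB] := product_form phi psi.
have lower : kappa <= injective_norm (\sum_(k < n) \sum_(l < n | (k <= l)%N) c k l *: z k l).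
  apply: le_trans (injective_norm_ge _ dphi dpsi hB).
  rewrite (_ : val _ B = of_real kappa) ?rnorm_of_real ?ler_norm//.
  transitivity (\sum_(k < n) \sum_(l < n | (k <= l)%N)
      c k l * B (basis_difference (u k)) (basis_difference (v l))).
    exact: (@val_matrix_tensor _ _ _ n leq c (basis_difference \o u) (basis_difference \o v)).
  rewrite /kappa nE -dyadic_upper mulr_suml of_real_sum; apply: eq_bigr => k _.
  rewrite mulr_suml of_real_sum; apply: eq_bigr => l _.
  by rewrite hB hphi// hpsi// /c !of_realM.
have upper : injective_norm (\sum_(k < n) \sum_(l < n) c k l *: z k l) <=
    eta * (m%:R * 2 ^+ m) * ((2 * (C1 / t1) / n%:R) * (2 * (C2 / t2) / n%:R)).
  have x0 : 0 < 2 * (C1 / t1) / n%:R by rewrite divr_gt0// mulr_gt0// divr_gt0.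
  have y0 : 0 < 2 * (C2 / t2) / n%:R by rewrite divr_gt0// mulr_gt0// divr_gt0.
  apply: injective_norm_le.
    have mn0 : 0 <= m%:R * 2 ^+ m :> R by rewrite mulr_ge0// exprn_ge0.
    exact: mulr_ge0 (mulr_ge0 (ltW eta0) mn0) (mulr_ge0 (ltW x0) (ltW y0)).
  move=> f g B' df dg hB'.
  rewrite (_ : val _ B' = \sum_(k < n) \sum_(l < n)
      c k l * (f (basis_difference (u k)) * g (basis_difference (v l)))); last first.
    rewrite (@val_matrix_tensor _ _ _ n (fun _ _ => true) c (basis_difference \o u)
      (basis_difference \o v) B').
    by apply: eq_bigr => k _; apply: eq_bigr => l _; rewrite hB'.
  apply: (hm (fun k => f (basis_difference (u k))) (fun l => g (basis_difference (v l))) _ _ x0 y0).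
    rewrite /dyadic_mean -nE.
    apply: (@functional_moment _ _ _ r r' n (fun k => basis_difference (u k))) => //.
      by rewrite mulr_gt0// divr_gt0.
    move=> d hd; apply: combination_difference_le => // i ii.
    exact: hC1.
  rewrite /dyadic_mean -nE; 
  apply: (@functional_moment _ _ _ r' r n (fun k => basis_difference (v k))) => //.
  - by rewrite addrC.
  - by rewrite mulr_gt0// divr_gt0.
  - move=> d hd; apply: combination_difference_le => // i ii.
    exact: hC2.
apply/negP; rewrite -ltNge.
apply: lt_le_trans lower.
apply: (@le_lt_trans _ _ (C * (eta * (m%:R * 2 ^+ m) *
   ((2 * (C1 / t1) / n%:R) * (2 * (C2 / t2) / n%:R))) + kappa / 2)).
  by rewrite lerD2r ler_wpM2l// ltW.
have -> : C * (eta * (m%:R * 2 ^+ m) *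
   ((2 * (C1 / t1) / n%:R) * (2 * (C2 / t2) / n%:R))) = kappa / 4.
  rewrite /eta /kappa /a /b -nE; field.
  by rewrite !gt_eqF.
lra.
Qed.

End injective_case.

Section projective_case.
Context {R : realType} {s : scalar_kind}.
Local Notation K := (scalar_field R s).

Lemma lorentz_mean_lower {G : orlicz_function R} {w : weight_sequence R} (p q : R) :
  1 <= p -> p <= q -> equivalent_to_convex (fun t => G (t `^ q^-1)) ->
  exists2 L : R, 0 < L & forall n (t : R), (0 < n)%N -> 0 < t ->
    1 <= weight_sum w n * G (2 * t) ->
    forall i : nat -> nat, {in gtn n &, injective i} ->
    forall x : orlicz_lorentz s G w, rnorm x <= 1 ->
    (\sum_(k < n) rnorm (val x (i k) : K) `^ p) / n%:R <= (L * t) `^ p.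
Proof.
move=> p1 pq eG; have p0 : 0 < p by exact: lt_le_trans ltr01 p1.
have [L L0 hL] := @lorentz_mean _ s G w q (le_trans p1 pq) eG.
exists L => // n t n0 t0 Wt i ii x x1.
have Lt0 : 0 < L * t by rewrite mulr_gt0.
have scale (y : R) : (\sum_(k < n) ((L * t)^-1 * rnorm (val x (i k) : K)) `^ y) / n%:R =
    (\sum_(k < n) rnorm (val x (i k) : K) `^ y) / n%:R / (L * t) `^ y.
  rewrite [RHS]mulrAC; congr (_ / _); rewrite mulr_suml; apply: eq_bigr => k _.
  have LtV : 0 <= (L * t)^-1 by rewrite invr_ge0 ltW.
  rewrite (powRM y LtV (rnorm_ge0 _)) mulrC; congr (_ * _).
  by rewrite -powR_inv1 ?(ltW Lt0)// -powRrM mulN1r powRN.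
have := @power_mean_le1 _ p q n (fun k => (L * t)^-1 * rnorm (val x (i k) : K)) p0 pq n0.
have scale_le1 y a : (a / (L * t) `^ y <= 1) = (a <= (L * t) `^ y).
  by rewrite ler_pdivrMr ?powR_gt0// mul1r.
rewrite !scale !scale_le1; apply; last exact: hL.
by move=> k; rewrite mulr_ge0 ?rnorm_ge0// invr_ge0 ltW.
Qed.

Lemma matrix_form_exists {G1 G2 : orlicz_function R} {w1 w2 : weight_sequence R} n
    (a : nat -> nat -> K) (u v : nat -> nat * nat) :
  exists B : {bilinear orlicz_lorentz s G1 w1 -> orlicz_lorentz s G2 w2 -> K^o},
    forall x y, B x y = \sum_(k < n) \sum_(l < n)
      a k l * ((val x (u k).1 : K) * (val y (v l).1 : K)).
Proof.
apply: (@bilinear_exists _ _ _ (fun (x : orlicz_lorentz s G1 w1) (y : orlicz_lorentz s G2 w2) =>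
  \sum_(k < n) \sum_(l < n) a k l * ((val x (u k).1 : K) * (val y (v l).1 : K)))).
  move=> y c x x'; rewrite mulr_sumr -big_split; apply: eq_bigr => k _.
  rewrite mulr_sumr -big_split; apply: eq_bigr => l _.
  by rewrite (val_linear c x x') mulrDl mulrDr -mulrA [a k l * (c * _)]mulrCA.
move=> x c y y'; rewrite mulr_sumr -big_split; apply: eq_bigr => k _.
rewrite mulr_sumr -big_split; apply: eq_bigr => l _.
rewrite (val_linear c y y') !mulrDr; congr (_ + _).
by rewrite (mulrCA _ c) (mulrCA _ c).
Qed.

(** The dyadic form has norm at most [Q] and takes the value [m n / 4] on the triangle
    of the all-ones matrix; [eta] is chosen so that the truncation bound gives at
    most [m n / 8]. *)
Theorem projective_not_embeds (G1 G2 : orlicz_function R) (w1 w2 : weight_sequence R)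
    (p q r r' : R) : 1 < r -> r^-1 + r'^-1 = 1 -> r <= p -> r' <= q ->
  equivalent_to_convex (fun t => G1 (t `^ p^-1)) ->
  equivalent_to_convex (fun t => G2 (t `^ q^-1)) ->
  forall X : completeNormedModType K,
    projective_tensor_product (orlicz_lorentz s G1 w1) (orlicz_lorentz s G2 w2) X ->
  ~ embeds_in_unconditional_basis_space X.
Proof.
move=> r1 rr' rp rq eG1 eG2 X cX eX.
have r'1 := conjugate_gt1 r1 rr'.
have [L1 L10 hL1] := @lorentz_mean_lower G1 w1 r p (ltW r1) rp eG1.
have [L2 L20 hL2] := @lorentz_mean_lower G2 w2 r' q (ltW r'1) rq eG2.
have [M1 M10 hM1] := @basis_vector_bounded _ s G1 w1.
have [M2 M20 hM2] := @basis_vector_bounded _ s G2 w2.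
have [|C C0 hC] := triangle_tensor cX eX (x := basis_vector) (y := basis_vector) (M := M1 * M2).
  move=> i j; rewrite (le_trans (projective_norm_elementary _ _))//.
  by rewrite ler_pM ?rnorm_ge0.
have P0 : 0 < L1 * L2 * (4 * C + 1) by rewrite !mulr_gt0// addr_gt0// mulr_gt0.
pose eta := (8 * (L1 * L2 * (4 * C + 1)))^-1.
have eta0 : 0 < eta by rewrite invr_gt0 mulr_gt0.
have [m m0 hm] := dyadic_form_scalars s r1 rr' eta0.
pose n := (2 ^ m)%N; have n0 : (0 < n)%N by rewrite expn_gt0.
have n1 : 0 < n%:R :> R by rewrite ltr0n.
have nE : n%:R = 2 ^+ m :> R by rewrite natrX.
have [t1 t10 /andP[Wt1 Wt1']] := orlicz_level G1 (@weight_sum_gt0 _ w1 n n0).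
have [t2 t20 /andP[Wt2 Wt2']] := orlicz_level G2 (@weight_sum_gt0 _ w2 n n0).
have m1 : 0 < m%:R :> R by rewrite ltr0n.
have tt0 : 0 < (t1 * t2)^-1 by rewrite invr_gt0 mulr_gt0.
have [u [v [iu iv huv]]] := hC n (t1 * t2)^-1 tt0.
pose z k l : tensor (orlicz_lorentz s G1 w1) (orlicz_lorentz s G2 w2) :=
  elementary_tensor (basis_difference (u k)) (basis_difference (v l)).
have one1 : rnorm (1 : K) <= 1 by rewrite -of_real1 rnorm_of_real normr1.
have := huv (fun _ _ => 1) z (fun _ _ => one1) (fun _ _ => erefl).
set U := \sum_(k < n) \sum_(l < n | (k <= l)%N) _.
pose Q := eta * (m%:R * 2 ^+ m) * (L1 * t1 * (L2 * t2)).
have Q0 : 0 < Q by rewrite !mulr_gt0// exprn_gt0.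
have [B hB] := @matrix_form_exists G1 G2 w1 w2 n (fun k l => of_real (dyadic_matrix m k l)) u v.
have lower : m%:R * n%:R / 4 <= Q * projective_norm U.
  have BQ x y : rnorm x <= 1 -> rnorm y <= 1 -> rnorm (B x y : K) <= Q.
    move=> x1 y1; rewrite hB.
    apply: (hm (fun k => val x (u k).1) (fun l => val y (v l).1)).
    - exact: mulr_gt0.
    - exact: mulr_gt0.
    - rewrite /dyadic_mean -nE.
      exact: (hL1 n t1 n0 t10 Wt1' _ (increasing_pairs_inj1 iu)).
    - rewrite /dyadic_mean -nE.
      exact: (hL2 n t2 n0 t20 Wt2' _ (increasing_pairs_inj1 iv)).
  apply: le_trans (projective_norm_ge U Q0 BQ).
  rewrite nE -dyadic_upper -[leLHS]ger0_norm.
    rewrite -(rnorm_of_real (s := s)) le_eqVlt; apply/orP; left; apply/eqP; congr rnorm.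
    transitivity (\sum_(k < n) \sum_(l < n | (k <= l)%N)
      1 * B (basis_difference (u k)) (basis_difference (v l))); last first.
      apply/esym; exact: (@val_matrix_tensor _ _ _ n leq (fun _ _ => 1)
        (basis_difference \o u) (basis_difference \o v)).
    rewrite of_real_sum; apply: eq_bigr => k _.
    rewrite of_real_sum; apply: eq_bigr => l _.
    rewrite mul1r hB.
    rewrite (eq_bigr (fun i : 'I_n => \sum_(j < n) of_real (dyadic_matrix m i j) *
      ((i == k :> nat)%:R * (j == l :> nat)%:R))); last first.
      move=> i _; apply: eq_bigr => j _; congr (_ * (_ * _)).
        exact: (val_basis_difference iu).
      exact: (val_basis_difference iv).
    rewrite (bigD1 k)//= [X in _ + X]big1 ?addr0; last first.
      move=> i ik; rewrite big1// => j _.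
      by rewrite (_ : (i == k :> nat) = false) ?mul0r ?mulr0//; apply/negbTE.
    rewrite (bigD1 l)//= [X in _ + X]big1 ?addr0; last first.
      move=> j jl.
      by rewrite (_ : (j == l :> nat) = false) ?mulr0//; apply/negbTE.
    by rewrite !eqxx !mulr1.
  by rewrite dyadic_upper divr_ge0// mulr_ge0// exprn_ge0.
have upper : projective_norm (\sum_(k < n) \sum_(l < n) (1 : K) *: z k l) <= 4 / (t1 * t2).
  rewrite (sum_elementary_tensor n (fun k => basis_difference (u k)) (fun l => basis_difference
    (v l))).
  apply: le_trans (projective_norm_elementary _ _) _.
  rewrite (_ : 4 / (t1 * t2) = (2 * t1^-1) * (2 * t2^-1)); last first.
    by field; rewrite !gt_eqF.
  have half (G : orlicz_function R) (w : weight_sequence R) (t : R) (d : nat -> nat * nat) :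
      0 < t -> weight_sum w n * G t <= 1 -> increasing_pairs d n ->
      rnorm (\sum_(k < n) basis_difference (d k) : orlicz_lorentz s G w) <= 2 * t^-1.
    move=> t0 Wt id.
    rewrite (_ : \sum_(k < n) _ = \sum_(k < n) (1 : K) *: basis_difference (d k)).
      apply: (@combination_difference_le _ s G w n d (fun=> 1)) => // i ii.
      under eq_bigr do rewrite scale1r.
      exact: lorentz_indicator_le.
    by apply: eq_bigr => k _; rewrite scale1r.
  by rewrite ler_pM ?rnorm_ge0// half.
apply/negP; rewrite -ltNge.
rewrite -(ltr_pM2l Q0); apply: lt_le_trans lower.
apply: (@le_lt_trans _ _ (Q * (C * (4 / (t1 * t2)) + (t1 * t2)^-1))).
  by rewrite ler_wpM2l ?(ltW Q0)// lerD2r ler_wpM2l// ltW.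
have -> : Q * (C * (4 / (t1 * t2)) + (t1 * t2)^-1) = m%:R * n%:R / 8.
  rewrite /Q /eta -nE; field.
  by rewrite !gt_eqF// addr_gt0// mulr_gt0.
have : 0 < m%:R * n%:R :> R by rewrite mulr_gt0.
lra.
Qed.

End projective_case.

Theorem theorem6p7 (R : realType) (s : scalar_kind)
    (G1 G2 : orlicz_function R) (w1 w2 : weight_sequence R) :
  separable_space (orlicz_lorentz s G1 w1) -> separable_space (orlicz_lorentz s G2 w2) ->
  (forall p q : R, 1 <= p -> 1 <= q -> (q%:E <= hoelder_conjugate p%:E)%E ->
     equivalent_to_concave (fun t => G1 (t `^ p^-1)) ->
     equivalent_to_concave (fun t => G2 (t `^ q^-1)) ->
     convex_on_positive_nat (weight_sum w1) ->
     convex_on_positive_nat (weight_sum w2) ->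
     forall X : completeNormedModType (scalar_field R s),
       injective_tensor_product
         (orlicz_lorentz s G1 w1) (orlicz_lorentz s G2 w2) X ->
       ~ embeds_in_unconditional_basis_space X) /\
  (forall p q : R, 1 < p -> 1 < q -> (hoelder_conjugate p%:E <= q%:E)%E ->
     equivalent_to_convex (fun t => G1 (t `^ p^-1)) ->
     equivalent_to_convex (fun t => G2 (t `^ q^-1)) ->
     concave_on_positive_nat (weight_sum w1) ->
     concave_on_positive_nat (weight_sum w2) ->
     forall X : completeNormedModType (scalar_field R s),
       projective_tensor_product
         (orlicz_lorentz s G1 w1) (orlicz_lorentz s G2 w2) X ->
       ~ embeds_in_unconditional_basis_space X).
Proof.
move=> _ _; split=> p q p1 q1 pq.
  have [r [r' [r1 rr' pr qr]]] := exponents_below_conjugate p1 q1 pq.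
  exact: injective_not_embeds r1 rr' pr qr.
move=> eG1 eG2 _ _ X cX.
have rq : p / (p - 1) <= q by move: pq; rewrite hoelder_conjugateE.
exact: projective_not_embeds p1 (real_conjugate p1) (lexx p) rq eG1 eG2 X cX.
Qed.
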